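(* The comultiplication $\Delta$ of $\hat U_q$ satisfies the following identities of formal series in $z$ (respectively $z^{-1}$) with coefficients in $\hat U_q\otimes\hat U_q$: $$\sum_{k\ge 0}\Delta(x_k)(zc\otimes c^2)^{-k}=1\otimes X_0^+(c^2z)+\sum_{n\ge 0}\bigl(-q(q-q^{-1})^2\bigr)^n X_0^+(cz)^{n+1}\otimes Y^+(q^2cz)^n\,\Psi(c^{3/2}z);$$ $$\sum_{k\ge 1}\Delta(x_{-k})(zc\otimes 1)^{k}=1\otimes X^-(z)+\sum_{n\ge 0}\bigl(-q(q-q^{-1})^2\bigr)^n X^-(cz)^{n+1}\otimes Y_0^-(q^2cz)^n\,\Phi(c^{1/2}z);$$ $$\sum_{k\ge 1}\Delta(y_{k})(z\otimes c)^{-k}=Y^+(z)\otimes 1+\sum_{n\ge 0}\bigl(-q^{-1}(q-q^{-1})^2\bigr)^n\, \Psi(c^{1/2}z)X_0^+(q^2cz)^{n}\otimes Y^+(cz)^{n+1};$$ $$\sum_{k\ge 0}\Delta(y_{-k})(zc^2\otimes c)^{k}=Y_0^-(c^2z)\otimes 1+\sum_{n\ge 0}\bigl(-q^{-1}(q-q^{-1})^2\bigr)^n\, \Phi(c^{3/2}z)X^-(q^2cz)^{n}\otimes Y_0^-(cz)^{n+1};$$ $$\sum_{k\ge 0}\Delta(\psi_{k})(zc^{1/2}\otimes c^{3/2})^{-k}=\sum_{n\ge 0}(-1)^n(q-q^{-1})^{2n}[n+1]\,\Psi(c^{1/2}z)X_0^+(q^2cz)^{n}\otimes Y^+(q^2cz)^{n}\Psi(c^{3/2}z);$$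 $$\sum_{k\ge 0}\Delta(\phi_{-k})(zc^{3/2}\otimes c^{1/2})^{k}=\sum_{n\ge 0}(-1)^n(q-q^{-1})^{2n}[n+1]\,\Phi(c^{3/2}z)X^-(q^2cz)^{n}\otimes Y_0^-(q^2cz)^{n}\Phi(c^{1/2}z).$$
   Context: Let $q$ be an indeterminate, and for integers $n\ge r\ge 0$ put $[n]=\frac{q^n-q^{-n}}{q-q^{-1}}$ (this formula is used for any integer $n$), $[n]!=[n][n-1]\cdots[1]$, $[0]!=1$, $\left[{n\atop r}\right]=\frac{[n]!}{[n-r]!\,[r]!}$. The Hopf algebra $U_q(\hat{\mathfrak{sl}}_2)$ is the associative $\mathbb{C}(q)$-algebra with generators $e_i^\pm,k_i^{\pm1}$ ($i\in\{0,1\}$), $c^{\pm1/2}$ and relations: $(c^{\pm1/2})^2=(k_0k_1)^{\pm1}$, $c^{1/2}$ central, $k_ik_i^{-1}=k_i^{-1}k_i=1$, $k_ik_j=k_jk_i$, $k_ie_i^\pm k_i^{-1}=q^{\pm2}e_i^\pm$, $k_ie_j^\pm k_i^{-1}=q^{\mp2}e_j^\pm$ ($i\ne j$), $[e_i^+,e_j^-]=\delta_{ij}\frac{k_i-k_i^{-1}}{q-q^{-1}}$, $\sum_{r=0}^3(-1)^r\left[{3\atop r}\right](e_i^\pm)^re_j^\pm(e_i^\pm)^{3-r}=0$ ($i\neq j$). Its comultiplication is $\Delta(e_i^+)=e_i^+\otimes k_i+1\otimes e_i^+$, $\Delta(e_i^-)=e_i^-\otimes1+k_i^{-1}\otimes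 e_i^-$, $\Delta(k_i)=k_i\otimes k_i$, $\Delta(c^{\pm1/2})=c^{\pm1/2}\otimes c^{\pm1/2}$. $\hat U_q$ is the $\mathbb{C}(q)$-algebra with generators $x_n,y_n$ ($n\in\mathbb{Z}$), $h_k$ ($k\in\mathbb{Z}\setminus\{0\}$), $K^{\pm1}$, $c^{\pm1/2}$ and defining relations: $KK^{-1}=K^{-1}K=1$; $c^{1/2}c^{-1/2}=c^{-1/2}c^{1/2}=1$ and $c^{1/2}$ is central; $[h_m,h_n]=\delta_{m,-n}\frac{[2m]}{m}\frac{c^m-c^{-m}}{q-q^{-1}}$; $Kh_m=h_mK$; $Kx_mK^{-1}=q^2x_m$, $Ky_mK^{-1}=q^{-2}y_m$; $[h_m,x_n]=\frac{[2m]}{m}c^{-|m|/2}x_{m+n}$; $[h_m,y_n]=-\frac{[2m]}{m}c^{|m|/2}y_{m+n}$; $x_{m+1}x_n-q^2x_nx_{m+1}=q^2x_mx_{n+1}-x_{n+1}x_m$; $y_{m+1}y_n-q^{-2}y_ny_{m+1}=q^{-2}y_my_{n+1}-y_{n+1}y_m$; $[x_m,y_n]=\frac{c^{(m-n)/2}\psi_{m+n}-c^{-(m-n)/2}\phi_{m+n}}{q-q^{-1}}$; where $\psi_{-m}=0=\phi_m$ for $m>0$ and $\psi_m,\phi_{-m}$ ($m\ge0$) are given by $\sum_{m\ge0}\psi_mz^{-m}=K\exp\bigl((q-q^{-1})\sum_{m\ge1}h_mz^{-m}\bigr)$ and $\sum_{m\ge0}\phi_{-m}z^m=K^{-1}\exp\bigl(-(q-q^{-1})\sum_{m\ge1}h_{-m}z^m\bigr)$.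 Here $c^{k/2}=(c^{1/2})^k$, $c=(c^{1/2})^2$. By a known theorem (Drinfeld, Beck) $U_q(\hat{\mathfrak{sl}}_2)\cong\hat U_q$ via $c^{\pm1/2}\mapsto c^{\pm1/2}$, $k_0\mapsto cK^{-1}$, $k_1\mapsto K$, $e_1^+\mapsto x_0$, $e_1^-\mapsto y_0$, $e_0^+\mapsto y_1K^{-1}$, $e_0^-\mapsto Kx_{-1}$. The comultiplication $\Delta$ of $\hat U_q$ is the one transported through this isomorphism (so e.g. $\Delta(x_0)=x_0\otimes K+1\otimes x_0$, $\Delta(y_1)=y_1\otimes c+K\otimes y_1$). Generating functions, for an indeterminate $z$ (commuting with everything): $X^+(z)=\sum_{k\ge1}x_kz^{-k}$, $X_0^+(z)=x_0+X^+(z)$, $X^-(z)=\sum_{k\ge1}x_{-k}z^k$, $X_0^-(z)=x_0+X^-(z)$, $Y^+(z)=\sum_{k\ge1}y_kz^{-k}$, $Y_0^+(z)=y_0+Y^+(z)$, $Y^-(z)=\sum_{k\ge1}y_{-k}z^k$, $Y_0^-(z)=y_0+Y^-(z)$, $\Psi(z)=\sum_{k\ge0}\psi_kz^{-k}$, $\Phi(z)=\sum_{k\ge0}\phi_{-k}z^k$. Expressions such as $X_0^+(q^2cz)$ or $\Psi(c^{1/2}z)$ mean substitution of $q^2cz$, $c^{1/2}z$, etc. for $z$; inside a tensor product, the central element $c$ belongs to the tensor factor in which it is written, and $(zc\otimes c^2)^{-k}=z^{-k}c^{-k}\otimes c^{-2k}$, etc. *)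

(* Defs.v *)
From HB Require Import structures.
From mathcomp Require Import all_boot all_order all_algebra.
From mathcomp Require Import finmap monalg boolp reals complex.
From mathcomp Require classical_sets.

Set Implicit Arguments.
Unset Strict Implicit.
Unset Printing Implicit Defensive.

Import GRing.Theory.

Local Open Scope ring_scope.
Local Open Scope quotient_scope.

Reserved Notation "a ⊗ b" (at level 45, left associativity).
Reserved Notation "f ⊠ g" (at level 45, left associativity).

(* The two-sided ideal generated by the differences u - v with [rel u v]. *)
Section Ideal.
Variables (F : fieldType) (A : algType F) (rel : A -> A -> Prop).

Inductive ideal : A -> Prop :=
| ideal0 : ideal 0
| ideal_rel a b u v : rel u v -> ideal (a * (u - v) * b)
| idealD a b : ideal a -> ideal b -> ideal (a + b).

Lemma idealM a b u : ideal u -> ideal (a * u * b).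
Proof.
elim=> [|c d v w vw|v w _ iv _ iw]; first by rewrite mulr0 mul0r; exact: ideal0.
  by rewrite !mulrA -(mulrA _ d b); exact: ideal_rel.
by rewrite mulrDr mulrDl; exact: idealD.
Qed.

Lemma idealZ k u : ideal u -> ideal (k *: u).
Proof. by move=> /(idealM k%:A 1); rewrite mulr1 mulr_algl. Qed.

Lemma idealN u : ideal u -> ideal (- u).
Proof. by rewrite -scaleN1r; exact: idealZ. Qed.

Definition ideal_eq (a b : A) := `[< ideal (a - b) >].

Lemma ideal_eq_refl : reflexive ideal_eq.
Proof. by move=> a; apply/asboolP; rewrite subrr; exact: ideal0. Qed.

Lemma ideal_eq_sym : symmetric ideal_eq.
Proof. by move=> a b; apply/asboolP/asboolP => /idealN; rewrite opprB. Qed.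

Lemma ideal_eq_trans : transitive ideal_eq.
Proof.
move=> b a c /asboolP ab /asboolP bc; apply/asboolP.
by move: (idealD ab bc); rewrite addrA subrK.
Qed.

Canonical ideal_equiv := EquivRel ideal_eq ideal_eq_refl ideal_eq_sym
  ideal_eq_trans.

End Ideal.

(* The hypothesis only serves to equip the quotient with the library's
   algebra structure, which excludes the zero ring. *)
Definition quot_alg (F : fieldType) (A : algType F) (rel : A -> A -> Prop)
    (proper : ~ ideal rel 1) : Type :=
  {eq_quot (ideal_equiv rel)}.

Section QuotAlg.
Variables (F : fieldType) (A : algType F) (rel : A -> A -> Prop).
Variable proper : ~ ideal rel 1.
Local Notation Q := (quot_alg proper).

HB.instance Definition _ := Choice.on Q.

Definition qcls (a : A) : Q := \pi_({eq_quot (ideal_equiv rel)}) a.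
Definition qrep (x : Q) : A := repr (x : {eq_quot (ideal_equiv rel)}).

Lemma qrepK x : qcls (qrep x) = x.
Proof. exact: reprK. Qed.

Lemma qclsP a b : qcls a = qcls b <-> ideal rel (a - b).
Proof.
by split=> [/eqP|ab]; last apply/eqP; rewrite eqmodE; [move/asboolP | apply/asboolP].
Qed.

Lemma qcls_rel u v : rel u v -> qcls u = qcls v.
Proof.
move=> uv; apply/qclsP; rewrite -[u - v]mul1r -[_ * (u - v)]mulr1.
exact: ideal_rel.
Qed.

Lemma qrepP a : ideal rel (qrep (qcls a) - a).
Proof. by apply/qclsP; rewrite qrepK. Qed.

Let qadd (x y : Q) := qcls (qrep x + qrep y).
Let qopp (x : Q) := qcls (- qrep x).
Let qmul (x y : Q) := qcls (qrep x * qrep y).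
Let qscale (k : F) (x : Q) := qcls (k *: qrep x).

Let qaddE a b : qadd (qcls a) (qcls b) = qcls (a + b).
Proof. by apply/qclsP; rewrite opprD addrACA; apply: idealD; exact: qrepP. Qed.

Let qoppE a : qopp (qcls a) = qcls (- a).
Proof. by apply/qclsP; rewrite -opprD; apply: idealN; exact: qrepP. Qed.

Let qmulE a b : qmul (qcls a) (qcls b) = qcls (a * b).
Proof.
apply/qclsP; set a' := qrep _; set b' := qrep _.
have -> : a' * b' - a * b = 1 * (a' - a) * b' + a * (b' - b) * 1.
  by rewrite mul1r mulr1 mulrBl mulrBr addrA subrK.
by apply: idealD; apply: idealM; exact: qrepP.
Qed.

Let qscaleE k a : qscale k (qcls a) = qcls (k *: a).
Proof. by apply/qclsP; rewrite -scalerBr; apply: idealZ; exact: qrepP. Qed.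

Let qE := (qaddE, qoppE, qmulE, qscaleE).

Let qaddA : associative qadd.
Proof.
by move=> x y z; rewrite -(qrepK x) -(qrepK y) -(qrepK z) !qE addrA.
Qed.
Let qaddC : commutative qadd.
Proof. by move=> x y; rewrite -(qrepK x) -(qrepK y) !qE addrC. Qed.
Let qadd0 : left_id (qcls 0) qadd.
Proof. by move=> x; rewrite -(qrepK x) !qE add0r. Qed.
Let qaddN : left_inverse (qcls 0) qopp qadd.
Proof. by move=> x; rewrite -(qrepK x) !qE addNr. Qed.

HB.instance Definition _ := GRing.isZmodule.Build Q qaddA qaddC qadd0 qaddN.

Let qmulA : associative qmul.
Proof.
by move=> x y z; rewrite -(qrepK x) -(qrepK y) -(qrepK z) !qE mulrA.
Qed.
Let qmul1l : left_id (qcls 1) qmul.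
Proof. by move=> x; rewrite -(qrepK x) !qE mul1r. Qed.
Let qmul1r : right_id (qcls 1) qmul.
Proof. by move=> x; rewrite -(qrepK x) !qE mulr1. Qed.
Let qmulDl : left_distributive qmul +%R.
Proof.
by move=> x y z; rewrite -(qrepK x) -(qrepK y) -(qrepK z) /GRing.add /= !qE mulrDl.
Qed.
Let qmulDr : right_distributive qmul +%R.
Proof.
by move=> x y z; rewrite -(qrepK x) -(qrepK y) -(qrepK z) /GRing.add /= !qE mulrDr.
Qed.
Let qone_neq0 : qcls 1 != 0.
Proof. by apply/eqP => /qclsP; rewrite subr0. Qed.

HB.instance Definition _ := GRing.Zmodule_isNzRing.Build Q
  qmulA qmul1l qmul1r qmulDl qmulDr qone_neq0.

Let qscaleA a b x : qscale a (qscale b x) = qscale (a * b) x.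
Proof. by rewrite -(qrepK x) !qE scalerA. Qed.
Let qscale1 : left_id 1 qscale.
Proof. by move=> x; rewrite -(qrepK x) !qE scale1r. Qed.
Let qscaleDr : right_distributive qscale +%R.
Proof.
by move=> k x y; rewrite -(qrepK x) -(qrepK y) /GRing.add /= !qE scalerDr.
Qed.
Let qscaleDl x : {morph qscale^~ x : a b / a + b}.
Proof.
move=> a b; rewrite -(qrepK x) [in RHS]/GRing.add /= !qE.
by rewrite scalerDl.
Qed.

HB.instance Definition _ := GRing.Zmodule_isLmodule.Build F Q
  qscaleA qscale1 qscaleDr qscaleDl.

Lemma qcls_linear : linear qcls.
Proof.
by move=> k a b; rewrite [in RHS]/GRing.scale [in RHS]/GRing.add /= !qE.
Qed.

HB.instance Definition _ := GRing.isLinear.Build F A Q _ qcls qcls_linear.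

Lemma qcls_monoid_morphism : monoid_morphism qcls.
Proof. by split=> // a b; rewrite [in RHS]/GRing.mul /= !qE. Qed.

HB.instance Definition _ := GRing.isMonoidMorphism.Build A Q qcls
  qcls_monoid_morphism.

Let qscaleAl k (x y : Q) : k *: (x * y) = k *: x * y.
Proof.
rewrite -(qrepK x) -(qrepK y) -rmorphM -!linearZ -rmorphM.
by rewrite scalerAl.
Qed.

HB.instance Definition _ := GRing.Lmodule_isLalgebra.Build F Q qscaleAl.

Let qscaleAr k (x y : Q) : k *: (x * y) = x * (k *: y).
Proof.
rewrite -(qrepK x) -(qrepK y) -rmorphM -!linearZ -rmorphM.
by rewrite scalerAr.
Qed.

HB.instance Definition _ := GRing.Lalgebra_isAlgebra.Build F Q qscaleAr.

End QuotAlg.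

Definition free_alg (F : fieldType) (G : choiceType) : Type :=
  {malg F[{fmonom G}]}.

Section FreeAlg.
Variables (F : fieldType) (G : choiceType).
Local Notation A := (free_alg F G).

HB.instance Definition _ := GRing.Lalgebra.on A.

Let free_scaleAr k (x y : A) : k *: (x * y) = x * (k *: y).
Proof.
rewrite -[x * y]/((x : {malg F[{fmonom G}]}) * y).
rewrite -[x * (k *: y)]/((x : {malg F[{fmonom G}]}) * (k *: (y : {malg F[{fmonom G}]}))).
rewrite malgME (malgMEw (fsubset_refl _) (msuppZ_le k y)).
rewrite scaler_sumr; apply: eq_bigr => i _; rewrite scaler_sumr.
apply: eq_bigr => j _; rewrite mcoeffZ mulrCA.
by apply/malgP => l; rewrite mcoeffZ !mcoeffU mulrnAr.
Qed.

HB.instance Definition _ := GRing.Lalgebra_isAlgebra.Build F A free_scaleAr.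

Definition fgen (i : G) : A := mkmalgU (fmu i) 1.

Section Counit.
Variable e : G -> F.

Definition fmon_eval (m : fmonom G) : F := \prod_(i <- (m : seq G)) e i.

Lemma fmon_eval_mmorphism : mmorphism fmon_eval.
Proof.
by split=> [m n|]; rewrite /fmon_eval ?fmM ?big_cat // fm1 big_nil.
Qed.

HB.instance Definition _ := monalg.isMultiplicative.Build (fmonom G) F fmon_eval
  fmon_eval_mmorphism.

Definition free_character (a : A) : F := mmap idfun fmon_eval a.

Lemma free_characterU i : free_character (fgen i) = e i.
Proof. by rewrite /free_character mmapU /= mul1r /fmon_eval fmU big_seq1. Qed.

Lemma free_character_rmorph : monoid_morphism free_character.
Proof. by split=> [|a b]; [exact: rmorph1 | exact: rmorphM]. Qed.

Lemma free_character_linear : linear_for *%R free_character.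
Proof. by move=> k a b; exact: linearP. Qed.

HB.instance Definition _ := GRing.isLinear.Build F A F *%R free_character
  free_character_linear.
HB.instance Definition _ := GRing.isMonoidMorphism.Build A F free_character
  free_character_rmorph.

End Counit.

End FreeAlg.

Lemma ideal_proper (F : fieldType) (A : algType F) (rel : A -> A -> Prop)
    (f : {rmorphism A -> F}) :
  (forall u v, rel u v -> f u = f v) -> ~ ideal rel 1.
Proof.
move=> frel i1; suff: f 1 = 0 by rewrite rmorph1 => /eqP; rewrite oner_eq0.
elim: i1 => [|a b u v /frel uv|a b _ fa _ fb]; rewrite ?rmorph0 //.
  by rewrite !rmorphM rmorphB uv subrr mulr0 mul0r.
by rewrite rmorphD fa fb addr0.
Qed.

(* A functional normalised at 1; it shows that A ⊗ B is not the zero ring. *)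
Lemma unit_functional (F : fieldType) (A : algType F) :
  exists2 l : A -> F, linear_for *%R l & l 1 = 1.
Proof.
pose closed (W : classical_sets.set A) :=
  [/\ forall a b, W a -> W b -> W (a + b), forall k a, W a -> W (k *: a) & ~ W 1].
have [|W [[WD WZ W1] maxW]] := @classical_sets.Zorn_bigcup A closed.
  move=> S clS totS; split.
  - move=> a b [X SX Xa] [Y SY Yb].
    have [XY|YX] := totS _ _ SX SY.
      by exists Y => //; have [+ _ _] := clS _ SY; apply=> //; exact: XY.
    by exists X => //; have [+ _ _] := clS _ SX; apply=> //; exact: YX.
  - by move=> k a [X SX Xa]; exists X => //; have [_ + _] := clS _ SX; apply.
  - by move=> [X SX X1]; have [_ _] := clS _ SX.
pose V a := W a \/ a = 0.
have VD a b : V a -> V b -> V (a + b).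
  move=> [Wa|->] [Wb|->]; rewrite ?add0r ?addr0; rewrite /V; auto.
have VZ k a : V a -> V (k *: a).
  by move=> [Wa|->]; [left; exact: WZ | right; rewrite scaler0].
have V1 : ~ V 1 by move=> [//|/eqP]; rewrite oner_eq0.
have dec a : exists s : F, V (a - s%:A).
  have [Wa|nWa] := pselect (W a); first by exists 0; left; rewrite scale0r subr0.
  pose W' : classical_sets.set A := fun c => exists w t, V w /\ c = w + t *: a.
  have W'1 : W' 1.
    apply: contrapT => nW'1; apply: (maxW W'); last first.
      split=> // [c d [w [t [Vw ->]]] [w' [t' [Vw' ->]]]|k c [w [t [Vw ->]]]].
        by exists (w + w'), (t + t'); split; [exact: VD | rewrite addrACA scalerDl].
      by exists (k *: w), (k * t); split; [exact: VZ | rewrite scalerDr scalerA].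
    split=> [c Wc|sW']; first by exists c, 0; split; [left | rewrite scale0r addr0].
    by apply: nWa; apply: sW'; exists 0, 1; split; [right | rewrite scale1r add0r].
  have [w [t [Vw e]]] := W'1.
  have t0 : t != 0.
    by apply/eqP => t0; apply: V1; rewrite e t0 scale0r addr0.
  exists t^-1; rewrite e scalerDr scalerA mulVf // scale1r opprD addrCA subrr addr0.
  by rewrite -scaleN1r; apply/VZ/VZ.
pose l a := projT1 (cid (dec a)).
have lP a : V (a - (l a)%:A) by rewrite /l; case: cid.
have lu a s : V (a - s%:A) -> l a = s.
  move=> Vs; apply/eqP/negPn/negP; rewrite -subr_eq0 => d0; apply: V1.
  have := VD _ _ (VZ (-1) _ (lP a)) Vs.
  rewrite scaleN1r opprB addrA subrK -scalerBl => /(VZ (l a - s)^-1).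
  by rewrite scalerA mulVf // scale1r.
exists l; last by apply: lu; right; rewrite scale1r subrr.
move=> k a b; apply: lu.
have := VD _ _ (VZ k _ (lP a)) (lP b).
by rewrite scalerBr scalerA addrACA -opprD -scalerDl.
Qed.

Local Notation bilin f := (bilinear_for *:%R *:%R f).

(* A list of pairs (a_i, b_i) stands for the sum of the a_i ⊗ b_i; two such
   sums are identified when every bilinear map takes the same value on them. *)
Section TensorRel.
Variables (F : fieldType) (A B : algType F).

Definition bsum (W : lmodType F) (f : A -> B -> W) (s : seq (A * B)) : W :=
  \sum_(p <- s) f p.1 p.2.

Definition tensor_eq (s t : seq (A * B)) :=
  `[< forall (W : lmodType F) (f : A -> B -> W), bilin f -> bsum f s = bsum f t >].

Lemma tensor_eq_refl : reflexive tensor_eq.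
Proof. by move=> s; apply/asboolP. Qed.

Lemma tensor_eq_sym : symmetric tensor_eq.
Proof. by move=> s t; apply/asboolP/asboolP => st W f /st. Qed.

Lemma tensor_eq_trans : transitive tensor_eq.
Proof.
move=> t s u /asboolP st /asboolP tu; apply/asboolP => W f fb.
by rewrite st // tu.
Qed.

Canonical tensor_equiv := EquivRel tensor_eq tensor_eq_refl tensor_eq_sym
  tensor_eq_trans.

End TensorRel.

Definition tensor (F : fieldType) (A B : algType F) : Type :=
  {eq_quot (tensor_equiv A B)}.

Section Tensor.
Variables (F : fieldType) (A B : algType F).
Local Notation T := (tensor A B).

HB.instance Definition _ := Choice.on T.

Let tcls (s : seq (A * B)) : T := \pi_({eq_quot (tensor_equiv A B)}) s.

Definition tens (a : A) (b : B) : T := tcls [:: (a, b)].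

(* The linear map T -> W induced by f, when f is bilinear. *)
Definition tens_lift (W : lmodType F) (f : A -> B -> W) (t : T) : W :=
  bsum f (repr (t : {eq_quot (tensor_equiv A B)})).

Let liftE (W : lmodType F) (f : A -> B -> W) s : bilin f -> tens_lift f (tcls s) = bsum f s.
Proof.
move=> fb; have /eqmodP /asboolP : repr (tcls s : {eq_quot _}) = s
  %[mod {eq_quot (tensor_equiv A B)}] by rewrite reprK.
exact.
Qed.

Lemma tens_liftE (W : lmodType F) (f : A -> B -> W) a b : bilin f ->
  tens_lift f (tens a b) = f a b.
Proof. by move=> fb; rewrite liftE // /bsum big_seq1. Qed.

Lemma tens_ext (t u : T) :
  (forall (W : lmodType F) (f : A -> B -> W), bilin f ->
    tens_lift f t = tens_lift f u) -> t = u.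
Proof.
move=> tu; rewrite -[t](@reprK _ {eq_quot (tensor_equiv A B)}).
rewrite -[u](@reprK _ {eq_quot (tensor_equiv A B)}).
by apply/eqmodP/asboolP => W f /tu.
Qed.

Let tadd (t u : T) := tcls (repr (t : {eq_quot _}) ++ repr (u : {eq_quot _})).
Let tscale (k : F) (t : T) :=
  tcls [seq (k *: p.1, p.2) | p <- repr (t : {eq_quot _})].
Let tmul (t u : T) :=
  tcls [seq (p.1 * r.1, p.2 * r.2) |
    p <- repr (t : {eq_quot _}), r <- repr (u : {eq_quot _})].

Let lift0 (W : lmodType F) (f : A -> B -> W) : bilin f -> tens_lift f (tcls [::]) = 0.
Proof. by move=> fb; rewrite liftE // /bsum big_nil. Qed.

Let liftD (W : lmodType F) (f : A -> B -> W) t u : bilin f ->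
  tens_lift f (tadd t u) = tens_lift f t + tens_lift f u.
Proof. by move=> fb; rewrite liftE // /bsum big_cat. Qed.

Let liftZ (W : lmodType F) (f : A -> B -> W) k t : bilin f ->
  tens_lift f (tscale k t) = k *: tens_lift f t.
Proof.
move=> fb; rewrite liftE // /bsum big_map /tens_lift /bsum scaler_sumr.
by apply: eq_bigr => p _ /=; rewrite (scalable_linear (fb.1 p.2)).
Qed.

Let bilin_mul (W : lmodType F) (f : A -> B -> W) u : bilin f ->
  bilin (fun a b => tens_lift (fun a' b' => f (a * a') (b * b')) u).
Proof.
move=> fb; split=> [b k a a'|a k b b'] /=;
  rewrite /tens_lift /bsum scaler_sumr -big_split; apply: eq_bigr => p _ /=.
- by rewrite mulrDl -scalerAl (fb.1 _ _).
- by rewrite mulrDl -scalerAl (fb.2 _ _).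
Qed.

Let bilin_mul1 (W : lmodType F) (f : A -> B -> W) a b : bilin f ->
  bilin (fun a' b' => f (a * a') (b * b')).
Proof.
move=> fb; split=> [b' k a1 a2|a' k b1 b2].
- by rewrite mulrDr -scalerAr (fb.1 _ _).
- by rewrite mulrDr -scalerAr (fb.2 _ _).
Qed.

Let liftM (W : lmodType F) (f : A -> B -> W) t u : bilin f ->
  tens_lift f (tmul t u) =
    tens_lift (fun a b => tens_lift (fun a' b' => f (a * a') (b * b')) u) t.
Proof. by move=> fb; rewrite liftE // /bsum big_allpairs_dep. Qed.

Let eq_lift (W : lmodType F) (f g : A -> B -> W) t :
  (forall a b, f a b = g a b) -> tens_lift f t = tens_lift g t.
Proof. by move=> fg; apply: eq_bigr => p _; exact: fg. Qed.

Let taddA : associative tadd.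
Proof. by move=> t u v; apply: tens_ext => W f fb; rewrite !liftD // addrA. Qed.
Let taddC : commutative tadd.
Proof. by move=> t u; apply: tens_ext => W f fb; rewrite !liftD // addrC. Qed.
Let tadd0 : left_id (tcls [::]) tadd.
Proof. by move=> t; apply: tens_ext => W f fb; rewrite liftD // lift0 // add0r. Qed.
Let taddN : left_inverse (tcls [::]) (tscale (-1)) tadd.
Proof.
move=> t; apply: tens_ext => W f fb.
by rewrite liftD // liftZ // lift0 // scaleN1r addNr.
Qed.

HB.instance Definition _ := GRing.isZmodule.Build T taddA taddC tadd0 taddN.

Let tmulA : associative tmul.
Proof.
move=> t u v; apply: tens_ext => W f fb; rewrite !liftM //; last exact: bilin_mul.
apply: eq_lift => a b; rewrite liftM; last exact: bilin_mul1.
by do 2 apply: eq_lift => ? ?; rewrite !mulrA.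
Qed.
Let tmul1l : left_id (tens 1 1) tmul.
Proof.
move=> t; apply: tens_ext => W f fb; rewrite liftM // tens_liftE; last exact: bilin_mul.
by apply: eq_lift => a b; rewrite !mul1r.
Qed.
Let tmul1r : right_id (tens 1 1) tmul.
Proof.
move=> t; apply: tens_ext => W f fb; rewrite liftM //.
by apply: eq_lift => a b; rewrite tens_liftE ?mulr1 //; exact: bilin_mul1.
Qed.
Let tmulDl : left_distributive tmul +%R.
Proof.
move=> t u v; apply: tens_ext => W f fb; rewrite liftM // !liftD ?liftM //.
exact: bilin_mul.
Qed.
Let tmulDr : right_distributive tmul +%R.
Proof.
move=> t u v; apply: tens_ext => W f fb; rewrite liftM // !liftD ?liftM //.
rewrite -big_split; apply: eq_bigr => p _ /=.
by rewrite liftD //; exact: bilin_mul1.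
Qed.
Let tone_neq0 : tens 1 1 != 0.
Proof.
have [l llin l1] := unit_functional A; have [m mlin m1] := unit_functional B.
pose f a b : F^o := l a * m b.
have fb : bilin f.
  split=> [b k a a'|a k b b']; rewrite /f ?llin ?mlin.
    by rewrite mulrDl -mulrA.
  by rewrite mulrDr mulrCA.
apply/eqP => /(congr1 (tens_lift f)); rewrite tens_liftE // lift0 //.
by rewrite /f l1 m1 mulr1 => /eqP; rewrite oner_eq0.
Qed.

HB.instance Definition _ := GRing.Zmodule_isNzRing.Build T
  tmulA tmul1l tmul1r tmulDl tmulDr tone_neq0.

Let tscaleA a b t : tscale a (tscale b t) = tscale (a * b) t.
Proof. by apply: tens_ext => W f fb; rewrite !liftZ // scalerA. Qed.
Let tscale1 : left_id 1 tscale.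
Proof. by move=> t; apply: tens_ext => W f fb; rewrite !liftZ // scale1r. Qed.
Let tscaleDr : right_distributive tscale +%R.
Proof.
by move=> k t u; apply: tens_ext => W f fb; rewrite !(liftZ, liftD) // scalerDr.
Qed.
Let tscaleDl t : {morph tscale^~ t : a b / a + b}.
Proof.
by move=> a b; apply: tens_ext => W f fb; rewrite !(liftZ, liftD) // scalerDl.
Qed.

HB.instance Definition _ := GRing.Zmodule_isLmodule.Build F T
  tscaleA tscale1 tscaleDr tscaleDl.

Let tscaleAl k (t u : T) : k *: (t * u) = k *: t * u.
Proof.
apply: tens_ext => W f fb; rewrite liftZ // !liftM // liftZ //.
exact: bilin_mul.
Qed.

HB.instance Definition _ := GRing.Lmodule_isLalgebra.Build F T tscaleAl.

Let tscaleAr k (t u : T) : k *: (t * u) = t * (k *: u).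
Proof.
apply: tens_ext => W f fb; rewrite liftZ // !liftM // scaler_sumr.
by apply: eq_bigr => p _ /=; rewrite liftZ //; exact: bilin_mul1.
Qed.

HB.instance Definition _ := GRing.Lalgebra_isAlgebra.Build F T tscaleAr.

Lemma tens_lift_linear (W : lmodType F) (f : A -> B -> W) : bilin f -> linear (tens_lift f).
Proof. by move=> fb k t u; rewrite liftD // liftZ. Qed.

Lemma tens_bilin : bilin tens.
Proof.
split=> [b k a a'|a k b b']; apply: tens_ext => W f fb;
  rewrite liftD // liftZ // !tens_liftE //; [exact: fb.1 | exact: fb.2].
Qed.

Lemma tens1 : tens 1 1 = 1.
Proof. by []. Qed.

Lemma tensM a b a' b' : tens a b * tens a' b' = tens (a * a') (b * b').
Proof.
apply: tens_ext => W f fb; rewrite liftM // !tens_liftE //.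
  exact: bilin_mul1.
exact: bilin_mul.
Qed.

Lemma tens_span (t : T) :
  exists s : seq (A * B), t = \sum_(p <- s) tens p.1 p.2.
Proof.
exists (repr (t : {eq_quot (tensor_equiv A B)})).
apply: tens_ext => W f fb; rewrite [LHS]/tens_lift.
elim: (repr _) => [|p s IHs]; first by rewrite /bsum !big_nil lift0.
by rewrite big_cons liftD // tens_liftE // -IHs /bsum big_cons.
Qed.

End Tensor.

Notation "a ⊗ b" := (tens a b) : ring_scope.

Section TensorMap.
Variables (F : fieldType) (A B A' B' : algType F).
Variables (f : {lrmorphism A -> A'}) (g : {lrmorphism B -> B'}).

Definition tens_map : tensor A B -> tensor A' B' :=
  tens_lift (fun a b => f a ⊗ g b).

Let tens_map_bilin : bilin (fun a b => f a ⊗ g b).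
Proof.
split=> [b k a a'|a k b b']; rewrite linearP.
  exact: (tens_bilin A' B').1.
exact: (tens_bilin A' B').2.
Qed.

Lemma tens_mapE a b : tens_map (a ⊗ b) = f a ⊗ g b.
Proof. exact: tens_liftE. Qed.

Lemma tens_map_linear : linear tens_map.
Proof. exact: tens_lift_linear. Qed.

HB.instance Definition _ :=
  GRing.isLinear.Build F (tensor A B) (tensor A' B') _ tens_map tens_map_linear.

Lemma tens_map_monoid_morphism : monoid_morphism tens_map.
Proof.
split=> [|t u]; first by have := tens_mapE 1 1; rewrite !rmorph1.
have [s ->] := tens_span t; have [r ->] := tens_span u.
rewrite mulr_suml !linear_sum mulr_suml; apply: eq_bigr => p _.
rewrite !mulr_sumr linear_sum; apply: eq_bigr => p' _.
by rewrite /= tensM !tens_mapE tensM !rmorphM.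
Qed.

HB.instance Definition _ := GRing.isMonoidMorphism.Build
  (tensor A B) (tensor A' B') tens_map tens_map_monoid_morphism.

End TensorMap.

(* Formal power series as coefficient sequences; the variable is z or z^-1
   depending on the series. *)
Definition fps (A : nzRingType) : Type := nat -> A.

Section FpsRing.
Variable A : nzRingType.
Local Notation S := (fps A).

HB.instance Definition _ := gen_eqMixin S.
HB.instance Definition _ := gen_choiceMixin S.

Let fadd (f g : S) : S := fun n => f n + g n.
Let fopp (f : S) : S := fun n => - f n.
Let fzero : S := fun=> 0.
Let fone : S := fun n => (n == 0%N)%:R.
Let fmul (f g : S) : S := fun n => \sum_(i < n.+1) f i * g (n - i)%N.

Let faddA : associative fadd.
Proof. by move=> f g h; apply/funext => n; rewrite /fadd addrA. Qed.
Let faddC : commutative fadd.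
Proof. by move=> f g; apply/funext => n; rewrite /fadd addrC. Qed.
Let fadd0 : left_id fzero fadd.
Proof. by move=> f; apply/funext => n; rewrite /fadd add0r. Qed.
Let faddN : left_inverse fzero fopp fadd.
Proof. by move=> f; apply/funext => n; rewrite /fadd addNr. Qed.

HB.instance Definition _ := GRing.isZmodule.Build S faddA faddC fadd0 faddN.

Let trunc N (f : S) : {poly A} := \poly_(i < N) f i.

Let fmul_trunc N f g n : (n < N)%N -> fmul f g n = (trunc N f * trunc N g)`_n.
Proof.
move=> nN; rewrite coefM; apply: eq_bigr => i _; rewrite !coef_poly.
by rewrite (leq_ltn_trans (leq_subr _ _) nN) (leq_ltn_trans _ nN) // -ltnS.
Qed.

Let fmulA : associative fmul.
Proof.
move=> f g h; apply/funext => n; transitivity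
  ((trunc n.+1 f * (trunc n.+1 g * trunc n.+1 h))`_n).
  rewrite coefM; apply: eq_bigr => i _; rewrite coef_poly ltn_ord.
  by rewrite (@fmul_trunc n.+1) // ltnS leq_subr.
rewrite mulrA coefM; apply: eq_bigr => i _.
by rewrite (@fmul_trunc n.+1) // coef_poly ltnS leq_subr.
Qed.
Let fmul1l : left_id fone fmul.
Proof.
move=> f; apply/funext => n; rewrite /fmul big_ord_recl /= subn0 mul1r.
by rewrite big1 ?addr0 // => i _; rewrite mul0r.
Qed.
Let fmul1r : right_id fone fmul.
Proof.
move=> f; apply/funext => n; rewrite /fmul big_ord_recr /= subnn mulr1.
rewrite big1 ?add0r // => i _.
by rewrite /fone subn_eq0 leqNgt ltn_ord mulr0.
Qed.
Let fmulDl : left_distributive fmul +%R.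
Proof.
move=> f g h; apply/funext => n; rewrite /GRing.add /= /fadd /fmul -big_split.
by apply: eq_bigr => i _; rewrite mulrDl.
Qed.
Let fmulDr : right_distributive fmul +%R.
Proof.
move=> f g h; apply/funext => n; rewrite /GRing.add /= /fadd /fmul -big_split.
by apply: eq_bigr => i _; rewrite mulrDr.
Qed.
Let fone_neq0 : fone != 0.
Proof.
by apply/eqP => /(congr1 (@^~ 0%N)) /eqP; rewrite /fone eqxx oner_eq0.
Qed.

HB.instance Definition _ := GRing.Zmodule_isNzRing.Build S
  fmulA fmul1l fmul1r fmulDl fmulDr fone_neq0.

Lemma fpsD (f g : S) n : (f + g) n = f n + g n.
Proof. by []. Qed.
Lemma fpsN (f : S) n : (- f) n = - f n.
Proof. by []. Qed.
Lemma fps0 n : (0 : S) n = 0.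
Proof. by []. Qed.
Lemma fps1 n : (1 : S) n = (n == 0%N)%:R.
Proof. by []. Qed.
Lemma fpsM (f g : S) n : (f * g) n = \sum_(i < n.+1) f i * g (n - i)%N.
Proof. by []. Qed.

(* S is the sum of the u n for n >= 0, in the adic topology. *)
Definition fps_has_sum (u : nat -> S) (s : S) :=
  forall k, exists N, forall M, (N <= M)%N -> (\sum_(n < M) u n) k = s k.

End FpsRing.

Section FpsAlg.
Variables (F : fieldType) (A : algType F).
Local Notation S := (fps A).

Let fscale (k : F) (f : S) : S := fun n => k *: f n.

Let fscaleA a b f : fscale a (fscale b f) = fscale (a * b) f.
Proof. by apply/funext => n; rewrite /fscale scalerA. Qed.
Let fscale1 : left_id 1 fscale.
Proof. by move=> f; apply/funext => n; rewrite /fscale scale1r. Qed.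
Let fscaleDr : right_distributive fscale +%R.
Proof. by move=> k f g; apply/funext => n; rewrite /fscale fpsD scalerDr. Qed.
Let fscaleDl f : {morph fscale^~ f : a b / a + b}.
Proof. by move=> a b; apply/funext => n; rewrite /fscale fpsD scalerDl. Qed.

HB.instance Definition _ := GRing.Zmodule_isLmodule.Build F S
  fscaleA fscale1 fscaleDr fscaleDl.

Lemma fpsZ k (f : S) n : (k *: f) n = k *: f n.
Proof. by []. Qed.

(* Used only when f 0 = 0, so that (f ^+ r) n = 0 for r > n. *)
Definition fps_exp (f : S) : S :=
  fun n => \sum_(r < n.+1) (r`!%:R : F)^-1 *: (f ^+ r) n.

End FpsAlg.

Definition fps_tens (F : fieldType) (A B : algType F) (f : fps A) (g : fps B) :
    fps (tensor A B) :=
  fun n => \sum_(i < n.+1) (f i ⊗ g (n - i)%N).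

Notation "f ⊠ g" := (fps_tens f g) : ring_scope.

Definition qint (F : fieldType) (q : F) (n : int) : F :=
  (q ^ n - q ^ (- n)) / (q - q^-1).

Definition qfact (F : fieldType) (q : F) (n : nat) : F :=
  \prod_(i < n) qint q i.+1.

Definition qbinom (F : fieldType) (q : F) (n r : nat) : F :=
  qfact q n / (qfact q (n - r) * qfact q r).

(* [CE true i] is e_i^+, [CE false i] is e_i^-, [CKi i] is k_i^-1, [Cc] is
   c^(1/2) and [Cci] is c^(-1/2). *)
Inductive cgen :=
  CE of bool & 'I_2 | CK of 'I_2 | CKi of 'I_2 | Cc | Cci.

HB.instance Definition _ := gen_eqMixin cgen.
HB.instance Definition _ := gen_choiceMixin cgen.

(* [Dc] is c^(1/2) and [Dci] is c^(-1/2). *)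
Inductive dgen :=
  Dx of int | Dy of int | Dh of {k : int | k != 0} | DK | DKi | Dc | Dci.

HB.instance Definition _ := gen_eqMixin dgen.
HB.instance Definition _ := gen_choiceMixin dgen.

Section ChevalleyRel.
Variables (F : fieldType) (q : F) (A : algType F) (g : cgen -> A).

Local Notation e s i := (g (CE s i)).
Local Notation k i := (g (CK i)).
Local Notation ki i := (g (CKi i)).
Local Notation c := (g Cc).
Local Notation ci := (g Cci).

Let sg (s : bool) : int := if s then 1 else -1.

Inductive chevalley_rel : A -> A -> Prop :=
| crel_c : chevalley_rel (c ^+ 2) (k 0 * k 1)
| crel_ci : chevalley_rel (ci ^+ 2) (ki 1 * ki 0)
| crel_cci : chevalley_rel (c * ci) 1
| crel_cic : chevalley_rel (ci * c) 1
| crel_central a : chevalley_rel (c * a) (a * c)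
| crel_kki i : chevalley_rel (k i * ki i) 1
| crel_kik i : chevalley_rel (ki i * k i) 1
| crel_kk i j : chevalley_rel (k i * k j) (k j * k i)
| crel_ke_same s i :
    chevalley_rel (k i * e s i * ki i) (q ^ (2 * sg s) *: e s i)
| crel_ke_diff s i j : i != j ->
    chevalley_rel (k i * e s j * ki i) (q ^ (- 2 * sg s) *: e s j)
| crel_ee i j :
    chevalley_rel (e true i * e false j - e false j * e true i)
      (if i == j then (q - q^-1)^-1 *: (k i - ki i) else 0)
| crel_serre s i j : i != j ->
    chevalley_rel
      (\sum_(r < 4) ((-1) ^+ r * qbinom q 3 r) *:
         (e s i ^+ r * e s j * e s i ^+ (3 - r)))
      0.

End ChevalleyRel.

Section DrinfeldRel.
Variables (F : fieldType) (q : F) (A : algType F) (g : dgen -> A).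

Local Notation x n := (g (Dx n)).
Local Notation y n := (g (Dy n)).
Local Notation h k := (g (Dh k)).
Local Notation K := (g DK).
Local Notation Ki := (g DKi).
Local Notation c := (g Dc).
Local Notation ci := (g Dci).

(* c^(l/2) *)
Definition chalf_pow (l : int) : A :=
  match l with Posz n => c ^+ n | Negz n => ci ^+ n.+1 end.

Let hplus : fps A :=
  fun m => if m is m'.+1 then h (exist _ (Posz m'.+1) isT) else 0.
Let hminus : fps A :=
  fun m => if m is m'.+1 then h (exist _ (Negz m') isT) else 0.

(* Psi is a series in z^-1 with coefficients psi_k, and Phi a series in z with
   coefficients phi_(-k). *)
Definition Psi_series : fps A :=
  fun k => K * fps_exp ((q - q^-1) *: hplus) k.
Definition Phi_series : fps A :=
  fun k => Ki * fps_exp (- (q - q^-1) *: hminus) k.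

Definition psi_of (m : int) : A := if m is Posz k then Psi_series k else 0.
Definition phi_of (m : int) : A := if - m is Posz k then Phi_series k else 0.

Inductive drinfeld_rel : A -> A -> Prop :=
| drel_KKi : drinfeld_rel (K * Ki) 1
| drel_KiK : drinfeld_rel (Ki * K) 1
| drel_cci : drinfeld_rel (c * ci) 1
| drel_cic : drinfeld_rel (ci * c) 1
| drel_central a : drinfeld_rel (c * a) (a * c)
| drel_hh m n :
    drinfeld_rel (h m * h n - h n * h m)
      (if val m == - val n then
         (qint q (2 * val m) / (val m)%:~R / (q - q^-1)) *:
           (chalf_pow (2 * val m) - chalf_pow (- (2 * val m)))
       else 0)
| drel_Kh m : drinfeld_rel (K * h m) (h m * K)
| drel_Kx m : drinfeld_rel (K * x m * Ki) (q ^+ 2 *: x m)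
| drel_Ky m : drinfeld_rel (K * y m * Ki) (q ^- 2 *: y m)
| drel_hx m n :
    drinfeld_rel (h m * x n - x n * h m)
      ((qint q (2 * val m) / (val m)%:~R) *:
         (chalf_pow (- `|val m|) * x (val m + n)))
| drel_hy m n :
    drinfeld_rel (h m * y n - y n * h m)
      (- (qint q (2 * val m) / (val m)%:~R) *:
         (chalf_pow `|val m| * y (val m + n)))
| drel_xx m n :
    drinfeld_rel (x (m + 1) * x n - q ^+ 2 *: (x n * x (m + 1)))
      (q ^+ 2 *: (x m * x (n + 1)) - x (n + 1) * x m)
| drel_yy m n :
    drinfeld_rel (y (m + 1) * y n - q ^- 2 *: (y n * y (m + 1)))
      (q ^- 2 *: (y m * y (n + 1)) - y (n + 1) * y m)
| drel_xy m n :
    drinfeld_rel (x m * y n - y n * x m)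
      ((q - q^-1)^-1 *:
         (chalf_pow (m - n) * psi_of (m + n)
          - chalf_pow (- (m - n)) * phi_of (m + n))).

End DrinfeldRel.

Section Proper.
Variables (F : fieldType) (q : F).

Let ceps (d : cgen) : F := if d is CE _ _ then 0 else 1.

Let chevalley_character (A : algType F) (g : cgen -> A)
    (chi : {lrmorphism A -> F | *%R}) u v :
  (forall d, chi (g d) = ceps d) -> chevalley_rel q g u v -> chi u = chi v.
Proof.
move=> chig; case=> [||||a|i|i|i j|s i|s i j _|i j|s i j _].
- by rewrite rmorphXn rmorphM /= !chig expr1n mulr1.
- by rewrite rmorphXn rmorphM /= !chig expr1n mulr1.
- by rewrite rmorphM /= !chig mulr1 rmorph1.
- by rewrite rmorphM /= !chig mulr1 rmorph1.
- by rewrite !rmorphM mulrC.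
- by rewrite rmorphM /= !chig mulr1 rmorph1.
- by rewrite rmorphM /= !chig mulr1 rmorph1.
- by rewrite !rmorphM mulrC.
- by rewrite !rmorphM linearZ /= !chig mulr0 mul0r mulr0.
- by rewrite !rmorphM linearZ /= !chig mulr0 mul0r mulr0.
- rewrite rmorphB !rmorphM /= !chig mulr0 subrr.
  by case: eqP => _; rewrite ?rmorph0 // linearZ rmorphB /= !chig subrr mulr0.
- rewrite linear_sum linear0 big1 // => r _; rewrite linearZ /= !rmorphM /= !chig.
  by rewrite mulr0 mul0r mulr0.
Qed.

Lemma chevalley_proper : ~ ideal (chevalley_rel q (@fgen F cgen)) 1.
Proof.
apply: (@ideal_proper _ _ _ (free_character ceps)) => u v.
by apply: chevalley_character => d; exact: free_characterU.
Qed.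

Let deps (d : dgen) : F := if d is (DK | DKi | Dc | Dci) then 1 else 0.

Let character_exp (A : algType F) (chi : {lrmorphism A -> F | *%R}) (f : fps A) k :
  (forall n, chi (f n) = 0) -> chi (fps_exp f k) = (k == 0%N)%:R.
Proof.
move=> f0; rewrite /fps_exp rmorph_sum big_ord_recl /= linearZ /=.
rewrite expr0 fps1 rmorph_nat invr1 mul1r big1 ?addr0 // => i _.
rewrite linearZ /= exprS fpsM rmorph_sum big1 ?mulr0 // => j _.
by rewrite rmorphM /= f0 mul0r.
Qed.

Let drinfeld_character (A : algType F) (g : dgen -> A)
    (chi : {lrmorphism A -> F | *%R}) u v :
  (forall d, chi (g d) = deps d) -> drinfeld_rel q g u v -> chi u = chi v.
Proof.
move=> chig.
have chic l : chi (chalf_pow g l) = 1.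
  by case: l => n; rewrite /= rmorphXn /= chig expr1n.
have chipsi m : chi (psi_of q g m) = (m == 0)%:R.
  case: m => k /=; last by rewrite rmorph0.
  rewrite rmorphM /= chig mul1r character_exp // => n.
  rewrite fpsZ linearZ /=.
  by case: n => [|n]; rewrite ?rmorph0 ?chig mulr0.
have chiphi m : chi (phi_of q g m) = (m == 0)%:R.
  rewrite -oppr_eq0 /phi_of; case: (- m) => k /=; last by rewrite rmorph0.
  rewrite rmorphM /= chig mul1r character_exp // => n.
  rewrite fpsZ linearZ /=.
  by case: n => [|n]; rewrite ?rmorph0 ?chig mulr0.
case=> [||||a|m n|m|m|m|m n|m n|m n|m n|m n].
- by rewrite rmorphM /= !chig mulr1 rmorph1.
- by rewrite rmorphM /= !chig mulr1 rmorph1.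
- by rewrite rmorphM /= !chig mulr1 rmorph1.
- by rewrite rmorphM /= !chig mulr1 rmorph1.
- by rewrite !rmorphM mulrC.
- rewrite rmorphB !rmorphM /= !chig mulr0 subrr.
  by case: eqP => _; rewrite ?rmorph0 // linearZ rmorphB /= !chic subrr mulr0.
- by rewrite !rmorphM mulrC.
- by rewrite !rmorphM linearZ /= !chig mulr0 mul0r mulr0.
- by rewrite !rmorphM linearZ /= !chig mulr0 mul0r mulr0.
- by rewrite rmorphB linearZ /= !rmorphM /= !chig !(mulr0, mul0r) subrr.
- by rewrite rmorphB linearZ /= !rmorphM /= !chig !(mulr0, mul0r) subrr.
- by rewrite !linearB /= !linearZ /= !rmorphM /= !chig !(mulr0, mul0r) !subrr.
- by rewrite !linearB /= !linearZ /= !rmorphM /= !chig !(mulr0, mul0r) !subrr.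
- rewrite linearB /= linearZ /= linearB /= !rmorphM /= !chic chipsi chiphi.
  by rewrite !chig !(mulr0, mul0r) !subrr mulr0.
Qed.

Lemma drinfeld_proper : ~ ideal (drinfeld_rel q (@fgen F dgen)) 1.
Proof.
apply: (@ideal_proper _ _ _ (free_character deps)) => u v.
by apply: drinfeld_character => d; exact: free_characterU.
Qed.

End Proper.

Definition Uq_sl2hat (F : fieldType) (q : F) : Type :=
  quot_alg (@chevalley_proper F q).
HB.instance Definition _ (F : fieldType) (q : F) :=
  GRing.Algebra.on (Uq_sl2hat q).

Definition Uhat (F : fieldType) (q : F) : Type :=
  quot_alg (@drinfeld_proper F q).
HB.instance Definition _ (F : fieldType) (q : F) :=
  GRing.Algebra.on (Uhat q).

(* The field of rational functions over the complex numbers, and its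
   indeterminate. *)
Definition Cq (R : realType) : fieldType := {fraction {poly R[i]}}.
Definition qvar (R : realType) : Cq R := tofrac 'X.

Section Generators.
Variables (F : fieldType) (q : F).

Definition cgen_cls (d : cgen) : Uq_sl2hat q :=
  qcls (@chevalley_proper F q) (fgen F d).

Definition dgen_cls (d : dgen) : Uhat q :=
  qcls (@drinfeld_proper F q) (fgen F d).

Definition e_plus (i : 'I_2) := cgen_cls (CE true i).
Definition e_minus (i : 'I_2) := cgen_cls (CE false i).
Definition k_gen (i : 'I_2) := cgen_cls (CK i).
Definition k_inv (i : 'I_2) := cgen_cls (CKi i).

Definition x_ (n : int) := dgen_cls (Dx n).
Definition y_ (n : int) := dgen_cls (Dy n).
Definition K_gen := dgen_cls DK.
Definition K_inv := dgen_cls DKi.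
Definition psi_ (m : int) := psi_of q dgen_cls m.
Definition phi_ (m : int) := phi_of q dgen_cls m.

(* c^(l/2) in Uhat *)
Definition cpow (l : int) := chalf_pow dgen_cls l.

Definition chevalley_comul
    (D : Uq_sl2hat q -> tensor (Uq_sl2hat q) (Uq_sl2hat q)) : Prop :=
  [/\ forall i, D (e_plus i) = e_plus i ⊗ k_gen i + 1 ⊗ e_plus i,
      forall i, D (e_minus i) = e_minus i ⊗ 1 + k_inv i ⊗ e_minus i,
      forall i, D (k_gen i) = k_gen i ⊗ k_gen i,
      D (cgen_cls Cc) = cgen_cls Cc ⊗ cgen_cls Cc
    & D (cgen_cls Cci) = cgen_cls Cci ⊗ cgen_cls Cci].

Definition drinfeld_iso (f : Uq_sl2hat q -> Uhat q) : Prop :=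
  [/\ bijective f,
      f (cgen_cls Cc) = cpow 1 /\ f (cgen_cls Cci) = cpow (-1),
      f (k_gen 0) = cpow 2 * K_inv /\ f (k_gen 1) = K_gen,
      f (e_plus 1) = x_ 0 /\ f (e_minus 1) = y_ 0
    & f (e_plus 0) = y_ 1 * K_inv /\ f (e_minus 0) = K_gen * x_ (-1)].

(* Series in z^-1: X0plus, Yplus, Psi; series in z: Xminus, Y0minus, Phi. *)
Definition X0plus : fps (Uhat q) := fun k => x_ k%:Z.
Definition Xminus : fps (Uhat q) := fun k => if k == 0%N then 0 else x_ (- k%:Z).
Definition Yplus : fps (Uhat q) := fun k => if k == 0%N then 0 else y_ k%:Z.
Definition Y0minus : fps (Uhat q) := fun k => y_ (- k%:Z).
Definition Psi : fps (Uhat q) := fun k => psi_ k%:Z.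
Definition Phi : fps (Uhat q) := fun k => phi_ (- k%:Z).

(* [at_zV s l f] and [at_z s l f] are f (s c^(l/2) z) for a series f in z^-1
   and in z respectively. *)
Definition at_zV (s : F) (l : int) (f : fps (Uhat q)) : fps (Uhat q) :=
  fun k => s ^- k *: (cpow (- (l * k%:Z)) * f k).
Definition at_z (s : F) (l : int) (f : fps (Uhat q)) : fps (Uhat q) :=
  fun k => s ^+ k *: (cpow (l * k%:Z) * f k).

End Generators.

(* Main.v *)
(** The bracket [[x_0, y_1]] (resp. [[x_{-1}, y_0]]) gives [Delta (h_1)] (resp.
    [Delta (h_{-1})]).  As [[h_1, x_k]] is a multiple of [x_{k+1}], the series
    [F = sum_k Delta (x_k) z^-k] is the only solution of [F = Delta (x_0) + [H, F]],
    where [H] is a multiple of [z^-1 Delta (h_1)].  The right-hand side solves this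
    equation because the contributions of its successive terms telescope.  With
    [p = q], this rests on the quadratic relations in the form
    [x_0 X = p^2 X x_0 + (1 - p^2) X^2], [y Y = p^-2 Y y + (1 - p^-2) Y^2] and
    [Psi y = (p^2 y - (p^2 - p^-2) Y) Psi], with [X], [Y] the current series of the
    two tensor factors.

    The identity for the [psi_k] comes from applying [[-, Delta (y_1)]] to that for
    the [x_k] and using
    [sum_(i <= n) X^i Psi X^(n-i) = (1 + p^-2 + ... + p^(-2n)) Psi Xt^n], where [Xt]
    is [X] evaluated at [q^2 z].  The identities for the [y_k] are those for the [x_k]
    in the opposite algebra, and those in positive powers of [z] are obtained by
    taking [p = q^-1]. *)

Require Import Defs.
From mathcomp Require Import all_boot all_order all_algebra.
From mathcomp Require Import reals.
From HB Require Import structures.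
From mathcomp Require Import boolp complex ring zify.

Set Implicit Arguments.
Unset Strict Implicit.
Unset Printing Implicit Defensive.

Import GRing.Theory.

Local Open Scope ring_scope.

(** * Identities in free algebras *)

(** Brackets with [Delta (h_1)] close only up to powers of [c], and these differ in the two tensor
    factors. Multiplying each current by a power of [c] affine in its index removes them, so the
    core of the proof concerns abstract sequences in a single algebra ([current_system]).

    The half currents start at [x_0, y_1] (or [x_{-1}, y_0]) because these are images of Chevalley
    generators up to powers of [K]: [Delta] is known on them, and their bracket is [h_1] (or
    [h_{-1}]) up to [K], [c] and a scalar. As a consequence the current of the [y]'s enters the sums
    with one extra power of the variable. This makes the [n]-th summand divisible by the [n]-th
    power, so that partial sums suffice, and it produces the factors [q^2] or [q^-2] that separate
    [tele_coef] from some of the constants of the theorem.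

    The rule for moving [Psi] past [y] is not a defining relation, since [Psi] is an exponential of
    the [h_m]. It is proved without expanding the exponential: both sides solve the same first-order
    equation for the derivation [t d/dt], whose solution is unique because positive integers are
    invertible. *)

Section FreeIdentities.
Variables (F : fieldType) (A : algType F).

(** The identities below mix noncommuting atoms with rational functions of [p]. Reflection splits
    such an equation into one scalar equation per word in the atoms, which is then left to [ring] or
    [field]. *)
Inductive nc_expr :=
  NcVar of nat | Nc0 | Nc1 | NcAdd of nc_expr & nc_expr | NcOpp of nc_expr
| NcMul of nc_expr & nc_expr | NcScale of F & nc_expr.

Fixpoint nc_eval (v : seq A) e : A :=
  match e with
  | NcVar i => v`_i
  | Nc0 => 0
  | Nc1 => 1
  | NcAdd a b => nc_eval v a + nc_eval v b
  | NcOpp a => - nc_eval v a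
  | NcMul a b => nc_eval v a * nc_eval v b
  | NcScale k a => k *: nc_eval v a
  end.

Fixpoint nc_norm e : seq (F * seq nat) :=
  match e with
  | NcVar i => [:: (1, [:: i])]
  | Nc0 => [::]
  | Nc1 => [:: (1, [::])]
  | NcAdd a b => nc_norm a ++ nc_norm b
  | NcOpp a => [seq (- u.1, u.2) | u <- nc_norm a]
  | NcMul a b =>
      [seq (u.1 * w.1, u.2 ++ w.2) | u <- nc_norm a, w <- nc_norm b]
  | NcScale k a => [seq (k * u.1, u.2) | u <- nc_norm a]
  end.

Definition nc_mon (v : seq A) (m : seq nat) : A := \prod_(i <- m) v`_i.

Lemma nc_normE v e : nc_eval v e = \sum_(u <- nc_norm e) u.1 *: nc_mon v u.2.
Proof.
elim: e => [i|||a IHa b IHb|a IHa|a IHa b IHb|k a IHa] /=.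
- by rewrite /nc_mon !big_seq1 scale1r.
- by rewrite big_nil.
- by rewrite /nc_mon big_seq1 big_nil scale1r.
- by rewrite big_cat IHa IHb.
- by rewrite big_map IHa -sumrN; apply: eq_bigr => u _; rewrite scaleNr.
- rewrite big_allpairs_dep IHa mulr_suml; apply: eq_bigr => u _.
  rewrite IHb mulr_sumr; apply: eq_bigr => w _.
  by rewrite -scalerAl -scalerAr scalerA /nc_mon big_cat.
- by rewrite big_map IHa scaler_sumr; apply: eq_bigr => u _; rewrite scalerA.
Qed.

(** Written by plain recursion and [if], so that the restricted [lazy] of [nc_expand] compares words
    without unfolding any operation of the field. *)
Fixpoint nc_eqm (s t : seq nat) : bool :=
  match s, t with
  | [::], [::] => true
  | i :: s', j :: t' => if eqn i j then nc_eqm s' t' else false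
  | _, _ => false
  end.

Lemma nc_eqmE : nc_eqm =2 eq_op.
Proof.
by elim=> [|i s IHs] [|j t] //=; rewrite IHs eqseq_cons -[i == j]/(eqn i j); case: eqn.
Qed.

Fixpoint nc_mem (m : seq nat) (ms : seq (seq nat)) : bool :=
  if ms is m' :: ms' then if nc_eqm m' m then true else nc_mem m ms' else false.

Fixpoint nc_mons (l : seq (F * seq nat)) : seq (seq nat) :=
  if l is u :: l' then
    let ms := nc_mons l' in if nc_mem u.2 ms then ms else u.2 :: ms
  else [::].

Fixpoint nc_coef (m : seq nat) (l : seq (F * seq nat)) : F :=
  if l is u :: l' then
    if nc_eqm u.2 m then u.1 + nc_coef m l' else nc_coef m l'
  else 0.

Fixpoint nc_zero (ms : seq (seq nat)) (l : seq (F * seq nat)) : Prop :=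
  if ms is m :: ms' then nc_coef m l = 0 /\ nc_zero ms' l else True.

Lemma nc_coefE m l : nc_coef m l = \sum_(u <- l | u.2 == m) u.1.
Proof. by elim: l => [|u l IHl] /=; rewrite ?big_nil // big_cons IHl nc_eqmE. Qed.

Lemma nc_memE m ms : nc_mem m ms = (m \in ms).
Proof.
elim: ms => //= m' ms IHms; rewrite inE nc_eqmE eq_sym IHms.
by case: eqP.
Qed.

Lemma nc_monsE l : nc_mons l = undup [seq u.2 | u <- l].
Proof. by elim: l => //= u l ->; rewrite nc_memE mem_undup; case: ifP. Qed.

Definition nc_check a b := let l := nc_norm (NcAdd a (NcOpp b)) in nc_zero (nc_mons l) l.

(** Grouped by words, the difference of the two sides is a sum of coefficients times products of
    atoms. The converse can fail when the atoms satisfy relations; hence such relations are always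
    rewritten before [nc_expand] is called. *)
Lemma nc_decide v a b : nc_check a b -> nc_eval v a = nc_eval v b.
Proof.
rewrite /nc_check /= nc_monsE => l0.
apply/eqP; rewrite -subr_eq0 -[_ - _]/(nc_eval v (NcAdd a (NcOpp b))).
rewrite nc_normE; move: l0; rewrite -[nc_norm a ++ _]/(nc_norm (NcAdd a (NcOpp b))).
set l := nc_norm _; set ms := undup _ => l0.
have {}l0 m : m \in ms -> nc_coef m l = 0.
  elim: (ms) l0 => //= m' s IHs [e0 /IHs es].
  by rewrite inE => /predU1P[->|].
apply/eqP; transitivity (\sum_(u <- l) \sum_(m <- ms | m == u.2) u.1 *: nc_mon v m).
  rewrite !big_seq; apply: eq_bigr => u lu.
  by rewrite -big_filter filter_pred1_uniq ?undup_uniq ?big_seq1 // mem_undup map_f.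
rewrite (exchange_big_dep predT) //= big_seq big1 // => m msm.
by rewrite -scaler_suml (eq_bigl (fun u => u.2 == m)) -?nc_coefE ?l0 ?scale0r //.
Qed.

End FreeIdentities.

Ltac nc_atoms e l :=
  lazymatch e with
  | 0 => l
  | 1 => l
  | ?a + ?b => let l := nc_atoms a l in nc_atoms b l
  | - ?a => nc_atoms a l
  | ?a * ?b => let l := nc_atoms a l in nc_atoms b l
  | ?k *: ?a => nc_atoms a l
  | _ =>
    lazymatch l with
    | context [cons e _] => l
    | _ => constr:(cons e l)
    end
  end.

Ltac nc_index x l :=
  lazymatch l with
  | cons x _ => constr:(0%N)
  | cons _ ?l' => let i := nc_index x l' in constr:(S i)
  end.

Ltac nc_reify F e l :=
  lazymatch e with
  | 0 => constr:(@Nc0 F)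
  | 1 => constr:(@Nc1 F)
  | ?a + ?b => let a := nc_reify F a l in let b := nc_reify F b l in
      constr:(@NcAdd F a b)
  | - ?a => let a := nc_reify F a l in constr:(@NcOpp F a)
  | ?a * ?b => let a := nc_reify F a l in let b := nc_reify F b l in
      constr:(@NcMul F a b)
  | ?k *: ?a => let a := nc_reify F a l in constr:(@NcScale F k a)
  | _ => let i := nc_index e l in constr:(@NcVar F i)
  end.

(* Leaves one scalar equation per noncommutative monomial in the atoms. *)
Ltac nc_expand F A :=
  lazymatch goal with
  | |- ?a = ?b =>
    let l := nc_atoms a (@nil A) in
    let l := nc_atoms b l in
    let a' := nc_reify F a l in
    let b' := nc_reify F b l in
    change (nc_eval l a' = nc_eval l b'); apply: nc_decide;
    lazy beta iota zeta delta
      [nc_check nc_norm nc_zero nc_coef nc_mons nc_mem nc_eqm eqn map cat allpairs_dep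
       flatten foldr fst snd];
    repeat match goal with |- _ /\ _ => split | |- True => exact I end
  end.

(** * Formal power series over an algebra *)

(* The identities for the [y_k] are those for the [x_k] read in the opposite
   algebra. *)
Definition rev_alg (F : fieldType) (A : algType F) : Type := A^c.

Section RevAlg.
Variables (F : fieldType) (A : algType F).

HB.instance Definition _ := GRing.NzRing.on (rev_alg A).
HB.instance Definition _ := GRing.Zmodule_isLmodule.Build F (rev_alg A)
  (@scalerA F A) (@scale1r F A) (@scalerDr F A) (fun v a b => @scalerDl F A v a b).

Let rev_scaleAl (k : F) (x y : rev_alg A) : k *: (x * y) = k *: x * y.
Proof. exact: (@scalerAr F A). Qed.
HB.instance Definition _ := GRing.Lmodule_isLalgebra.Build F (rev_alg A) rev_scaleAl.

Let rev_scaleAr (k : F) (x y : rev_alg A) : k *: (x * y) = x * (k *: y).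
Proof. exact: (@scalerAl F A). Qed.
HB.instance Definition _ := GRing.Lalgebra_isAlgebra.Build F (rev_alg A) rev_scaleAr.

End RevAlg.

Section FpsAlgebra.
Variables (F : fieldType) (A : algType F).
Local Notation W := (fps A).

Let fps_scaleAl (k : F) (f g : W) : k *: (f * g) = k *: f * g.
Proof.
apply/funext => n; rewrite fpsZ !fpsM scaler_sumr; apply: eq_bigr => i _.
by rewrite fpsZ scalerAl.
Qed.
HB.instance Definition _ := GRing.Lmodule_isLalgebra.Build F W fps_scaleAl.

Let fps_scaleAr (k : F) (f g : W) : k *: (f * g) = f * (k *: g).
Proof.
apply/funext => n; rewrite fpsZ !fpsM scaler_sumr; apply: eq_bigr => i _.
by rewrite fpsZ scalerAr.
Qed.
HB.instance Definition _ := GRing.Lalgebra_isAlgebra.Build F W fps_scaleAr.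

Definition fpsC (a : A) : W := fun k => if k == 0%N then a else 0.

(* multiplication of a series by its variable *)
Definition fpsT (f : W) : W := fun k => if k is k'.+1 then f k' else 0.

Lemma fps_sum (I : Type) (r : seq I) (P : pred I) (f : I -> W) k :
  (\sum_(i <- r | P i) f i) k = \sum_(i <- r | P i) f i k.
Proof. exact: (big_morph (fun f : W => f k) (fun f g => fpsD f g k) (fps0 A k)). Qed.

Lemma fpsCMl a (f : W) k : (fpsC a * f) k = a * f k.
Proof.
rewrite fpsM big_ord_recl /= subn0 big1 ?addr0 // => i _.
by rewrite mul0r.
Qed.

Lemma fpsCMr a (f : W) k : (f * fpsC a) k = f k * a.
Proof.
rewrite fpsM big_ord_recr /= subnn big1 ?add0r // => i _.
by rewrite /fpsC subn_eq0 leqNgt ltn_ord mulr0.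
Qed.

Lemma fpsCM a b : fpsC (a * b) = fpsC a * fpsC b.
Proof. by apply/funext => k; rewrite fpsCMl /fpsC; case: eqP; rewrite ?mulr0. Qed.

Lemma fpsT_mull f g : fpsT f * g = fpsT (f * g).
Proof.
apply/funext => -[|k]; rewrite !fpsM big_ord_recl /= mul0r ?big_ord0 ?addr0 //.
by rewrite add0r fpsM; apply: eq_bigr => i _; rewrite /= subSS.
Qed.

Lemma fpsT_mulr f g : f * fpsT g = fpsT (f * g).
Proof.
apply/funext => -[|k].
  by rewrite fpsM big_ord1 /= mulr0.
rewrite fpsM big_ord_recr /= subnn mulr0 addr0 fpsM.
by apply: eq_bigr => i _; rewrite subSn // -ltnS.
Qed.

Lemma fpsT_linear : linear fpsT.
Proof. by move=> a f g; apply/funext => -[|k]; rewrite ?fpsD ?fpsZ //= scaler0 addr0. Qed.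

HB.instance Definition _ := GRing.isLinear.Build F W W _ fpsT fpsT_linear.

(** Congruence to 0 modulo the [N]-th power of the variable; the infinite sums are treated through
    their truncations modulo such powers. *)
Definition fps_small N (f : W) := forall k, (k < N)%N -> f k = 0.

Lemma smallS N f g : fps_small N f -> fps_small N g -> fps_small N (f + g).
Proof. by move=> f0 g0 k kN; rewrite fpsD f0 // g0 // addr0. Qed.

Lemma smallZ N a f : fps_small N f -> fps_small N (a *: f).
Proof. by move=> f0 k kN; rewrite fpsZ f0 // scaler0. Qed.

Lemma smallN N f : fps_small N f -> fps_small N (- f).
Proof. by move=> f0 k kN; rewrite fpsN f0 // oppr0. Qed.

Lemma smallMl N f g : fps_small N g -> fps_small N (f * g).
Proof.
move=> g0 k kN; rewrite fpsM big1 // => i _; rewrite g0 ?mulr0 //.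
exact: leq_ltn_trans (leq_subr _ _) kN.
Qed.

Lemma smallMr N f g : fps_small N f -> fps_small N (f * g).
Proof.
move=> f0 k kN; rewrite fpsM big1 // => i _; rewrite f0 ?mul0r //.
by rewrite (leq_ltn_trans _ kN) // -ltnS.
Qed.

Lemma smallT N f : fps_small N f -> fps_small N.+1 (fpsT f).
Proof. by move=> f0 [|k] //; exact: f0. Qed.

Lemma smallTX N f : fps_small N (fpsT f ^+ N).
Proof.
elim: N => [//|N IHN]; rewrite exprS fpsT_mull; apply: smallT.
exact: smallMl.
Qed.

End FpsAlgebra.

Section FpsRev.
Variables (F : fieldType) (A : algType F).

Lemma fps_revM (f g : fps (rev_alg A)) : f * g = ((g : fps A) * (f : fps A))%R :> fps A.
Proof.
apply/funext => k; rewrite [LHS]fpsM [RHS]fpsM (reindex_inj rev_ord_inj) /=.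
by apply: eq_bigr => i _; rewrite subSS subKn // -ltnS.
Qed.

Lemma fps_revX (f : fps (rev_alg A)) n : f ^+ n = (f : fps A) ^+ n :> fps A.
Proof. by elim: n => // n IHn; rewrite exprS fps_revM IHn -exprSr. Qed.

Lemma fps_rev_sum (I : Type) (r : seq I) (P : pred I) (f : I -> fps A) :
  \sum_(i <- r | P i) (f i : fps (rev_alg A)) = \sum_(i <- r | P i) f i :> fps A.
Proof. by []. Qed.

End FpsRev.

(** * Telescoping sums *)

Section SkewPowers.
Variables (F : fieldType) (W : algType F) (p : F) (X x0 : W).
Hypothesis x0X : x0 * X = p ^+ 2 *: (X * x0) + (1 - p ^+ 2) *: (X * X).

(** The hypothesis says [(x0 - X) * X = p^2 X * (x0 - X)], so [x0 - X] passes [X ^+ n] at the cost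
    of [p ^+ (2 * n)]. *)
Lemma skew_powers n : x0 * X ^+ n =
  p ^+ (2 * n) *: (X ^+ n * x0) + (1 - p ^+ (2 * n)) *: (X * X ^+ n).
Proof.
elim: n => [|n IHn]; first by rewrite !expr0 subrr scale0r scale1r mulr1 mul1r addr0.
rewrite exprSr mulrA IHn mulrDl -!scalerAl -[X ^+ n * x0 * X]mulrA x0X.
rewrite mulnS exprD.
have XX : X * X ^+ n = X ^+ n * X by rewrite -exprS exprSr.
rewrite ?XX.
have -> : X * (X ^+ n * X) = X ^+ n * X * X by rewrite mulrA XX.
move: (X ^+ n) => V; move: (p ^+ (2 * n)) => r.
by nc_expand F W; ring.
Qed.

(** In the Leibniz expansion of the bracket of [H] with [X ^+ n.+1], moving [X - x0] to the right
    past the remaining powers of [X] gives successive powers of [p ^+ 2], whence the geometric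
    sum. *)
Lemma shift_powers H k n : p ^+ 2 - 1 != 0 -> H * X = X * H + k *: (X - x0) ->
  H * X ^+ n.+1 = X ^+ n.+1 * H
    + (k * ((p ^+ (2 * n.+1) - 1) / (p ^+ 2 - 1))) *: (X ^+ n.+1 - X ^+ n * x0).
Proof.
move=> p21 HX; elim: n => [|n IHn].
  by rewrite expr0 expr1 mul1r HX muln1 divff // mulr1.
have e : X * (X ^+ n * x0) = X ^+ n.+1 * x0 by rewrite mulrA -exprS.
have := skew_powers n.+1; rewrite (exprS X n.+1) (mulnS 2 n.+1) exprD.
move: IHn e; move: (X ^+ n.+1) (X ^+ n * x0) (p ^+ (2 * n.+1)) => V U r IHn e x0V.
have -> : H * (X * V) = X * (H * V) + k *: (X * V) - k *: (x0 * V).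
  by rewrite mulrA HX mulrDl mulrA -scalerAl mulrBl scalerBr addrA.
rewrite IHn x0V -e.
by nc_expand F W; field.
Qed.

End SkewPowers.

Lemma qcomm_powers (F : fieldType) (W : algType F) (r : F) (a X : W) n :
  a * X = r *: (X * a) -> a * X ^+ n = r ^+ n *: (X ^+ n * a).
Proof.
move=> aX; elim: n => [|n IHn]; first by rewrite !expr0 scale1r mulr1 mul1r.
rewrite (exprSr X) (exprSr r) mulrA IHn -scalerAl -(mulrA _ a) aX.
by rewrite -scalerAr scalerA mulrA.
Qed.

Section Telescope.
Variables (F : fieldType) (W : algType F) (p : F).
Hypotheses (p0 : p != 0) (p1 : p - p^-1 != 0).
Variables X x0 H1 Y y H2 Psi K Z z0 : W.

Local Notation comm a b := (a * b - b * a).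

Hypothesis x0X : x0 * X = p ^+ 2 *: (X * x0) + (1 - p ^+ 2) *: (X * X).
Hypothesis H1X : H1 * X = X * H1 + X - x0.
Hypothesis yY : y * Y = p ^- 2 *: (Y * y) + (1 - p ^- 2) *: (Y * Y).
Hypothesis H2Y : H2 * Y = Y * H2 - p ^+ 2 *: (Y - y).
Hypothesis Psi_y : Psi * y = p ^+ 2 *: (y * Psi) - (p ^+ 2 - p ^- 2) *: (Y * Psi).
Hypothesis H2Psi : H2 * Psi = Psi * H2.
Hypothesis H2Z : H2 * Z = Z * H2 + Z - z0.
Hypothesis Zy : Z * y = y * Z + (p - p^-1)^-1 *: (Psi - K).
Hypotheses (XY : X * Y = Y * X) (Xy : X * y = y * X) (XH2 : X * H2 = H2 * X).
Hypotheses (x0Y : x0 * Y = Y * x0) (x0Psi : x0 * Psi = Psi * x0) (x0Z : x0 * Z = Z * x0).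
Hypotheses (H1Y : H1 * Y = Y * H1) (H1Psi : H1 * Psi = Psi * H1) (H1Z : H1 * Z = Z * H1).

Lemma p2_neq1 : p ^+ 2 - 1 != 0.
Proof.
apply: contraNneq p1 => /eqP; rewrite subr_eq0 => /eqP p21.
by rewrite subr_eq0 -(inj_eq (mulfI p0)) mulfV // -expr2 p21.
Qed.

(** The ratio of consecutive terms dictated by [tele_step]. For [p = q] it is the constant of the
    identity for [y_k], and for [p = q^-1] that of the identity for [x_{-k}]; for [x_k] and [y_{-k}]
    a factor [p ^+ 2] is hidden in the normalisation of [Y]. *)
Definition tele_coef : F := - p^-1 * (p - p^-1) ^+ 2.
Local Notation T n := (X ^+ n.+1 * Y ^+ n * Psi).

(* The defect of the [n]-th term under [H1 + H2] is cancelled by the contribution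
   of [x0 * y] to the previous one. *)
Lemma tele_step n :
  (p - p^-1) *: comm (x0 * y) (T n) =
  tele_coef *: (comm (H1 + H2) (T n.+1) - T n.+1).
Proof.
have p21 := p2_neq1.
have pV2 : p^-1 ^+ 2 - 1 != 0.
  have -> : p^-1 ^+ 2 - 1 = - ((p ^+ 2 - 1) / p ^+ 2) by field.
  by rewrite oppr_eq0 mulf_neq0 // invr_eq0 expf_neq0.
have H2Y' : H2 * Y = Y * H2 + - p ^+ 2 *: (Y - y) by rewrite scaleNr.
have yY' : y * Y = p^-1 ^+ 2 *: (Y * y) + (1 - p^-1 ^+ 2) *: (Y * Y) by rewrite exprVn.
have H1X' : H1 * X = X * H1 + 1 *: (X - x0) by rewrite scale1r addrA.
have := skew_powers x0X n.+1; have := shift_powers x0X n.+1 p21 H1X'.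
have := skew_powers yY' n; have := shift_powers yY' n pV2 H2Y'.
have : GRing.comm Y (Y ^+ n) by exact: commrX.
have : GRing.comm (X ^+ n.+1) y by apply/commr_sym/commrX/commr_sym.
have : GRing.comm (X ^+ n.+1) H2 by apply/commr_sym/commrX/commr_sym.
have : GRing.comm (X ^+ n.+1) Y by apply/commr_sym/commrX/commr_sym.
have : GRing.comm x0 (Y ^+ n) by exact: commrX.
have : GRing.comm H1 (Y ^+ n) by exact: commrX.
rewrite /GRing.comm (exprS X n.+1) (exprS Y n) mul1r.
rewrite !(mulnS 2 n.+1) !(exprD _ 2 (2 * n.+1)) !(mulnS 2 n) !(exprD _ 2 (2 * n)).
have : p^-1 ^+ (2 * n) = (p ^+ (2 * n))^-1 by rewrite exprVn.
have : p ^+ (2 * n) != 0 by rewrite expf_neq0.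
(* The commutation rules just recorded are all that is used about the powers. They become atoms and
   [p ^+ (2 * n)] a nonzero scalar [r], so one polynomial identity covers every [n]. *)
move: (X ^+ n.+1) (Y ^+ n) (p ^+ (2 * n)) => V U r r0 -> H1U x0U VY VH2 Vy YU H2YU yU H1XV x0V.
have -> : x0 * y * (V * U * Psi) = (x0 * V) * (y * U) * Psi.
  by rewrite !mulrA -(mulrA x0 y V) -Vy mulrA.
have -> : V * U * Psi * (x0 * y) = (V * x0) * U * (Psi * y).
  by rewrite !mulrA -(mulrA _ Psi) -x0Psi mulrA -(mulrA V U) -x0U mulrA.
have -> : (H1 + H2) * (X * V * (Y * U) * Psi) =
    (H1 * (X * V)) * (Y * U) * Psi + (X * V) * (H2 * (Y * U)) * Psi.
  by rewrite mulrDl !mulrA -XH2 -(mulrA X H2 V) -VH2 mulrA.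
have -> : X * V * (Y * U) * Psi * (H1 + H2) =
    (X * V) * H1 * (Y * U) * Psi + (X * V) * (Y * U) * H2 * Psi.
  rewrite mulrDr !mulrA -(mulrA _ Psi H2) -H2Psi mulrA; congr (_ + _).
  by rewrite -(mulrA _ Psi) -H1Psi mulrA -(mulrA _ U H1) -H1U mulrA -(mulrA _ Y H1) -H1Y mulrA.
rewrite H1XV x0V H2YU yU Psi_y /tele_coef.
have -> : V * x0 * U * (p ^+ 2 *: (y * Psi) - (p ^+ 2 - p ^- 2) *: (Y * Psi)) =
   V * x0 * (p ^+ 2 *: (U * y) - (p ^+ 2 - p ^- 2) *: (Y * U)) * Psi.
  by rewrite YU; nc_expand F W; ring.
have n21 : 1 + -1 * p ^+ 2 != 0 by rewrite mulN1r -oppr_eq0 opprB.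
by nc_expand F W; field; rewrite ?p0 ?r0 ?n21 ?p21.
Qed.

Definition tele_sum N : W := Z + \sum_(n < N) tele_coef ^+ n *: T n.
(** Stands for the variable times the rescaled [Delta (h_1)]; the product [x0 * y] is the amount by
    which [h_1] fails to be primitive. *)
Definition tele_H : W := H1 + H2 - (p - p^-1) *: (x0 * y).

(** The fixed-point equation for the truncated sum, with constant term [z0 + x0 * K] in the role of
    [Delta (x_0)]. Adding the next term cancels the old defect, and [tele_step] rewrites what its
    bracket with [x0 * y] leaves as the new one. The remaining defect contains [Y ^+ N]. *)
Lemma tele_sum_comm N :
  comm tele_H (tele_sum N) =
  tele_sum N - (z0 + x0 * K) - tele_coef ^+ N *: (comm (H1 + H2) (T N) - T N).
Proof.
elim: N => [|N IHN].
  (* For [N = 0] the bracket of [Z] with [x0 * y] yields [x0 * (Psi - K)]: the part with [K] enters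
     the constant term, and the part with [Psi] is the defect of the term [X * Psi]. *)
  rewrite /tele_sum /tele_H big_ord0 addr0 expr0 scale1r expr1 expr0 mulr1.
  have -> : (H1 + H2) * (X * Psi) = H1 * X * Psi + X * (H2 * Psi).
    by rewrite mulrDl !mulrA XH2.
  have -> : X * Psi * (H1 + H2) = X * (H1 * Psi) + X * (Psi * H2).
    by rewrite mulrDr -!mulrA H1Psi.
  have -> : Z * (H1 + H2 - (p - p^-1) *: (x0 * y)) =
      H1 * Z + Z * H2 - (p - p^-1) *: (x0 * (Z * y)).
    by rewrite mulrBr mulrDr H1Z -scalerAr !mulrA x0Z.
  have -> : (H1 + H2 - (p - p^-1) *: (x0 * y)) * Z =
      H1 * Z + H2 * Z - (p - p^-1) *: (x0 * (y * Z)).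
    by rewrite mulrBl mulrDl -scalerAl mulrA.
  rewrite H1X H2Psi Zy H2Z.
  by nc_expand F W; field; rewrite ?p0 ?p2_neq1.
have tS : tele_sum N.+1 = tele_sum N + tele_coef ^+ N *: T N.
  rewrite /tele_sum (big_ord_recr N (fun n => tele_coef ^+ n *: T n)).
  by rewrite /= addrA.
have := tele_step N; move: IHN; rewrite tS [tele_coef ^+ N.+1]exprSr -scalerA.
move: (tele_sum N) (tele_coef ^+ N) (T N) (T N.+1) => S r t t' IHN <-.
have -> : comm tele_H (S + r *: t) = comm tele_H S + r *: comm tele_H t.
  by nc_expand F W; ring.
rewrite IHN /tele_H.
by nc_expand F W; ring.
Qed.

End Telescope.

Section PsiTelescope.
Variables (F : fieldType) (W : algType F) (p : F).
Hypotheses (p0 : p != 0) (p1 : p - p^-1 != 0).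

(** The hypothesis amounts to [X * (X - Xt) = p^-2 (X - Xt) * Xt]. It trades left factors [X] for
    right factors [Xt] one at a time, and the powers of [p^-2] collected on the way form the two
    geometric sums. *)
Lemma geometric_pair (X Xt : W) n :
  (1 + p ^+ 2) *: (X * Xt) = Xt * Xt + p ^+ 2 *: (X * X) ->
  ((1 - p ^- 2 ^+ n.+1) / (1 - p ^- 2)) *: (X * Xt ^+ n) =
  X ^+ n.+1 + (p ^- 2 * ((1 - p ^- 2 ^+ n) / (1 - p ^- 2))) *: Xt ^+ n.+1.
Proof.
have p21 := p2_neq1 p0 p1.
have q1 : 1 - p ^- 2 != 0.
  have -> : 1 - p ^- 2 = (p ^+ 2 - 1) / p ^+ 2 by field.
  by rewrite mulf_neq0 // invr_eq0 expf_neq0.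
move=> XXt; elim: n => [|n IHn].
  by rewrite expr0 expr1 !expr0 subrr mul0r mulr0 scale0r addr0 expr1 divff // scale1r mulr1.
have XX : X * X = (1 + p ^- 2) *: (X * Xt) - p ^- 2 *: (Xt * Xt).
  have -> : X * X = p ^- 2 *: (p ^+ 2 *: (X * X)) by rewrite scalerA mulVf ?scale1r ?expf_neq0.
  have -> : p ^+ 2 *: (X * X) = (1 + p ^+ 2) *: (X * Xt) - Xt * Xt by rewrite XXt addrC addKr.
  by nc_expand F W; field.
have XXV : X * (X * Xt ^+ n) =
    (1 + p ^- 2) *: (X * (Xt * Xt ^+ n)) - p ^- 2 *: (Xt * (Xt * Xt ^+ n)).
  by rewrite mulrA XX; move: (Xt ^+ n) => V; nc_expand F W; ring.
have -> : X ^+ n.+2 = ((1 - p ^- 2 ^+ n.+1) / (1 - p ^- 2)) *: (X * (X * Xt ^+ n)) -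
    (p ^- 2 * ((1 - p ^- 2 ^+ n) / (1 - p ^- 2))) *: (X * Xt ^+ n.+1).
  rewrite exprS !(scalerAr _ X) -mulrBr; congr (X * _).
  by rewrite -scalerAr IHn addrK.
rewrite XXV (exprS Xt n.+1) (exprS Xt n) !(exprS (p ^- 2)).
move: (p ^- 2 ^+ n) (Xt ^+ n) => r V.
by nc_expand F W; field; rewrite ?q1 ?p0 ?p21.
Qed.

Variables X x0 Y y Psi K Z Xt Psi1 K1 v : W.
Local Notation comm a b := (a * b - b * a).

Hypothesis yY : y * Y = p ^- 2 *: (Y * y) + (1 - p ^- 2) *: (Y * Y).
Hypothesis Psi_y : Psi * y = p ^+ 2 *: (y * Psi) - (p ^+ 2 - p ^- 2) *: (Y * Psi).
Hypothesis Zy : Z * y = y * Z + (p - p^-1)^-1 *: (Psi - K).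
Hypothesis XXt : (1 + p ^+ 2) *: (X * Xt) = Xt * Xt + p ^+ 2 *: (X * X).
Hypothesis XPsi1 : X * Psi1 = Psi1 * ((1 + p ^- 2) *: Xt - X).
Hypothesis K1X : K1 * X = p ^+ 2 *: (X * K1).
Hypothesis Xv : X * v = v * X + (p - p^-1)^-1 *: (Psi1 - K1).
Hypothesis Xy : X * y = y * X.
Hypotheses (K1Y : K1 * Y = Y * K1) (K1Psi : K1 * Psi = Psi * K1) (K1Z : K1 * Z = Z * K1).
Hypotheses (vY : v * Y = Y * v) (vPsi : v * Psi = Psi * v) (vZ : v * Z = Z * v).

(** By Leibniz the bracket is a sum of terms [X^i (Psi1 - K1) X^(n-i)]. The part with [K1] is
    geometric by [K1X]. In the part with [Psi1], each move of an [X] through [Psi1] leaves a term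
    [X * Xt ^+ n], which [geometric_pair] cancels against [X ^+ n.+1]. *)
Lemma powers_comm n :
  (p - p^-1) *: comm (X ^+ n.+1) v =
  ((1 - p ^- 2 ^+ n.+1) / (1 - p ^- 2)) *: (Psi1 * Xt ^+ n)
  - ((p ^+ (2 * n.+1) - 1) / (p ^+ 2 - 1)) *: (X ^+ n * K1).
Proof.
have p21 := p2_neq1 p0 p1.
have q1 : 1 - p ^- 2 != 0.
  have -> : 1 - p ^- 2 = (p ^+ 2 - 1) / p ^+ 2 by field.
  by rewrite mulf_neq0 // invr_eq0 expf_neq0.
elim: n => [|n IHn].
  rewrite !expr0 expr1 Xv muln1 !divff // !scale1r mulr1 mul1r.
  by nc_expand F W; field; rewrite ?p0 ?p21.
have K1Xn : K1 * X ^+ n.+1 = p ^+ (2 * n.+1) *: (X ^+ n.+1 * K1).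
  by rewrite exprM; exact: qcomm_powers.
have -> : comm (X ^+ n.+2) v = X * comm (X ^+ n.+1) v + (X * v - v * X) * X ^+ n.+1.
  rewrite (exprS X n.+1); move: (X ^+ n.+1) => V.
  by nc_expand F W; ring.
have e : (p - p^-1) *: (X * v - v * X) = Psi1 - K1.
  by rewrite Xv [v * X + _]addrC addrK scalerA divff // scale1r.
have -> : forall C D V, (p - p^-1) *: (X * C + D * V) = X * ((p - p^-1) *: C) + ((p - p^-1) *: D) * V.
  by move=> C D V; nc_expand F W; ring.
rewrite IHn e [(Psi1 - K1) * _]mulrBl K1Xn.
have G := geometric_pair n XXt.
have XPsi1V : X * (Psi1 * Xt ^+ n) = Psi1 * ((1 + p ^- 2) *: Xt ^+ n.+1 - X * Xt ^+ n).
  by rewrite mulrA XPsi1 (exprS Xt n); move: (Xt ^+ n) => V; nc_expand F W; ring.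
have XXK : X * (X ^+ n * K1) = X ^+ n.+1 * K1 by rewrite mulrA -exprS.
have -> : forall g k : F, X * (g *: (Psi1 * Xt ^+ n) - k *: (X ^+ n * K1)) =
    Psi1 * ((g * (1 + p ^- 2)) *: Xt ^+ n.+1 - g *: (X * Xt ^+ n)) - k *: (X ^+ n.+1 * K1).
  move=> g k; rewrite mulrBr -!(scalerAr _ X) XPsi1V XXK.
  move: (X * Xt ^+ n) (Xt ^+ n.+1) (X ^+ n.+1) => U V V'; nc_expand F W; ring.
rewrite G (mulnS 2 n.+1) exprD !(exprS (p ^- 2)).
move: (p ^- 2 ^+ n) (p ^+ (2 * n.+1)) (X ^+ n.+1) (Xt ^+ n.+1) => r r' U V.
by nc_expand F W; field; rewrite ?q1 ?p0 ?p21.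
Qed.

Local Notation a := (tele_coef p).
Definition psi_term n : W :=
  (a ^+ n * ((1 - p ^- 2 ^+ n.+1) / (1 - p ^- 2))) *: (Psi1 * Xt ^+ n * Y ^+ n * Psi).
Definition psi_rest n : W :=
  (a ^+ n * ((p ^+ (2 * n.+1) - 1) / (p ^+ 2 - 1))) *: (X ^+ n * K1 * Y ^+ n * Psi).

(** Here [v + K1 * y] stands for the variable times [Delta (y_1)]. Its bracket with the [N]-th term
    is [psi_term N] plus the difference of two consecutive [psi_rest]: the part with [K1] of the
    bracket with [v] pairs off with the bracket with [K1 * y]. *)
Lemma psi_sum_comm N :
  K1 * K + (p - p^-1) *: comm (tele_sum p X Y Psi Z N) (v + K1 * y) =
  psi_rest N + \sum_(n < N) psi_term n.
Proof.
have p21 := p2_neq1 p0 p1.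
elim: N => [|N IHN].
  rewrite /tele_sum !big_ord0 !addr0 /psi_rest !expr0 muln1 divff // mulr1 scale1r !mul1r mulr1.
  have -> : comm Z (v + K1 * y) = K1 * (Z * y) - K1 * (y * Z).
    by rewrite mulrDr mulrDl vZ !mulrA K1Z; nc_expand F W; ring.
  by rewrite Zy; nc_expand F W; field; rewrite ?p0 ?p21.
have tS : tele_sum p X Y Psi Z N.+1 = tele_sum p X Y Psi Z N + a ^+ N *: (X ^+ N.+1 * Y ^+ N * Psi).
  rewrite /tele_sum (big_ord_recr N (fun n => a ^+ n *: (X ^+ n.+1 * Y ^+ n * Psi))).
  by rewrite /= addrA.
rewrite (big_ord_recr N psi_term) /= addrA.
have -> : psi_rest N.+1 + \sum_(i < N) psi_term i + psi_term N =
    psi_rest N + \sum_(i < N) psi_term i + (psi_rest N.+1 - psi_rest N + psi_term N).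
  by nc_expand F W; ring.
rewrite -IHN tS; move: (tele_sum p X Y Psi Z N) => S.
suff <- : (p - p^-1) *: (a ^+ N *: comm (X ^+ N.+1 * Y ^+ N * Psi) (v + K1 * y)) =
    psi_rest N.+1 - psi_rest N + psi_term N.
  by nc_expand F W; ring.
rewrite /psi_term /psi_rest.
have yY' : y * Y = p^-1 ^+ 2 *: (Y * y) + (1 - p^-1 ^+ 2) *: (Y * Y) by rewrite exprVn.
have vYN : v * Y ^+ N = Y ^+ N * v by exact: commrX.
have K1YN : K1 * Y ^+ N = Y ^+ N * K1 by exact: commrX.
have XNy : X ^+ N.+1 * y = y * X ^+ N.+1 by apply/commr_sym/commrX/commr_sym.
have YYN : Y * Y ^+ N = Y ^+ N * Y by rewrite -exprS exprSr.
have K1XN : K1 * X ^+ N.+1 = p ^+ (2 * N.+1) *: (X ^+ N.+1 * K1).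
  by rewrite exprM; exact: qcomm_powers.
have := skew_powers yY' N; have := powers_comm N; move: K1XN XNy.
have : p^-1 ^+ (2 * N) = (p ^+ (2 * N))^-1 by rewrite exprVn.
have : p ^+ (2 * N) != 0 by rewrite expf_neq0.
move: vYN K1YN YYN.
rewrite (exprS Y N) (exprSr a N) !(mulnS 2 N.+1) !(exprD p 2 (2 * N.+1)) !(mulnS 2 N) !(exprD p 2 (2 * N)).
move: (Y ^+ N) (p ^+ (2 * N)) => U r vU K1U YU r0 -> K1V Vy Vv yU.
have -> : X ^+ N.+1 * U * Psi * (v + K1 * y) =
    X ^+ N.+1 * v * U * Psi + X ^+ N.+1 * K1 * U * (Psi * y).
  rewrite mulrDr -!mulrA -vPsi [K1 * (U * _)]mulrA K1U -!mulrA [v * (U * _)]mulrA vU -!mulrA.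
  by rewrite [K1 * (Psi * _)]mulrA K1Psi -mulrA.
have -> : (v + K1 * y) * (X ^+ N.+1 * U * Psi) =
    v * X ^+ N.+1 * U * Psi + K1 * X ^+ N.+1 * (y * U) * Psi.
  by rewrite mulrDl !mulrA -[K1 * y * _]mulrA -Vy !mulrA.
rewrite Psi_y yU K1V.
have -> : X ^+ N.+1 * v * U * Psi = v * X ^+ N.+1 * U * Psi +
  (p - p^-1)^-1 *: (((p - p^-1) *: comm (X ^+ N.+1) v) * U * Psi).
  rewrite -!scalerAl scalerA mulVf // scale1r; move: (X ^+ N.+1) => V.
  by nc_expand F W; ring.
rewrite Vv (_ : forall b c : F, X ^+ N.+1 * K1 * U * (b *: (y * Psi) - c *: (Y * Psi)) =
   X ^+ N.+1 * K1 * (b *: (U * y) - c *: (Y * U)) * Psi); last first.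
  by move=> b c; rewrite YU; move: (X ^+ N.+1) => V; nc_expand F W; ring.
move: (p ^- 2 ^+ N.+1) (Xt ^+ N) (X ^+ N.+1) (X ^+ N) (a ^+ N) => r' V' V V0 b.
rewrite /tele_coef.
by nc_expand F W; field; rewrite ?p0 ?r0 ?p21.
Qed.

End PsiTelescope.

(** * Systems of currents *)

(* The expansion coefficients of [p^-2 (1 - p^2 z) / (1 - p^-2 z)]. *)
Definition conj_coef (F : fieldType) (p : F) (k : nat) : F :=
  (k == 0%N)%:R * p ^+ 2 - (p ^+ 2 - p ^- 2) * p ^- (2 * k).

Definition quadratic (F : fieldType) (T : algType F) (p : F) (xi : nat -> T) :=
  forall k l, xi k.+1 * xi l - p ^+ 2 *: (xi l * xi k.+1) =
    p ^+ 2 *: (xi k * xi l.+1) - xi l.+1 * xi k.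

(** For [p = q] and series in [z^-1], as well as for [p = q^-1] and series in [z], this is the
    substitution of [q^2 z] for [z]. *)
Definition scaled (F : fieldType) (T : algType F) (p : F) (xi : nat -> T) : fps T :=
  fun k => p ^- (2 * k) *: xi k.

Section SeriesLemmas.
Variables (F : fieldType) (T : algType F).
Implicit Types f g : fps T.

Lemma fps_comm f g : (forall i j, f i * g j = g j * f i) -> f * g = g * f.
Proof.
move=> fg; apply/funext => k; rewrite !fpsM (reindex_inj rev_ord_inj) /=.
by apply: eq_bigr => i _; rewrite subSS subKn ?fg // -ltnS.
Qed.

Lemma fpsTC_mull a f : fpsT (fpsC a) * f = fpsT (fun k => a * f k).
Proof. by rewrite fpsT_mull; congr fpsT; apply/funext => k; rewrite fpsCMl. Qed.

Lemma fpsTC_mulr a f : f * fpsT (fpsC a) = fpsT (fun k => f k * a).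
Proof. by rewrite fpsT_mulr; congr fpsT; apply/funext => k; rewrite fpsCMr. Qed.

Definition fps_shift f : fps T := fun k => f k.+1.

Lemma fpsT_shift f : fpsT (fps_shift f) = f - fpsC (f 0%N).
Proof.
apply/funext => -[|k]; first by rewrite fpsD fpsN /fpsC /= subrr.
by rewrite fpsD fpsN /fpsC /= subr0.
Qed.

(** Uniqueness for the fixed-point equation: bracketing with a multiple of the variable raises the
    order of vanishing by one, so [D] vanishes as far as [R] does. *)
Lemma small_fixpoint N (h : T) (D R : fps T) :
  D = fpsT (fpsC h) * D - D * fpsT (fpsC h) + R ->
  fps_small N R -> fps_small N D.
Proof.
move=> DR R0; suff: forall m, (m <= N)%N -> fps_small m D by apply.
elim=> [//|m IHm mN]; rewrite DR fpsTC_mull fpsTC_mulr.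
apply: smallS => [|k km]; last by apply: R0; exact: leq_trans mN.
apply: smallS; last apply: smallN; apply: smallT => k km;
  by rewrite IHm ?mulr0 ?mul0r // ltnW.
Qed.

Definition fps_dilate (r : F) f : fps T := fun k => r ^+ k *: f k.

Lemma fps_dilate1 f : fps_dilate 1 f = f.
Proof. by apply/funext => k; rewrite /fps_dilate expr1n scale1r. Qed.

Lemma quadratic_dilate p r (X : fps T) : quadratic p X -> quadratic p (fps_dilate r X).
Proof.
move=> XX k l; rewrite /fps_dilate.
have -> : p ^+ 2 *: (r ^+ k *: X k * (r ^+ l.+1 *: X l.+1)) - r ^+ l.+1 *: X l.+1 * (r ^+ k *: X k) =
   (r ^+ k * r ^+ l.+1) *: (p ^+ 2 *: (X k * X l.+1) - X l.+1 * X k).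
  by nc_expand F T; ring.
by rewrite -XX !exprS; nc_expand F T; ring.
Qed.

(** The two-variable relation between the current at [z] and at [w], restricted to proportional
    arguments. *)
Lemma quadratic_shift p r (X : fps T) : quadratic p X ->
  fps_shift X * fps_dilate r X - p ^+ 2 *: (fps_dilate r X * fps_shift X) =
  p ^+ 2 *: (X * fps_dilate r (fps_shift X)) - fps_dilate r (fps_shift X) * X.
Proof.
move=> XX; apply/funext => n; rewrite !(fpsD, fpsN, fpsZ, fpsM).
rewrite [X in _ - _ *: X](reindex_inj rev_ord_inj) [X in _ = _ - X](reindex_inj rev_ord_inj) /=.
rewrite !scaler_sumr -!sumrB; apply: eq_bigr => i _.
rewrite subSS subKn -1?ltnS // /fps_dilate /fps_shift -!scalerAl -!scalerAr.
have Zc (v : T) : p ^+ 2 *: (r ^+ (n - i) *: v) = r ^+ (n - i) *: (p ^+ 2 *: v).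
  by rewrite !scalerA mulrC.
by rewrite !Zc -!scalerBr XX.
Qed.

Hypothesis two0 : 2%:R != 0 :> F.

(** At [r = 1] the two sides of [quadratic_shift] are opposite to each other, so both vanish once 2
    is invertible. Multiplied by the variable, this reads [(X - x0) * X = p^2 X * (X - x0)]. *)
Lemma quadratic_series p (X : fps T) : quadratic p X ->
  fpsC (X 0%N) * X = p ^+ 2 *: (X * fpsC (X 0%N)) + (1 - p ^+ 2) *: (X * X).
Proof.
move=> XX; have := quadratic_shift 1 XX; rewrite !fps_dilate1 => e.
have {}e : fps_shift X * X = p ^+ 2 *: (X * fps_shift X).
  apply: (scalerI two0); move: e.
  move: (fps_shift X * X) (p ^+ 2 *: (X * fps_shift X)) => a b e.
  have -> : 2%:R *: a = (a - b) - (b - a) + 2%:R *: b by nc_expand F (fps T); ring.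
  by rewrite e subrr add0r.
have := congr1 (@fpsT F T) e.
rewrite linearZ /= -fpsT_mull -fpsT_mulr fpsT_shift mulrBl mulrBr => {}e.
have -> : fpsC (X 0%N) * X = X * X - (X * X - fpsC (X 0%N) * X) by rewrite opprB addrC subrK.
by rewrite e; nc_expand F (fps T); ring.
Qed.

(** The case [r = p^-2] of [quadratic_shift]. The terms containing the constant coefficient are
    removed by [quadratic_series] for [X] and for [Xt], and a common factor [p ^+ 2 - 1] is then
    cancelled. *)
Lemma quadratic_scaled p (X : fps T) : p != 0 -> p ^+ 2 - 1 != 0 -> quadratic p X ->
  let Xt := scaled p X in
  (1 + p ^+ 2) *: (X * Xt) = Xt * Xt + p ^+ 2 *: (X * X).
Proof.
move=> p0 p21 XX /=.
have -> : scaled p X = fps_dilate (p ^- 2) X.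
  by apply/funext => k; rewrite /scaled /fps_dilate exprVn exprM.
set Xt := fps_dilate _ X.
have tXt : fpsT (fps_dilate (p ^- 2) (fps_shift X)) = p ^+ 2 *: (Xt - fpsC (X 0%N)).
  apply/funext => -[|k]; rewrite fpsZ fpsD fpsN /fpsC /Xt /fps_dilate /=.
    by rewrite expr0 scale1r subrr scaler0.
  by rewrite subr0 scalerA (exprS (p ^- 2)) mulrA mulfV ?mul1r // expf_neq0.
have := congr1 (@fpsT F T) (quadratic_shift (p ^- 2) XX).
rewrite -/Xt !linearB /= !linearZ /= -(fpsT_mull _ Xt) -(fpsT_mulr Xt).
rewrite -(fpsT_mulr X) -(fpsT_mull _ X) fpsT_shift tXt.
have := quadratic_series (quadratic_dilate (p ^- 2) XX); rewrite -/Xt.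
have -> : fpsC (Xt 0%N) = fpsC (X 0%N) :> fps T by rewrite /Xt /fps_dilate expr0 scale1r.
move: (quadratic_series XX); move: (fpsC (X 0%N)) => x0 e1 e2.
set L := _ + _; set R := _ - _ => LR.
apply: (scalerI p21).
have -> : (p ^+ 2 - 1) *: ((1 + p ^+ 2) *: (X * Xt)) =
    R - L + p ^+ 2 *: (Xt * x0) - x0 * Xt + p ^+ 2 *: (p ^+ 2 *: (X * x0) - x0 * X).
  by rewrite /R /L; nc_expand F (fps T); ring.
rewrite LR subrr add0r e1 e2.
by nc_expand F (fps T); ring.
Qed.

End SeriesLemmas.

(* [xi] and [h1] come from one tensor factor, [eta], [zeta], [psi] and [h2] from
   the other; they are rescaled by powers of [c] so that [c] no longer appears. *)
Record current_system (F : fieldType) (T : algType F) (p : F)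
    (xi eta zeta psi : nat -> T) (h1 h2 : T) : Prop := CurrentSystem {
  cs_xi : quadratic p xi;
  cs_eta : quadratic p^-1 eta;
  cs_h1_xi k : h1 * xi k - xi k * h1 = xi k.+1;
  cs_h2_eta k : h2 * eta k - eta k * h2 = - eta k.+1;
  cs_h2_zeta k : h2 * zeta k - zeta k * h2 = zeta k.+1;
  cs_h2_psi k : h2 * psi k = psi k * h2;
  cs_zeta_eta k : zeta k * eta 0%N - eta 0%N * zeta k = (p - p^-1)^-1 *: psi k.+1;
  cs_psi_eta k : psi k * eta 0%N =
    \sum_(i < k.+1) conj_coef p i *: (eta i * psi (k - i)%N);
  cs_comm u v : (u = h1 \/ exists k, u = xi k) ->
    (v = h2 \/ exists k, [\/ v = eta k, v = zeta k | v = psi k]) -> u * v = v * u }.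

Section CurrentSystem.
Variables (F : fieldType) (T : algType F) (p : F).
Hypotheses (two0 : 2%:R != 0 :> F) (p0 : p != 0) (p1 : p - p^-1 != 0).
Variables (xi eta zeta psi : nat -> T) (h1 h2 : T).
Hypothesis sys : current_system p xi eta zeta psi h1 h2.

Local Notation X := (xi : fps T).
(** The extra power of the variable accounts for [eta] starting one index later than the current
    that it represents; it makes [Y ^+ n] divisible by the [n]-th power. *)
Local Notation Y := (fpsT (scaled p eta)).
Local Notation y := (fpsT (fpsC (eta 0%N))).
Local Notation x0 := (fpsC (xi 0%N)).
Local Notation Psi := (psi : fps T).
Local Notation Z := (zeta : fps T).
Local Notation H1 := (fpsT (fpsC h1)).
Local Notation H2 := (fpsT (fpsC h2)).

Lemma series_H1X : H1 * X = X * H1 + X - x0.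
Proof.
rewrite fpsTC_mull fpsTC_mulr -addrA -fpsT_shift -linearD; congr fpsT.
by apply/funext => k; rewrite fpsD /fps_shift -(cs_h1_xi sys) addrC subrK.
Qed.

Lemma series_H2Z : H2 * Z = Z * H2 + Z - fpsC (zeta 0%N).
Proof.
rewrite fpsTC_mull fpsTC_mulr -addrA -fpsT_shift -linearD; congr fpsT.
by apply/funext => k; rewrite fpsD /fps_shift -(cs_h2_zeta sys) addrC subrK.
Qed.

Lemma series_H2Y : H2 * Y = Y * H2 - p ^+ 2 *: (Y - y).
Proof.
rewrite fpsTC_mull fpsTC_mulr -linearB -linearZ -linearB; congr fpsT.
apply/funext => -[|k]; rewrite !(fpsD, fpsN, fpsZ) /scaled /fpsC /=.
  by rewrite mulr0 mul0r muln0 expr0 invr1 scale1r subrr scaler0 subrr.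
rewrite subr0 scalerA mulnS exprD invfM mulrA divff ?expf_neq0 // mul1r -scalerAr -scalerAl.
rewrite -scalerBr; congr (_ *: _).
by rewrite -[eta k.+1]opprK -(cs_h2_eta sys) opprK addrC subrK.
Qed.

Lemma series_yY : y * Y = p ^- 2 *: (Y * y) + (1 - p ^- 2) *: (Y * Y).
Proof.
have := quadratic_series two0 (quadratic_dilate (p ^- 2) (cs_eta sys)).
have <- : scaled p eta = fps_dilate (p ^- 2) eta.
  by apply/funext => k; rewrite /scaled /fps_dilate exprVn exprM.
rewrite exprVn /scaled muln0 expr0 invr1 scale1r -/(scaled p eta) => e.
have TT (f g : fps T) : fpsT f * fpsT g = fpsT (fpsT (f * g)) by rewrite fpsT_mull fpsT_mulr.
by rewrite !TT e !linearD !linearZ.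
Qed.

(** The Kronecker part of [conj_coef] contributes the term with [y], and its geometric part is
    exactly the rescaling contained in [Y]. *)
Lemma series_Psi_y : Psi * y = p ^+ 2 *: (y * Psi) - (p ^+ 2 - p ^- 2) *: (Y * Psi).
Proof.
rewrite fpsTC_mull fpsTC_mulr fpsT_mull -!linearZ -linearB; congr fpsT.
apply/funext => k; rewrite fpsD fpsN !fpsZ fpsM (cs_psi_eta sys) scaler_sumr.
rewrite (big_ord_recl k (fun i => conj_coef p i *: (eta i * psi (k - i)%N))).
rewrite (big_ord_recl k (fun i =>
  (p ^+ 2 - p ^- 2) *: (scaled p eta i * psi (k - i)%N))) /=.
rewrite subn0 /scaled /conj_coef /= muln0 expr0 invr1 mulr1 mul1r scale1r.
rewrite scalerBl [in RHS]opprD [in RHS]addrA.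
congr (_ + _); rewrite -sumrN; apply: eq_bigr => i _.
by rewrite mul0r sub0r scaleNr -scalerAl scalerA.
Qed.

Lemma series_Zy : Z * y = y * Z + (p - p^-1)^-1 *: (Psi - fpsC (psi 0%N)).
Proof.
rewrite fpsTC_mull fpsTC_mulr -fpsT_shift -linearZ -linearD; congr fpsT.
by apply/funext => k; rewrite fpsD fpsZ /fps_shift -(cs_zeta_eta sys) addrC subrK.
Qed.

Local Notation second_comm v := (v = h2 \/ exists k, [\/ v = eta k, v = zeta k | v = psi k]).
Local Notation first_comm u := (u = h1 \/ exists k, u = xi k).

Lemma cs_first_series (u : fps T) (v : T) :
  u \in [:: X; x0; H1] -> second_comm v -> forall i, u i * v = v * u i.
Proof.
move=> us vP i; have c w : first_comm w -> w * v = v * w by move=> wP; exact: (cs_comm sys).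
move: us; rewrite !inE => /or3P[] /eqP ->.
- by apply: c; right; exists i.
- by rewrite /fpsC; case: eqP => _; rewrite ?mul0r ?mulr0 // c //; right; exists 0%N.
- by case: i => [|[|i]]; rewrite /= ?mul0r ?mulr0 // c //; left.
Qed.

Lemma cs_series_comm (u w : fps T) :
  u \in [:: X; x0; H1] -> w \in [:: Y; y; H2; Psi; Z] -> u * w = w * u.
Proof.
move=> us ws; apply: fps_comm => i j.
have c v : second_comm v -> u i * v = v * u i by move=> vP; exact: cs_first_series.
move: ws; rewrite !inE => /or4P[/eqP->|/eqP->|/eqP->|/orP[]/eqP->].
- case: j => [|j] /=; rewrite ?mulr0 ?mul0r // /scaled -scalerAr -scalerAl c //.
  by right; exists j; apply: Or31.
- by case: j => [|[|j]]; rewrite /= ?mul0r ?mulr0 // c //; right; exists 0%N; apply: Or31.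
- by case: j => [|[|j]]; rewrite /= ?mul0r ?mulr0 // c //; left.
- by rewrite c //; right; exists j; apply: Or33.
- by rewrite c //; right; exists j; apply: Or32.
Qed.

Section Solution.
Variable f : nat -> T.
Hypothesis f0 : f 0%N = zeta 0%N + xi 0%N * psi 0%N.
Let h := h1 + h2 - (p - p^-1) *: (xi 0%N * eta 0%N).
Hypothesis f_rec : forall k, h * f k - f k * h = f k.+1.

(** The comultiplication enters only through the initial value and the recursion of [f], so the same
    statement, read in the opposite algebra, also treats the [y_k]. *)
Lemma current_solution N : fps_small N ((f : fps T) - tele_sum p X Y Psi Z N).
Proof.
have cc u w : u \in [:: X; x0; H1] -> w \in [:: Y; y; H2; Psi; Z] -> u * w = w * u.
  exact: cs_series_comm.
have hH : tele_H p x0 H1 y H2 = fpsT (fpsC h).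
  rewrite /tele_H fpsT_mulr -fpsCM; apply/funext => -[|[|k]];
    by rewrite !(fpsD, fpsN, fpsZ) /fpsC /= ?scaler0 ?subr0 ?addr0.
have small_f0 : fpsC (zeta 0%N) + x0 * fpsC (psi 0%N) = fpsC (f 0%N).
  by rewrite -fpsCM f0; apply/funext => -[|k]; rewrite fpsD /fpsC ?addr0.
have fE : (f : fps T) = fpsC (f 0%N) + (fpsT (fpsC h) * (f : fps T) - (f : fps T) * fpsT (fpsC h)).
  rewrite fpsTC_mull fpsTC_mulr -linearB.
  transitivity (fpsC (f 0%N) + fpsT (fps_shift f)); first by rewrite fpsT_shift addrC subrK.
  by congr (_ + fpsT _); apply/funext => k; rewrite fpsD fpsN f_rec.
have := tele_sum_comm p0 p1 (quadratic_series two0 (cs_xi sys)) series_H1X series_yY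
  series_H2Y series_Psi_y (fps_comm _) series_H2Z series_Zy.
rewrite -/X -/Psi -/Z => /(_ _ (cc _ _ _ _) (cc _ _ _ _) (cc _ _ _ _) (cc _ _ _ _) (cc _ _ _ _)
  (cc _ _ _ _) (cc _ _ _ _) (cc _ _ _ _) (cc _ _ _ _)) tele.
have {}tele : fpsT (fpsC h) * tele_sum p X Y Psi Z N - tele_sum p X Y Psi Z N * fpsT (fpsC h) =
  tele_sum p X Y Psi Z N - fpsC (f 0%N) - tele_coef p ^+ N *:
   ((H1 + H2) * (X ^+ N.+1 * Y ^+ N * Psi) - X ^+ N.+1 * Y ^+ N * Psi * (H1 + H2)
     - X ^+ N.+1 * Y ^+ N * Psi).
  rewrite -hH -small_f0 tele // ?inE ?eqxx ?orbT // => i j.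
  by case: i => [|[|i]]; rewrite /= ?mul0r ?mulr0 // (cs_h2_psi sys).
move: tele; set S := tele_sum _ _ _ _ _ _; set t := _ * _ * _; set Hh := fpsT _ => tele.
(* The factor [Y ^+ N] alone supplies the [N] powers of the variable. *)
have small_t : fps_small N t by apply/smallMr/smallMl/smallTX.
apply: (@small_fixpoint _ _ N h _ (- (tele_coef p ^+ N *: ((H1 + H2) * t - t * (H1 + H2) - t)))).
  rewrite -/Hh mulrBr mulrBl; rewrite [in LHS]fE -/Hh.
  have SE : S = fpsC (f 0%N) + (Hh * S - S * Hh) + tele_coef p ^+ N *: ((H1 + H2) * t - t * (H1 + H2) - t).
    by rewrite tele; nc_expand F (fps T); ring.
  by rewrite [in LHS]SE; nc_expand F (fps T); ring.
apply: smallN; apply: smallZ; apply: smallS; last exact: smallN.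
by apply: smallS; [exact: smallMl | apply: smallN; exact: smallMr].
Qed.
End Solution.

Section PsiSystem.
(** These play in the first tensor factor the part that [eta 0] and [psi] play in the second; the
    element [d] below is then the rescaled [Delta (y_1)] or [Delta (y_0)]. *)
Variables (w0 : T) (psi1 : nat -> T).
Local Notation Psi1 := (psi1 : fps T).
Local Notation Xt := (scaled p xi).
Local Notation K1 := (fpsC (psi1 0%N)).
Hypothesis ps_xi_w : forall k, xi k * w0 - w0 * xi k = (p - p^-1)^-1 *: psi1 k.+1.
Hypothesis ps_K_xi : forall k, psi1 0%N * xi k = p ^+ 2 *: (xi k * psi1 0%N).
Hypothesis ps_xi_psi1 : forall k, xi 0%N * psi1 k =
  \sum_(i < k.+1) conj_coef p i *: (psi1 (k - i)%N * xi i).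
Hypothesis ps_h1_psi1 : forall k, h1 * psi1 k = psi1 k * h1.
Hypothesis ps_comm : forall u v, u = w0 \/ u = psi1 0%N ->
  (exists k, [\/ v = eta k, v = zeta k | v = psi k]) -> u * v = v * u.

Lemma series_x0Psi1 : x0 * Psi1 =
  p ^+ 2 *: (Psi1 * x0) - (p ^+ 2 - p ^- 2) *: (Psi1 * Xt).
Proof.
apply/funext => k; rewrite fpsD fpsN !fpsZ fpsCMl fpsCMr ps_xi_psi1 fpsM scaler_sumr.
rewrite [X in _ = _ - X](reindex_inj rev_ord_inj) /=.
rewrite (big_ord_recl k (fun i => conj_coef p i *: (psi1 (k - i)%N * xi i))).
rewrite (big_ord_recl k (fun i =>
  (p ^+ 2 - p ^- 2) *: (psi1 (k.+1 - i.+1)%N * Xt (k - (k.+1 - i.+1))%N))) /=.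
rewrite subn0 subSS subn0 subnn /scaled /conj_coef /= muln0 expr0 invr1 mulr1 mul1r scale1r scalerBl
  [in RHS]opprD [in RHS]addrA.
congr (_ + _); rewrite -sumrN; apply: eq_bigr => i _.
by rewrite mul0r sub0r scaleNr subSS subKn // -scalerAr scalerA.
Qed.

Lemma series_H1Xt : H1 * Xt = Xt * H1 + p ^+ 2 *: (Xt - x0).
Proof.
rewrite fpsTC_mull fpsTC_mulr.
have -> : p ^+ 2 *: (Xt - x0) = fpsT (fun k => p ^- (2 * k) *: xi k.+1).
  apply/funext => -[|k]; rewrite fpsZ fpsD fpsN /scaled /fpsC /=.
    by rewrite muln0 expr0 invr1 scale1r subrr scaler0.
  by rewrite subr0 scalerA mulnS exprD invfM mulrA divff ?expf_neq0 // mul1r.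
rewrite -linearD; congr fpsT; apply/funext => k; rewrite fpsD /scaled -scalerAr -scalerAl -scalerDr.
by rewrite -(cs_h1_xi sys) addrC subrK.
Qed.

(* Both sides satisfy [f = x0 * Psi1 + (H1 * f - f * H1)], which has only one solution. *)
Lemma series_XPsi1 : X * Psi1 = Psi1 * ((1 + p ^- 2) *: Xt - X).
Proof.
apply/eqP; rewrite -subr_eq0; apply/eqP/funext => N; set D := _ - _.
apply: (@small_fixpoint _ _ N.+1 h1 D 0) => //.
have H1Psi1 : H1 * Psi1 = Psi1 * H1.
  by apply: fps_comm => -[|[|i]] j; rewrite /= ?mul0r ?mulr0.
rewrite addr0 /D [H1 * (_ - _)]mulrBr.
have -> : H1 * (X * Psi1) = (X * H1 + X - x0) * Psi1 by rewrite mulrA series_H1X.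
have -> : H1 * (Psi1 * ((1 + p ^- 2) *: Xt - X)) =
    Psi1 * ((1 + p ^- 2) *: (Xt * H1 + p ^+ 2 *: (Xt - x0)) - (X * H1 + X - x0)).
  by rewrite mulrA H1Psi1 -mulrA mulrBr -scalerAr series_H1X series_H1Xt.
have -> : (X * Psi1 - Psi1 * ((1 + p ^- 2) *: Xt - X)) * H1 =
    X * (H1 * Psi1) - Psi1 * ((1 + p ^- 2) *: (Xt * H1) - X * H1).
  by rewrite mulrBl -!mulrA H1Psi1 mulrBl -scalerAl.
have -> : (X * H1 + X - x0) * Psi1 = X * (H1 * Psi1) + X * Psi1 - x0 * Psi1.
  by rewrite mulrBl mulrDl mulrA.
rewrite series_x0Psi1; move: (H1 * Psi1) => U.
by nc_expand F (fps T); field; rewrite ?p0.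
Qed.

Section PsiSolution.
Variables f P : nat -> T.
Hypothesis f0 : f 0%N = zeta 0%N + xi 0%N * psi 0%N.
Let h := h1 + h2 - (p - p^-1) *: (xi 0%N * eta 0%N).
Hypothesis f_rec : forall k, h * f k - f k * h = f k.+1.
Hypothesis P0 : P 0%N = psi1 0%N * psi 0%N.
Let d := w0 + psi1 0%N * eta 0%N.
Hypothesis P_rec : forall k, P k.+1 = (p - p^-1) *: (f k * d - d * f k).

(** Up to its constant term, [P] is the bracket of [f] with [d], shifted by one degree. Bracketing
    preserves the congruence of [current_solution], and [psi_rest N] is negligible because it
    contains [Y ^+ N]. *)
Lemma psi_solution N :
  fps_small N ((P : fps T) - \sum_(n < N) psi_term p Y Psi Xt Psi1 n).
Proof.
have cc u w : u \in [:: X; x0; H1] -> w \in [:: Y; y; H2; Psi; Z] -> u * w = w * u.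
  exact: cs_series_comm.
set v := fpsT (fpsC w0).
have second w : w \in [:: Y; y; Psi; Z] ->
    forall j, w j = 0 \/ exists a v', w j = a *: v' /\ exists k, [\/ v' = eta k, v' = zeta k | v' = psi k].
  rewrite !inE => /or4P[]/eqP-> j.
  - case: j => [|j]; [by left | right; exists (p ^- (2 * j)), (eta j); split=> //].
    by exists j; apply: Or31.
  - case: j => [|[|j]]; [by left | right | by left].
    by exists 1, (eta 0%N); rewrite scale1r; split=> //; exists 0%N; apply: Or31.
  - by right; exists 1, (psi j); rewrite scale1r; split=> //; exists j; apply: Or33.
  - by right; exists 1, (zeta j); rewrite scale1r; split=> //; exists j; apply: Or32.
have cv u w : u \in [:: v; K1] -> w \in [:: Y; y; Psi; Z] -> u * w = w * u.
  move=> us ws; apply: fps_comm => i j; have [->|[a [v' [-> v'P]]]] := second _ ws j.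
    by rewrite mulr0 mul0r.
  rewrite -scalerAr -scalerAl; congr (_ *: _).
  move: us; rewrite !inE => /orP[]/eqP->.
    by case: i => [|[|i]]; rewrite /= ?mul0r ?mulr0 //; apply: ps_comm => //; left.
  by case: i => [|i]; rewrite /= ?mul0r ?mulr0 //; apply: ps_comm => //; right.
have p21 := p2_neq1 p0 p1.
have K1X : K1 * X = p ^+ 2 *: (X * K1).
  by apply/funext => k; rewrite fpsZ fpsCMl fpsCMr ps_K_xi.
have Xv : X * v = v * X + (p - p^-1)^-1 *: (Psi1 - K1).
  rewrite /v fpsTC_mulr fpsTC_mull -fpsT_shift -linearZ -linearD; congr fpsT.
  by apply/funext => k; rewrite fpsD fpsZ /fps_shift -ps_xi_w addrC subrK.
have vE : v + K1 * y = fpsT (fpsC d).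
  rewrite fpsT_mulr -fpsCM -linearD; congr fpsT.
  by apply/funext => -[|k]; rewrite fpsD /fpsC /= ?addr0.
have PE : (P : fps T) = K1 * fpsC (psi 0%N) +
    (p - p^-1) *: ((f : fps T) * (v + K1 * y) - (v + K1 * y) * (f : fps T)).
  rewrite vE fpsTC_mulr fpsTC_mull -linearB -linearZ -fpsCM.
  transitivity (fpsC (P 0%N) + fpsT (fps_shift P)); first by rewrite fpsT_shift addrC subrK.
  rewrite P0; congr (_ + fpsT _); apply/funext => k.
  by rewrite fpsZ fpsD fpsN -P_rec.
have := psi_sum_comm p0 p1 series_yY series_Psi_y series_Zy
  (quadratic_scaled two0 p0 p21 (cs_xi sys)) series_XPsi1 K1X Xv.
rewrite -/X -/Psi -/Z => /(_ (cc _ _ _ _) (cv _ _ _ _) (cv _ _ _ _) (cv _ _ _ _)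
  (cv _ _ _ _) (cv _ _ _ _) (cv _ _ _ _) N) tele.
have {}tele : \sum_(n < N) psi_term p Y Psi Xt Psi1 n = K1 * fpsC (psi 0%N) +
    (p - p^-1) *: (tele_sum p X Y Psi Z N * (v + K1 * y)
      - (v + K1 * y) * tele_sum p X Y Psi Z N) - psi_rest p X Y Psi K1 N.
  by rewrite tele ?addKr ?inE ?eqxx ?orbT //; nc_expand F (fps T); ring.
have sol : fps_small N ((f : fps T) - tele_sum p X Y Psi Z N) := current_solution f0 f_rec (N := N).
rewrite tele [X in X - _]PE; move: sol; set S := tele_sum _ _ _ _ _ _; set V := v + _ => sol.
have -> : K1 * fpsC (psi 0%N) + (p - p^-1) *: ((f : fps T) * V - V * (f : fps T)) -
    (K1 * fpsC (psi 0%N) + (p - p^-1) *: (S * V - V * S) - psi_rest p X Y Psi K1 N) =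
    psi_rest p X Y Psi K1 N + (p - p^-1) *: (((f : fps T) - S) * V - V * ((f : fps T) - S)).
  by nc_expand F (fps T); ring.
apply: smallS; first by apply/smallZ/smallMr/smallMl/smallTX.
by apply/smallZ/smallS; [exact: smallMr | apply/smallN/smallMl].
Qed.

End PsiSolution.

End PsiSystem.

End CurrentSystem.

(** * Logarithmic derivatives of exponential series and conjugation by them *)

Section EulerOperator.
Variables (F : fieldType) (A : algType F).
Hypothesis char0 : forall n, n.+1%:R != 0 :> F.
Implicit Types f g : fps A.

(** The derivation [t d/dt], which preserves degrees, so that no index shift appears in the equation
    for [Psi]. *)
Definition fps_euler f : fps A := fun n => n%:R *: f n.

Lemma fps_euler_linear : linear fps_euler.
Proof.
move=> a f g; apply/funext => n; rewrite /fps_euler fpsD !fpsZ scalerDr fpsD fpsZ.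
by rewrite !scalerA mulrC.
Qed.
HB.instance Definition _ := GRing.isLinear.Build F (fps A) (fps A) _ fps_euler fps_euler_linear.

Lemma fps_eulerM f g : fps_euler (f * g) = fps_euler f * g + f * fps_euler g.
Proof.
apply/funext => n; rewrite fpsD /fps_euler !fpsM scaler_sumr -big_split.
apply: eq_bigr => i _ /=; rewrite -scalerAl -scalerAr -scalerDl -natrD subnKC //.
by rewrite -ltnS.
Qed.

Lemma fps_eulerC a : fps_euler (fpsC a) = 0.
Proof. by apply/funext => -[|n]; rewrite /fps_euler /fpsC ?scale0r ?scaler0. Qed.

(** Since [M 0 = 0], coefficient [n.+1] of [f * M] involves only lower coefficients of [f], while
    the left side is [n.+1] times that of [f]. *)
Lemma euler_unique f M : fps_euler f = f * M -> f 0%N = 0 -> M 0%N = 0 -> f = 0.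
Proof.
move=> fM f0 M0; apply/funext => n; elim/ltn_ind: n => -[//|n] IHn.
apply: (scalerI (char0 n)); rewrite scaler0.
rewrite -[LHS]/(fps_euler f n.+1) fM fpsM big_ord_recr /= subnn M0 mulr0 addr0.
by rewrite big1 // => i _; rewrite IHn ?mul0r.
Qed.

Lemma fps_eulerX f n : fps_euler f * f = f * fps_euler f ->
  fps_euler (f ^+ n.+1) = n.+1%:R *: (fps_euler f * f ^+ n).
Proof.
move=> fc; elim: n => [|n IHn]; first by rewrite expr1 scale1r mulr1.
have c : f * fps_euler f * f ^+ n = fps_euler f * f ^+ n.+1 by rewrite -fc -mulrA -exprS.
rewrite exprS fps_eulerM IHn -scalerAr mulrA c -[n.+2%:R]natr1 addrC scalerDl scale1r.
by rewrite addrC.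
Qed.

(** [fps_exp] cuts the exponential at a length depending on the degree; products need one length for
    all degrees up to [n], and longer cuts change nothing because [f ^+ r] starts in degree [r]. *)
Lemma fps_expE f n M : f 0%N = 0 -> (n < M)%N ->
  fps_exp f n = (\sum_(r < M) (r`!%:R : F)^-1 *: f ^+ r) n.
Proof.
move=> f0 nM; rewrite fps_sum /fps_exp.
have fT : f = fpsT (fps_shift f) by apply/funext => -[|k].
rewrite (big_ord_widen M (fun r => (r`!%:R : F)^-1 *: (f ^+ r) n)) // big_mkcond.
apply: eq_bigr => r _; rewrite fpsZ ltnS; case: leqP => // nr.
by rewrite fT smallTX ?scaler0.
Qed.

Lemma fps_euler_exp f : f 0%N = 0 -> fps_euler f * f = f * fps_euler f ->
  fps_euler (fps_exp f) = fps_euler f * fps_exp f.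
Proof.
move=> f0 fc; apply/funext => n.
have e1 : fps_euler 1 = 0 :> fps A.
  by apply/funext => -[|m]; rewrite /fps_euler fps1 ?scale0r ?scaler0.
transitivity (fps_euler (\sum_(r < n.+1) (r`!%:R : F)^-1 *: f ^+ r) n).
  by rewrite /fps_euler (fps_expE f0 (ltnSn n)).
rewrite linear_sum fps_sum big_ord_recl expr0 linearZ /= e1 scaler0 add0r.
rewrite fpsM big_ord_recl [X in X * _]scale0r mul0r add0r.
have -> : \sum_(i < n) fps_euler f (lift ord0 i) * fps_exp f (n - lift ord0 i)%N =
    (fps_euler f * \sum_(r < n) (r`!%:R : F)^-1 *: f ^+ r) n.
  rewrite fpsM big_ord_recl [X in X * _]scale0r mul0r add0r; apply: eq_bigr => i _.
  by rewrite (@fps_expE _ _ n) // ltn_subrL /= (leq_ltn_trans _ (ltn_ord i)).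
rewrite mulr_sumr fps_sum; apply: eq_bigr => i _.
rewrite /= linearZ /= fps_eulerX // scalerA -scalerAr !fpsZ; congr (_ *: _).
rewrite factS natrM invfM mulrAC mulVf ?mul1r //.
Qed.

Lemma fps_exp_comm f g : g 0%N = 0 -> f * g = g * f -> f * fps_exp g = fps_exp g * f.
Proof.
move=> g0 fg; apply/funext => n.
pose S := \sum_(r < n.+1) (r`!%:R : F)^-1 *: g ^+ r.
have SE i : (i <= n)%N -> fps_exp g i = S i by move=> i_n; exact: fps_expE.
have fS : f * S = S * f.
  rewrite mulr_sumr mulr_suml; apply: eq_bigr => r _.
  by rewrite -scalerAr -scalerAl commrX.
transitivity ((f * S) n).
  by rewrite !fpsM; apply: eq_bigr => i _; rewrite SE ?leq_subr.
by rewrite fS !fpsM; apply: eq_bigr => i _; rewrite SE // -ltnS.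
Qed.

End EulerOperator.

Section Conjugation.
Variables (F : fieldType) (A : algType F) (p : F).
Hypothesis char0 : forall n, n.+1%:R != 0 :> F.
Hypotheses (p0 : p != 0) (p1 : p - p^-1 != 0).
Variables (h psi u : nat -> A).
Let M : fps A := fun m => (m%:R * (p - p^-1)) *: h m.
Hypothesis psiM : fps_euler (psi : fps A) = (psi : fps A) * M.
Hypothesis psi0u : psi 0%N * u 0%N = p ^+ 2 *: (u 0%N * psi 0%N).
Hypothesis hu : forall m n, (0 < m)%N ->
  m%:R *: (h m * u n - u n * h m) =
    ((p ^+ (2 * m) - p ^- (2 * m)) / (p - p^-1)) *: u (m + n)%N.

(** With [c(t)] the series of the [conj_coef], this is the coefficient of [t c'(t) = - c(t) sum_i
    (p^(2i) - p^(-2i)) t^i], obtained from the logarithmic derivative of the fraction that defines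
    [c]. *)
Lemma conj_coef_sum j : \sum_(i < j.+1) conj_coef p (j - i) * (p ^+ (2 * i) - p ^- (2 * i)) =
  - (j%:R * conj_coef p j).
Proof.
rewrite (eq_bigr (fun i : 'I_j.+1 => (j - i == 0)%N%:R * p ^+ 2 * (p ^+ (2 * i) - p ^- (2 * i)) -
   ((p ^+ 2 - p ^- 2) * ((p ^+ 2) ^+ i * (p ^- 2) ^+ (j - i)) - (p ^+ 2 - p ^- 2) * p ^- (2 * j))));
  last first.
  move=> i _; rewrite /conj_coef mulrBl; congr (_ - _).
  have -> : p ^- (2 * j) = (p ^- 2) ^+ i * (p ^- 2) ^+ (j - i).
    rewrite -exprD subnKC; last by rewrite -ltnS.
    by rewrite exprM exprVn.
  rewrite !exprM !exprVn -!exprM; ring.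
rewrite sumrB big_ord_recr /= subnn mul1r big1 ?add0r; last first.
  by move=> i _; rewrite subn_eq0 leqNgt ltn_ord !mul0r.
rewrite sumrB -mulr_sumr sumr_const card_ord.
have := subrXX (p ^- 2) (p ^+ 2) j.+1.
rewrite (eq_bigr (fun i : 'I_j.+1 => (p ^+ 2) ^+ i * p ^- 2 ^+ (j - i))); last by move=> i _; rewrite mulrC.
set S := \sum_(i < _) _ => e.
have -> : (p ^+ 2 - p ^- 2) * S = - (p ^- 2 ^+ j.+1 - p ^+ 2 ^+ j.+1) by rewrite e -mulNr opprB.
rewrite /conj_coef -[p ^- (2 * j)]exprVn !exprM exprVn !(exprS _ j).
case: (j) => [|m] /=; rewrite -[_ * _ *+ _]mulr_natr; first by rewrite !expr0; ring.
rewrite -[m.+2%:R]natr1; move: (p ^- 2 ^+ m.+1) (p ^+ 2 ^+ m.+1) (m.+1%:R : F) => a b c.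
ring.
Qed.

(** Both [u 0 * psi] and [psi * cU] satisfy the equation of [euler_unique] with the same [M]: for
    the second, the bracket of [M] with [cU] is minus the derivative of [cU], by [conj_coef_sum]. In
    degree 0 they agree by [psi0u]. *)
Lemma conj_series k : u 0%N * psi k =
  \sum_(i < k.+1) conj_coef p i *: (psi (k - i)%N * u i).
Proof.
pose cU : fps A := fun k => conj_coef p k *: u k.
have MU : M * cU + fps_euler cU = cU * M.
  apply/funext => j; rewrite fpsD !fpsM [RHS](reindex_inj rev_ord_inj) /=.
  apply/eqP; rewrite addrC -subr_eq0 -addrA -sumrB.
  rewrite (eq_bigr (fun i : 'I_j.+1 =>
      (conj_coef p (j - i) * (p ^+ (2 * i) - p ^- (2 * i))) *: u j)); last first.
    move=> i _; have ij : (i <= j)%N by rewrite -ltnS.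
    rewrite subSS subKn // /M /cU -!scalerAl -!scalerAr.
    have -> : forall (a b : F) (v w : A), (a * b) *: (v) - w = (a * b) *: v - w by [].
    case: (posnP i) => [i0|i_gt0].
      by rewrite i0 !mul0r !scale0r scaler0 subrr muln0 expr0 invr1 subrr mulr0 scale0r.
    have e := hu (j - i) i_gt0; rewrite subnKC // in e.
    transitivity ((conj_coef p (j - i) * (p - p^-1)) *: (i%:R *: (h i * u (j - i)%N - u (j - i)%N * h i))).
      by rewrite !(scalerA, scalerBr); congr (_ *: _ - _ *: _); ring.
    by rewrite e scalerA; congr (_ *: _); rewrite -mulrA [(p - p^-1) * _]mulrC divfK.
  by rewrite -scaler_suml conj_coef_sum /cU /fps_euler scalerA scaleNr subrr.
have : fpsC (u 0%N) * (psi : fps A) - (psi : fps A) * cU = 0.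
  apply: (euler_unique char0 (M := M)).
  - rewrite linearB /= !fps_eulerM fps_eulerC mul0r add0r psiM mulrBl -[_ * cU * M]mulrA -MU.
    by rewrite mulrDr !mulrA.
  - have c0 : conj_coef p 0 = p ^- 2.
      by rewrite /conj_coef muln0 expr0 invr1 mulr1 mul1r opprB addrC subrK.
    rewrite fpsD fpsN fpsCMl fpsM big_ord1 /cU c0.
    by rewrite -scalerAr psi0u scalerA mulVf ?scale1r ?subrr // expf_neq0.
  - by rewrite /M mul0r scale0r.
move/subr0_eq => e; rewrite -fpsCMl e fpsM (reindex_inj rev_ord_inj) /=.
by apply: eq_bigr => i _; rewrite subSS subKn -1?ltnS // /cU -scalerAr.
Qed.
End Conjugation.

(** * Half currents of the Drinfeld algebra *)

Definition sgn_int (s : bool) : int := if s then 1 else -1.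

Lemma NegzS1 k : Negz k.+1 + 1 = Negz k.
Proof. lia. Qed.

(** Running through the indices downwards exchanges the two sides of a quadratic relation, which is
    why the negative modes obey it with [q^-1]. *)
Lemma quadratic_flip (F : fieldType) (V : lmodType F) (r : F) (a b c d : V) : r != 0 ->
  a - r *: b = r *: c - d -> c - r^-1 *: d = r^-1 *: a - b.
Proof.
move=> r0 e; apply: (scalerI r0).
by rewrite !scalerBr !scalerA !divff // !scale1r.
Qed.

Section HalfCurrents.
Variables (F : fieldType) (q : F) (A : algType F) (g : dgen -> A).
Hypothesis rel : forall u v, drinfeld_rel q g u v -> u = v.
Hypotheses (q0 : q != 0) (q1 : q - q^-1 != 0).
Hypothesis char0 : forall n, n.+1%:R != 0 :> F.
Variable s : bool.

(* For [s = true] the half currents are [x_k, y_(k+1), h_m, psi_k] with [k >= 0];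
   for [s = false] they are [x_(-1-k), y_(-k), h_(-m), phi_(-k)], which satisfy the
   same relations with [q] replaced by [q^-1]. *)
Definition half_q : F := if s then q else q^-1.
Local Notation p := half_q.
Local Notation eps := (sgn_int s).
Local Notation cp := (chalf_pow g).

Definition half_x (k : nat) : A := g (Dx (if s then Posz k else Negz k)).
Definition half_y (k : nat) : A := g (Dy (if s then Posz k.+1 else - Posz k)).
Definition half_h (m : nat) : A :=
  if m is m'.+1 then
    if s then g (Dh (exist _ (Posz m'.+1) isT)) else g (Dh (exist _ (Negz m') isT))
  else 0.
Definition half_K : A := if s then g DK else g DKi.
Definition half_Kinv : A := if s then g DKi else g DK.
Definition half_Psi : fps A := if s then Psi_series q g else Phi_series q g.
Local Notation x := half_x.
Local Notation y := half_y.
Local Notation h := half_h.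
Local Notation Kh := half_K.
Local Notation Psi := half_Psi.

Lemma half_q_neq0 : p != 0.
Proof. by rewrite /half_q; case: s; rewrite ?invr_eq0. Qed.

Lemma half_qV : p - p^-1 = (if s then 1 else -1) * (q - q^-1).
Proof. by rewrite /half_q; case: s; rewrite ?invrK ?mul1r // mulN1r opprB. Qed.

Lemma half_q_neqV : p - p^-1 != 0.
Proof. by rewrite half_qV; case: s; rewrite ?mul1r // mulN1r oppr_eq0. Qed.

Lemma cp0 : cp 0 = 1. Proof. exact: expr0. Qed.

Lemma cp_central l a : cp l * a = a * cp l.
Proof.
have cc b : g Dc * b = b * g Dc by apply: rel; constructor.
have ci b : g Dci * b = b * g Dci.
  rewrite -[b in LHS]mulr1 -(rel (drel_cci _ _)) !mulrA -[_ * b * g Dc]mulrA -cc mulrA.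
  by rewrite (rel (drel_cic _ _)) mul1r.
by case: l => n /=; apply/commr_sym/commrX => //; apply/commr_sym.
Qed.

Lemma cpD l m : cp (l + m) = cp l * cp m.
Proof.
have cpS k : cp (k + 1) = cp k * g Dc.
  case: k => [k|[|k]].
  - by rewrite -PoszD addn1 /= exprSr.
  - by rewrite /= expr1 (rel (drel_cic _ _)).
  - rewrite NegzS1.
    by rewrite /= [in RHS]exprSr -mulrA (rel (drel_cic _ _)) mulr1.
have cpP k : cp (k - 1) = cp k * g Dci.
  by rewrite -[k in RHS](subrK 1) cpS -mulrA (rel (drel_cci _ _)) mulr1.
elim/int_rect: m => [|m IHm|m IHm].
- by rewrite addr0 cp0 mulr1.
- by rewrite intS [1 + _]addrC addrA !cpS IHm mulrA.
- by rewrite intS opprD [- 1 + _]addrC addrA !cpP IHm mulrA.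
Qed.

Lemma half_KVK : half_Kinv * Kh = 1.
Proof. by rewrite /half_K /half_Kinv; case: s; apply: rel; constructor. Qed.

Lemma half_xx : quadratic p x.
Proof.
move=> k l; rewrite /half_x /half_q; case: s.
  by have := rel (drel_xx q g k l); rewrite -!PoszD !addn1.
have := rel (drel_xx q g (Negz k.+1) (Negz l.+1)).
rewrite !NegzS1.
by move/(quadratic_flip (expf_neq0 2 q0)); rewrite exprVn.
Qed.

Lemma half_yy : quadratic p^-1 y.
Proof.
move=> k l; rewrite /half_y /half_q; case: s.
  by have := rel (drel_yy q g k.+1 l.+1); rewrite -!PoszD !addn1 exprVn.
have := rel (drel_yy q g (- Posz k.+1) (- Posz l.+1)).
have NS (n : nat) : - Posz n.+1 + 1 = - Posz n by lia.
rewrite !NS => /(quadratic_flip (invr_neq0 (expf_neq0 2 q0))).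
by rewrite !invrK.
Qed.

Definition half_qint (m : nat) : F := (p ^+ (2 * m) - p ^- (2 * m)) / (p - p^-1).

Lemma half_qintE m :
  qint q (2 * (if s then Posz m.+1 else Negz m)) / (if s then Posz m.+1 else Negz m)%:~R =
  half_qint m.+1 / m.+1%:R.
Proof.
rewrite /qint /half_qint half_qV /half_q; case: s; first by rewrite mul1r.
have -> : 2 * Negz m = - Posz (2 * m.+1) by lia.
rewrite opprK NegzE intrN invrN mulrN -!mulNr; congr (_ / _).
by rewrite -!exprVn invrK !mulN1r invrN mulrN mulNr -exprnN exprVn.
Qed.

Lemma half_hx m n : (0 < m)%N ->
  h m * x n - x n * h m = (half_qint m / m%:R) *: (cp (- Posz m) * x (m + n)).
Proof.
case: m => // m _; rewrite -half_qintE /half_h /half_x; case: s.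
  by rewrite (rel (drel_hx q g (exist _ (Posz m.+1) isT) n)).
rewrite (rel (drel_hx q g (exist _ (Negz m) isT) (Negz n))) /=.
by rewrite (_ : Negz m + Negz n = Negz (m.+1 + n)) //; lia.
Qed.

Lemma half_hy m n : (0 < m)%N ->
  h m * y n - y n * h m = - ((half_qint m / m%:R) *: (cp (Posz m) * y (m + n))).
Proof.
case: m => // m _; rewrite -half_qintE -scaleNr /half_h /half_y; case: s.
  rewrite (rel (drel_hy q g (exist _ (Posz m.+1) isT) n.+1)) /=.
  by rewrite (_ : Posz m.+1 + Posz n.+1 = Posz (m.+1 + n).+1) //; lia.
rewrite (rel (drel_hy q g (exist _ (Negz m) isT) (- Posz n))) /=.
by rewrite (_ : Negz m + - Posz n = - Posz (m.+1 + n)) //; lia.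
Qed.

Lemma half_hh m n : h m * h n = h n * h m.
Proof.
case: m => [|m]; first by rewrite mul0r mulr0.
case: n => [|n]; first by rewrite mul0r mulr0.
rewrite /half_h; case: s; apply: subr0_eq.
  by rewrite (rel (drel_hh q g (exist _ (Posz m.+1) isT) (exist _ (Posz n.+1) isT))).
by rewrite (rel (drel_hh q g (exist _ (Negz m) isT) (exist _ (Negz n) isT))).
Qed.

Lemma half_hK m : Kh * h m = h m * Kh.
Proof.
case: m => [|m]; first by rewrite mul0r mulr0.
have Kc i : g DK * g (Dh i) = g (Dh i) * g DK by apply: rel; constructor.
have Kic i : g DKi * g (Dh i) = g (Dh i) * g DKi.
  rewrite -[g (Dh i) in LHS]mulr1 -(rel (drel_KKi q g)) [g (Dh i) * (_ * _)]mulrA -Kc.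
  by rewrite !mulrA (rel (drel_KiK q g)) mul1r.
by rewrite /half_K /half_h; case: s.
Qed.

Lemma conj_K (a : A) (r : F) : r != 0 -> g DK * a * g DKi = r *: a ->
  g DK * a = r *: (a * g DK) /\ g DKi * a = r^-1 *: (a * g DKi).
Proof.
move=> r0 e.
have e1 : g DK * a = r *: (a * g DK).
  by rewrite scalerAl -e -!mulrA (rel (drel_KiK q g)) mulr1.
split=> //; apply: (scalerI r0); rewrite scalerA divff // scale1r.
rewrite -[in LHS](mulr1 a) -(rel (drel_KKi q g)) (mulrA a) scalerAr scalerAl -e1.
by rewrite !mulrA (rel (drel_KiK q g)) mul1r.
Qed.

Lemma half_Kx k : Kh * x k = p ^+ 2 *: (x k * Kh).
Proof.
have [e1 e2] := conj_K (expf_neq0 2 q0) (rel (drel_Kx q g (if s then Posz k else Negz k))).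
by rewrite /half_K /half_x /half_q; move: e1 e2; case: s => // _; rewrite exprVn.
Qed.

Lemma half_Ky k : Kh * y k = p ^- 2 *: (y k * Kh).
Proof.
have [e1 e2] := conj_K (invr_neq0 (expf_neq0 2 q0))
  (rel (drel_Ky q g (if s then Posz k.+1 else - Posz k))).
by rewrite /half_K /half_y /half_q; move: e1 e2; case: s => // _; rewrite exprVn.
Qed.

Lemma half_PsiE : Psi = fpsC Kh * fps_exp ((p - p^-1) *: (h : fps A)).
Proof.
apply/funext => k; rewrite fpsCMl /half_Psi half_qV /half_K /half_h; case: s.
  by rewrite mul1r.
by rewrite mulN1r.
Qed.

Let M : fps A := fun m => (m%:R * (p - p^-1)) *: h m.

Lemma half_Psi_euler : fps_euler Psi = Psi * M.
Proof.
have h0 : ((p - p^-1) *: (h : fps A)) 0%N = 0 by rewrite fpsZ scaler0.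
have ME : fps_euler ((p - p^-1) *: (h : fps A)) = M.
  by apply/funext => m; rewrite /fps_euler fpsZ scalerA.
have Mh : M * ((p - p^-1) *: (h : fps A)) = ((p - p^-1) *: (h : fps A)) * M.
  apply: fps_comm => i j; rewrite fpsZ /M -!scalerAr -!scalerAl half_hh.
  by rewrite !scalerA mulrC.
rewrite half_PsiE fps_eulerM fps_eulerC mul0r add0r fps_euler_exp // ME //.
by rewrite (fps_exp_comm h0 Mh) mulrA.
Qed.

Lemma half_Psi_comm m k : h m * Psi k = Psi k * h m.
Proof.
have e : fpsC (h m) * Psi = Psi * fpsC (h m).
  rewrite half_PsiE mulrA -fpsCM -half_hK fpsCM -!mulrA; congr (_ * _).
  apply: fps_exp_comm; first by rewrite fpsZ scaler0.
  apply: fps_comm => i j; rewrite /fpsC fpsZ; case: eqP => _; rewrite ?mul0r ?mulr0 //.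
  by rewrite -scalerAr -scalerAl half_hh.
by rewrite -fpsCMl e fpsCMr.
Qed.

Lemma half_Psi0 : Psi 0%N = Kh.
Proof. by rewrite half_PsiE fpsCMl /fps_exp big_ord1 expr0 fps1 invr1 scale1r mulr1. Qed.

Lemma half_Psi1 : Psi 1%N = (p - p^-1) *: (Kh * h 1%N).
Proof.
have := congr1 (fun f : fps A => f 1%N) half_Psi_euler.
rewrite fpsM !big_ord_recl big_ord0 /fps_euler /= /M half_Psi0 !mul1r mul0r !scale0r mulr0 !addr0 scale1r.
by rewrite -scalerAr.
Qed.

(** The two modes add up to a positive integer for [s = true] and to a negative one for [s = false],
    so just one of [psi], [phi] survives; the sign of [phi] is absorbed by [p - p^-1]. *)
Lemma half_xy k l : x k * y l - y l * x k =
  (p - p^-1)^-1 *: (cp (Posz k - Posz l - eps) * Psi (k + l).+1).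
Proof.
have D (m n : int) := rel (drel_xy q g m n).
rewrite half_qV /half_x /half_y /half_Psi; case: s.
  rewrite D /= -PoszD addnS /phi_of /= mulr0 subr0 mul1r.
  by rewrite (_ : Posz k - Posz l.+1 = Posz k - Posz l - 1) //; lia.
rewrite D /= (_ : Negz k + - Posz l = Negz (k + l)) /=; last by lia.
rewrite mulr0 sub0r mulN1r invrN scaleNr scalerN; congr (- (_ *: (_ * _))).
by congr cp; lia.
Qed.

(* The relations of both halves now have one form, indexed by natural numbers and depending on [s]
   through [p] and [eps]. *)
End HalfCurrents.

Lemma quadratic_rev (F : fieldType) (T : algType F) (p : F) (f : nat -> T) :
  p != 0 -> quadratic p f -> quadratic p^-1 (f : nat -> rev_alg T).
Proof.
move=> p0 ff k l.
have := quadratic_flip (expf_neq0 2 p0) (ff k l).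
move/(congr1 -%R); rewrite !opprB exprVn.
by move=> e; symmetry.
Qed.

Section ScaledCurrents.
Variables (F : fieldType) (q : F) (A : algType F) (g : dgen -> A).
Hypothesis rel : forall u v, drinfeld_rel q g u v -> u = v.
Hypotheses (q0 : q != 0) (q1 : q - q^-1 != 0) (q2 : q + q^-1 != 0).
Hypothesis char0 : forall n, n.+1%:R != 0 :> F.
Variable s : bool.

Local Notation p := (half_q q s).
Local Notation eps := (sgn_int s).
Local Notation cp := (chalf_pow g).
Local Notation x := (half_x g s).
Local Notation y := (half_y g s).
Local Notation h := (half_h g s).
Local Notation K := (half_K g s).
Local Notation Psi := (half_Psi q g s).

(* [d] is 1 in the first tensor factor and -1 in the second. *)
Variables (d b b' : int).

(** The slopes of the exponents absorb the power of [c] in [[h_1, x_k]] and [[h_1, y_k]], and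
    [cur_h] is divided by [[2]], so that its bracket shifts the index with coefficient 1 or -1. The
    offsets must satisfy [b + b' = d - eps] for the bracket of [x] and [y] to be free of [c]. *)
Definition cur_x (k : nat) : A := cp ((d - 1 - 2 * eps) * k + b) * x k.
Definition cur_y (k : nat) : A := cp ((d + 1 - 2 * eps) * k + b') * y k.
Definition cur_Psi (k : nat) : A := cp ((d - 2 * eps) * k) * Psi k.
Definition cur_h : A := (half_qint q s 1)^-1 *: (cp (d - 2 * eps) * h 1%N).

Let cpC l a := cp_central rel l a.
Let cpD' l m := cpD rel l m.

Lemma cp_mul l m a a' : (cp l * a) * (cp m * a') = cp (l + m) * (a * a').
Proof. by rewrite cpD' -!mulrA [a * _]mulrA -cpC !mulrA. Qed.

Lemma cp_comm l m a a' : (cp l * a) * (cp m * a') - (cp m * a') * (cp l * a) =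
  cp (l + m) * (a * a' - a' * a).
Proof. by rewrite !cp_mul [m + l]addrC -mulrBr. Qed.

Lemma cp_quadratic r (l : nat -> int) (f : nat -> A) :
  (forall k m, l k.+1 + l m = l k + l m.+1) ->
  quadratic r f -> quadratic r (fun k => cp (l k) * f k).
Proof.
move=> lE ff k m; rewrite !cp_mul ![_ + l k.+1]addrC ![l m.+1 + _]addrC !lE.
by rewrite ![r ^+ 2 *: (cp _ * _)]scalerAr -!mulrBr ff.
Qed.

Lemma half_qint1 : half_qint q s 1 != 0.
Proof.
rewrite /half_qint muln1.
have -> : (p ^+ 2 - p ^- 2) / (p - p^-1) = p + p^-1.
  apply: (mulIf (half_q_neqV q1 s)); rewrite divfK ?half_q_neqV //.
  by rewrite mulrC -subr_sqr exprVn.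
by rewrite /half_q; case: s => //; rewrite invrK addrC.
Qed.

Lemma cur_xx : quadratic p cur_x.
Proof. by apply: cp_quadratic; [lia | exact: half_xx]. Qed.

Lemma cur_yy : quadratic p^-1 cur_y.
Proof. by apply: cp_quadratic; [lia | exact: half_yy]. Qed.

Lemma cur_hx k : cur_h * cur_x k - cur_x k * cur_h = cur_x k.+1.
Proof.
rewrite /cur_h /cur_x -scalerAl -scalerAr -scalerBr cp_comm (half_hx rel) //.
rewrite mulr1n divr1 -scalerAr scalerA mulVf ?half_qint1 // scale1r mulrA -cpD'.
by congr (cp _ * _); lia.
Qed.

Lemma cur_hy k : cur_h * cur_y k - cur_y k * cur_h = - cur_y k.+1.
Proof.
rewrite /cur_h /cur_y -scalerAl -scalerAr -scalerBr cp_comm (half_hy rel) //.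
rewrite mulr1n divr1 mulrN -scalerAr scalerN scalerA mulVf ?half_qint1 // scale1r mulrA -cpD'.
by congr (- (cp _ * _)); lia.
Qed.

Lemma cur_hPsi k : cur_h * cur_Psi k = cur_Psi k * cur_h.
Proof.
apply: subr0_eq.
by rewrite /cur_h /cur_Psi -scalerAl -scalerAr -scalerBr cp_comm (half_Psi_comm rel) // subrr mulr0 scaler0.
Qed.

Lemma cur_xy k l : b + b' = d - eps ->
  cur_x k * cur_y l - cur_y l * cur_x k = (p - p^-1)^-1 *: cur_Psi (k + l).+1.
Proof.
move=> bb; rewrite /cur_x /cur_y cp_comm (half_xy rel) // -scalerAr mulrA -cpD'.
by congr (_ *: (cp _ * _)); lia.
Qed.

Lemma cur_Psi0 : cur_Psi 0 = K.
Proof. by rewrite /cur_Psi mulr0 cp0 mul1r half_Psi0. Qed.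

Lemma cur_Psi_x k : cur_Psi 0 * cur_x k = p ^+ 2 *: (cur_x k * cur_Psi 0).
Proof. by rewrite cur_Psi0 /cur_x mulrA -cpC -mulrA (half_Kx rel) // -scalerAr mulrA. Qed.

Lemma cur_Psi_y k : cur_Psi 0 * cur_y k = p ^- 2 *: (cur_y k * cur_Psi 0).
Proof. by rewrite cur_Psi0 /cur_y mulrA -cpC -mulrA (half_Ky rel) // -scalerAr mulrA. Qed.

Let hc (m : nat) : A := cp ((d - 2 * eps) * m) * h m.

Lemma cur_Psi_euler (M := (fun m => (m%:R * (p - p^-1)) *: hc m) : fps A) :
  fps_euler (cur_Psi : fps A) = (cur_Psi : fps A) * M.
Proof.
apply/funext => n.
rewrite /fps_euler /cur_Psi scalerAr -[n%:R *: Psi n]/(fps_euler Psi n) (half_Psi_euler rel) //.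
rewrite !fpsM mulr_sumr; apply: eq_bigr => i _.
rewrite /M /hc -!scalerAr cp_mul; congr (_ *: (cp _ * _)).
by rewrite -mulrDr -PoszD subnKC // -ltnS.
Qed.

Lemma cur_x_Psi k : cur_x 0%N * cur_Psi k =
  \sum_(i < k.+1) conj_coef p i *: (cur_Psi (k - i)%N * cur_x i).
Proof.
have p0 := half_q_neq0 q0 s; have p1 := half_q_neqV q1 s.
apply: (conj_series char0 p0 p1 cur_Psi_euler (cur_Psi_x 0)) => m n m0.
rewrite /hc /cur_x cp_comm (half_hx rel) // -scalerAr scalerA mulrC divfK; last by case: m m0.
rewrite mulrA -cpD'; congr (_ *: (cp _ * _)); lia.
Qed.

(** In the opposite algebra the sign of [[h_m, y_n]] and the factor [p^-2] of [K y = p^-2 y K]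
    become those of the [x]'s, so [conj_series] applies there. *)
Lemma cur_Psi_y_conj k : cur_Psi k * cur_y 0%N =
  \sum_(i < k.+1) conj_coef p i *: (cur_y i * cur_Psi (k - i)%N).
Proof.
have p0 := half_q_neq0 q0 s; have p1 := half_q_neqV q1 s.
have euler : fps_euler (cur_Psi : fps (rev_alg A)) =
    (cur_Psi : fps (rev_alg A)) * ((fun m => (m%:R * (p - p^-1)) *: hc m) : fps (rev_alg A)).
  rewrite fps_revM -[LHS]/(fps_euler (cur_Psi : fps A)) cur_Psi_euler.
  apply: (@fps_comm F A) => i j; rewrite /cur_Psi /hc -scalerAr -scalerAl; congr (_ *: _).
  by rewrite !cp_mul (half_Psi_comm rel) // addrC.
have Py : (cur_Psi 0%N : rev_alg A) * (cur_y 0%N : rev_alg A) =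
    p ^+ 2 *: ((cur_y 0%N : rev_alg A) * (cur_Psi 0%N : rev_alg A)).
  rewrite -[LHS]/(cur_y 0 * cur_Psi 0) -[X in _ *: X]/(cur_Psi 0 * cur_y 0).
  by rewrite cur_Psi_y scalerA divff ?scale1r // expf_neq0.
apply: (conj_series char0 p0 p1 euler Py) => m n m0.
change (m%:R *: (cur_y n * hc m - hc m * cur_y n) =
  ((p ^+ (2 * m) - p ^- (2 * m)) / (p - p^-1)) *: cur_y (m + n)).
rewrite -opprB /hc /cur_y cp_comm (half_hy rel) // mulrN opprK -scalerAr scalerA.
rewrite mulrC divfK; last by case: m m0.
rewrite mulrA -cpD'; congr (_ *: (cp _ * _)); lia.
Qed.

End ScaledCurrents.

(** * The comultiplication of half currents *)

Section TensorFactors.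
Variables (F : fieldType) (A B : algType F).
Local Notation T := (tensor A B).

Definition tens_l (a : A) : T := a ⊗ 1.
Definition tens_r (b : B) : T := 1 ⊗ b.

Lemma tens_l_linear : linear tens_l. Proof. exact: (tens_bilin A B).1. Qed.
Lemma tens_r_linear : linear tens_r. Proof. exact: (tens_bilin A B).2. Qed.
HB.instance Definition _ := GRing.isLinear.Build F A T _ tens_l tens_l_linear.
HB.instance Definition _ := GRing.isLinear.Build F B T _ tens_r tens_r_linear.

Lemma tens_l_monoid : monoid_morphism tens_l.
Proof. by split=> // a a'; rewrite /tens_l tensM mulr1. Qed.
Lemma tens_r_monoid : monoid_morphism tens_r.
Proof. by split=> // a a'; rewrite /tens_r tensM mulr1. Qed.
HB.instance Definition _ := GRing.isMonoidMorphism.Build A T tens_l tens_l_monoid.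
HB.instance Definition _ := GRing.isMonoidMorphism.Build B T tens_r tens_r_monoid.

Lemma tens_lr a b : tens_l a * tens_r b = a ⊗ b.
Proof. by rewrite tensM mulr1 mul1r. Qed.

Lemma tens_rl a b : tens_r b * tens_l a = a ⊗ b.
Proof. by rewrite tensM mulr1 mul1r. Qed.

Lemma tens_lrC a b : tens_l a * tens_r b = tens_r b * tens_l a.
Proof. by rewrite tens_lr tens_rl. Qed.

Lemma tensDl a a' b : (a + a') ⊗ b = a ⊗ b + a' ⊗ b :> T.
Proof. by rewrite -!tens_lr linearD mulrDl. Qed.

Lemma tensDr a b b' : a ⊗ (b + b') = a ⊗ b + a ⊗ b' :> T.
Proof. by rewrite -!tens_lr linearD mulrDr. Qed.

Lemma tensZl k a b : (k *: a) ⊗ b = k *: (a ⊗ b) :> T.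
Proof. by rewrite -!tens_lr linearZ -scalerAl. Qed.

Lemma tensZr k a b : a ⊗ (k *: b) = k *: (a ⊗ b) :> T.
Proof. by rewrite -!tens_lr linearZ -scalerAr. Qed.

Lemma tensNl a b : (- a) ⊗ b = - (a ⊗ b) :> T.
Proof. by rewrite -!tens_lr linearN mulNr. Qed.

Lemma tensNr a b : a ⊗ (- b) = - (a ⊗ b) :> T.
Proof. by rewrite -!tens_lr linearN mulrN. Qed.

End TensorFactors.

Lemma quadratic_morph (F : fieldType) (A B : algType F) (phi : {lrmorphism A -> B}) p
  (f : nat -> A) : quadratic p f -> quadratic p (fun k => phi (f k)).
Proof.
move=> ff k l; rewrite -!rmorphM.
by rewrite -!linearZ -!linearB ff.
Qed.

Section TensorCurrents.
Variables (F : fieldType) (q : F) (A : algType F) (g : dgen -> A).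
Hypothesis rel : forall u v, drinfeld_rel q g u v -> u = v.
Hypotheses (q0 : q != 0) (q1 : q - q^-1 != 0) (q2 : q + q^-1 != 0).
Hypothesis char0 : forall n, n.+1%:R != 0 :> F.
Variable s : bool.

Local Notation T := (tensor A A).
Local Notation p := (half_q q s).
Local Notation eps := (sgn_int s).
Local Notation cp := (chalf_pow g).
Local Notation x := (half_x g s).
Local Notation y := (half_y g s).
Local Notation h := (half_h g s).
Local Notation K := (half_K g s).
Local Notation Kinv := (half_Kinv g s).
Local Notation Psi := (half_Psi q g s).
Local Notation tl := (@tens_l F A A).
Local Notation tr := (@tens_r F A A).

(** The offsets [1 - eps] here and [-1 - eps] in [second_y] cancel the powers of [c] in
    [Delta (x_0)] and [Delta (y_0)]; in each factor the two offsets add up to [d - eps]. *)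
Definition first_x k : T := tl (cur_x g s 1 (1 - eps) k).
Definition first_y k : T := tl (cur_y g s 1 0 k).
Definition first_Psi k : T := tl (cur_Psi q g s 1 k).
Definition first_h : T := tl (cur_h q g s 1).
Definition second_x k : T := tr (cur_x g s (-1) 0 k).
Definition second_y k : T := tr (cur_y g s (-1) (-1 - eps) k).
Definition second_Psi k : T := tr (cur_Psi q g s (-1) k).
Definition second_h : T := tr (cur_h q g s (-1)).

Let p0 := half_q_neq0 q0 s.
Let p1 := half_q_neqV q1 s.

Lemma tensor_system :
  current_system p first_x second_y second_x second_Psi first_h second_h.
Proof.
split.
- exact/quadratic_morph/cur_xx.
- exact/quadratic_morph/cur_yy.
- by move=> k; rewrite -!rmorphM -rmorphB (cur_hx rel).
- by move=> k; rewrite -!rmorphM -rmorphB (cur_hy rel) // rmorphN.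
- by move=> k; rewrite -!rmorphM -rmorphB (cur_hx rel).
- by move=> k; rewrite -!rmorphM (cur_hPsi rel).
- move=> k; rewrite -!rmorphM -rmorphB (cur_xy rel) //; last by lia.
  by rewrite /= linearZ addn0.
- move=> k; rewrite -!rmorphM (cur_Psi_y_conj rel) //= linear_sum; apply: eq_bigr => i _.
  by rewrite linearZ /= rmorphM.
- move=> u v uP vP.
  have [a ->] : exists a, u = tl a by case: uP => [->|[k ->]]; eexists; reflexivity.
  have [b ->] : exists b, v = tr b by case: vP => [->|[k [] ->]]; eexists; reflexivity.
  exact: tens_lrC.
Qed.

(** Reversing products inverts the parameter of [quadratic] and the sign of brackets. Thus the [y]'s
    of the second factor take the place of the [x]'s of the first, and conversely, with the same
    [p]. *)
Lemma tensor_system_rev :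
  @current_system F (rev_alg T) p second_y first_x first_y first_Psi second_h first_h.
Proof.
split.
- have yy : quadratic p^-1 second_y by apply: quadratic_morph; exact: cur_yy.
  by have := quadratic_rev (invr_neq0 p0) yy; rewrite invrK.
- by apply: quadratic_rev p0 _; apply: quadratic_morph; exact: cur_xx.
- move=> k; change (second_y k * second_h - second_h * second_y k = second_y k.+1).
  by rewrite -opprB -!rmorphM -rmorphB (cur_hy rel) // rmorphN opprK.
- move=> k; change (first_x k * first_h - first_h * first_x k = - first_x k.+1).
  by rewrite -opprB -!rmorphM -rmorphB (cur_hx rel).
- move=> k; change (first_y k * first_h - first_h * first_y k = first_y k.+1).
  by rewrite -opprB -!rmorphM -rmorphB (cur_hy rel) // rmorphN opprK.
- by move=> k; change (first_Psi k * first_h = first_h * first_Psi k); rewrite -!rmorphM (cur_hPsi rel).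
- move=> k; change (first_x 0 * first_y k - first_y k * first_x 0 = (p - p^-1)^-1 *: first_Psi k.+1).
  rewrite -!rmorphM -rmorphB (cur_xy rel) //; last by lia.
  by rewrite /= linearZ add0n.
- move=> k; change (first_x 0 * first_Psi k =
    \sum_(i < k.+1) conj_coef p i *: (first_Psi (k - i) * first_x i)).
  rewrite -!rmorphM (cur_x_Psi rel) //= linear_sum; apply: eq_bigr => i _.
  by rewrite linearZ /= rmorphM.
- move=> u v uP vP.
  have [a ->] : exists a, u = tr a by case: uP => [->|[k ->]]; eexists; reflexivity.
  have [b ->] : exists b, v = tl b by case: vP => [->|[k [] ->]]; eexists; reflexivity.
  exact: (tens_lrC b a).
Qed.

Section Coproduct.
Variable D : {lrmorphism A -> T}.
Hypothesis D_cp : forall l, D (cp l) = cp l ⊗ cp l.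
Hypotheses (D_K : D K = K ⊗ K) (D_Kinv : D Kinv = Kinv ⊗ Kinv).
(** One formula for [Delta (x_0) = x_0 ⊗ K + 1 ⊗ x_0] and [Delta (x_{-1}) = x_{-1} ⊗ K^-1 + c^-1 ⊗
    x_{-1}], according to [s]. *)
Hypothesis D_x : D (x 0%N) = x 0%N ⊗ K + cp (eps - 1) ⊗ x 0%N.
Hypothesis D_y : D (y 0%N) = y 0%N ⊗ cp (eps + 1) + K ⊗ y 0%N.

Let D_mul u v : D (u * v) = D u * D v. Proof. exact: rmorphM. Qed.
Let D_sub u v : D (u - v) = D u - D v. Proof. exact: rmorphB. Qed.
Let D_opp u : D (- u) = - D u. Proof. exact: rmorphN. Qed.
Let D_scale k u : D (k *: u) = k *: D u. Proof. exact: linearZ. Qed.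

Definition cpp (l m : int) : T := cp l ⊗ cp m.

Lemma cppM l m l' m' : cpp l m * cpp l' m' = cpp (l + l') (m + m').
Proof. by rewrite tensM -!(cpD rel). Qed.

Lemma cpp_central l m t : cpp l m * t = t * cpp l m.
Proof.
have [r ->] := tens_span t; rewrite mulr_sumr mulr_suml; apply: eq_bigr => i _.
by rewrite !tensM !(cp_central rel).
Qed.

Lemma cpp0 : cpp 0 0 = 1. Proof. by []. Qed.

Lemma half_h1E : h 1%N = Kinv * (cp eps * (x 0%N * y 0%N - y 0%N * x 0%N)).
Proof.
rewrite (half_xy rel) // half_Psi1 // -!scalerAr scalerA mulVf // scale1r.
rewrite [cp eps * (_ * _)]mulrA -(cpD rel) (_ : eps + (Posz 0 - Posz 0 - eps) = 0); last by lia.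
by rewrite cp0 mul1r mulrA (half_KVK rel) mul1r.
Qed.

(** The factors [x_0 ⊗ K] and [K ⊗ y_0] commute up to [p^4], one [p^2] from each tensor factor; this
    is the source of the mixed term. The other mixed products cancel because [c] is central. *)
Lemma D_comm_xy : D (x 0%N * y 0%N - y 0%N * x 0%N) =
  (x 0%N * y 0%N - y 0%N * x 0%N) ⊗ (K * cp (eps + 1))
  + (1 - p ^+ 4) *: ((x 0%N * K) ⊗ (K * y 0%N))
  + (K * cp (eps - 1)) ⊗ (x 0%N * y 0%N - y 0%N * x 0%N).
Proof.
rewrite D_sub !D_mul D_x D_y !mulrDl !mulrDr !tensM.
rewrite ![cp _ * _](cp_central rel) (half_Kx rel) //.
have -> : y 0%N * K = p ^+ 2 *: (K * y 0%N).
  by rewrite (half_Ky rel) // scalerA divff ?scale1r // expf_neq0.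
rewrite tensZl tensZr scalerA -exprD tensDl tensDr tensNl tensNr.
move: (_ ⊗ _) (_ ⊗ _) (_ ⊗ _) (_ ⊗ _) (_ ⊗ _) (_ ⊗ _) => t1 t2 t3 t4 t5 t6.
by nc_expand F (tensor A A); ring.
Qed.

Lemma D_h1 : D (h 1%N) = h 1%N ⊗ cp (2 * eps + 1) + cp (2 * eps - 1) ⊗ h 1%N
  - (p ^+ 2 - p ^- 2) *: ((cp eps * x 0%N) ⊗ (cp eps * y 0%N)).
Proof.
rewrite {1}half_h1E !D_mul D_Kinv D_cp D_comm_xy !mulrDr -!scalerAr !tensM.
have Kc l : Kinv * (cp eps * (K * cp l)) = cp (eps + l).
  by rewrite mulrA -(cp_central rel) -mulrA (mulrA Kinv) (half_KVK rel) mul1r -(cpD rel).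
have Kx0 : Kinv * (cp eps * (x 0%N * K)) = p ^- 2 *: (cp eps * x 0%N).
  have -> : x 0%N * K = p ^- 2 *: (K * x 0%N).
    by rewrite (half_Kx rel) // scalerA mulVf ?scale1r // expf_neq0.
  rewrite -!scalerAr; congr (_ *: _).
  by rewrite mulrA -(cp_central rel) -mulrA (mulrA Kinv) (half_KVK rel) mul1r.
have Ky0 : Kinv * (cp eps * (K * y 0%N)) = cp eps * y 0%N.
  by rewrite mulrA -(cp_central rel) -mulrA (mulrA Kinv) (half_KVK rel) mul1r.
rewrite Kx0 Ky0 !Kc -half_h1E tensZl.
rewrite (_ : eps + (eps + 1) = 2 * eps + 1); last by lia.
rewrite (_ : eps + (eps - 1) = 2 * eps - 1); last by lia.
move: (_ ⊗ _) (_ ⊗ _) (_ ⊗ _) => t1 t2 t3.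
by nc_expand F (tensor A A); field.
Qed.

Definition total_h : T :=
  first_h + second_h - (p - p^-1) *: (first_x 0%N * second_y 0%N).

(** Dividing by [[2] = p + p^-1] turns the coefficient [p^2 - p^-2] of [D_h1] into [p - p^-1], and
    the power of [c] makes the first two terms those of [cur_h]. *)
Lemma total_hE :
  total_h = (half_qint q s 1)^-1 *: (D (h 1%N) * cpp (1 - 2 * eps) (-1 - 2 * eps)).
Proof.
have e1 : (h 1%N ⊗ cp (2 * eps + 1)) * cpp (1 - 2 * eps) (-1 - 2 * eps) =
    (cp (1 - 2 * eps) * h 1%N) ⊗ 1.
  rewrite tensM -(cp_central rel) -(cpD rel) (_ : 2 * eps + 1 + _ = 0) ?cp0 //; lia.
have e2 : (cp (2 * eps - 1) ⊗ h 1%N) * cpp (1 - 2 * eps) (-1 - 2 * eps) =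
    1 ⊗ (cp (-1 - 2 * eps) * h 1%N).
  rewrite tensM -[h 1%N * _](cp_central rel) -(cpD rel) (_ : 2 * eps - 1 + _ = 0) ?cp0 //; lia.
have e3 : ((cp eps * x 0%N) ⊗ (cp eps * y 0%N)) * cpp (1 - 2 * eps) (-1 - 2 * eps) =
    first_x 0%N * second_y 0%N.
  rewrite tens_lr tensM -!(cp_central rel) !mulrA -!(cpD rel).
  by rewrite /cur_x /cur_y; congr ((cp _ * _) ⊗ (cp _ * _)); lia.
rewrite D_h1 mulrBl mulrDl -scalerAl e1 e2 e3 scalerBr scalerDr -tensZl -tensZr scalerA.
congr (_ - _ *: _).
have c0 : half_qint q s 1 != 0 by apply: half_qint1.
move: c0; rewrite /half_qint muln1 => c0.
by rewrite invf_div divfK //; apply: contraNneq c0 => ->; rewrite mul0r.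
Qed.

(** The exponents are those of [first_x] and [second_x], left unsimplified to match [cur_x] with
    [d = 1] and [d = -1]; similarly for [Delta_y] and [Delta_Psi]. *)
Definition Delta_x k : T :=
  D (x k) * cpp ((1 - 1 - 2 * eps) * k + (1 - eps)) ((-1 - 1 - 2 * eps) * k + 0).
Definition Delta_y k : T :=
  D (y k) * cpp ((1 + 1 - 2 * eps) * k + 0) ((-1 + 1 - 2 * eps) * k + (-1 - eps)).
Definition Delta_Psi k : T :=
  D (Psi k) * cpp ((1 - 2 * eps) * k) ((-1 - 2 * eps) * k).

Lemma cpp_comm u v l m l' m' :
  (D u * cpp l m) * (D v * cpp l' m') - (D v * cpp l' m') * (D u * cpp l m) =
  D (u * v - v * u) * cpp (l + l') (m + m').
Proof.
rewrite -!mulrA ![cpp _ _ * (_ * _)]mulrA !cpp_central -!mulrA !cppM.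
by rewrite [l' + l]addrC [m' + m]addrC !mulrA -mulrBl D_sub !D_mul.
Qed.

Lemma Delta_x0 : Delta_x 0%N = second_x 0%N + first_x 0%N * second_Psi 0%N.
Proof.
rewrite /Delta_x D_x mulrDl !tensM -![x 0%N * _](cp_central rel) -[K * _](cp_central rel) -(cpD rel).
rewrite addrC; congr (_ + _).
  by rewrite (_ : eps - 1 + _ = 0) ?cp0 //; lia.
rewrite mulr1 mul1r cur_Psi0 /cur_x.
by rewrite (_ : (-1 - 1 - 2 * eps) * Posz 0 + 0 = 0) ?cp0 ?mul1r //; lia.
Qed.

Lemma Delta_y0 : Delta_y 0%N = first_y 0%N + first_Psi 0%N * second_y 0%N.
Proof.
rewrite /Delta_y D_y mulrDl !tensM -![y 0%N * _](cp_central rel) -[K * _](cp_central rel) -(cpD rel).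
congr (_ + _).
  by rewrite (_ : eps + 1 + _ = 0) ?cp0 //; lia.
rewrite mulr1 mul1r cur_Psi0 /cur_y.
by rewrite (_ : (1 + 1 - 2 * eps) * Posz 0 + 0 = 0) ?cp0 ?mul1r //; lia.
Qed.

Lemma Delta_x_rec k : total_h * Delta_x k - Delta_x k * total_h = Delta_x k.+1.
Proof.
rewrite total_hE -scalerAl -scalerAr -scalerBr cpp_comm (half_hx rel) //.
rewrite mulr1n divr1 D_scale -scalerAl scalerA mulVf ?half_qint1 // scale1r.
rewrite D_mul D_cp [(cp _ ⊗ cp _) * _]cpp_central -mulrA cppM /Delta_x.
by congr (_ * cpp _ _); lia.
Qed.

Lemma Delta_y_rec k : Delta_y k * total_h - total_h * Delta_y k = Delta_y k.+1.
Proof.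
rewrite -opprB total_hE -scalerAl -scalerAr -scalerBr cpp_comm (half_hy rel) //.
rewrite mulr1n divr1 D_opp D_scale mulNr scalerN opprK -scalerAl scalerA mulVf ?half_qint1 //.
rewrite scale1r D_mul D_cp [(cp _ ⊗ cp _) * _]cpp_central -mulrA cppM /Delta_y.
by congr (_ * cpp _ _); lia.
Qed.

Lemma Delta_Psi0 : Delta_Psi 0%N = first_Psi 0%N * second_Psi 0%N.
Proof.
by rewrite /Delta_Psi half_Psi0 // D_K !mulr0 cpp0 mulr1 tens_lr !cur_Psi0.
Qed.

Lemma Delta_Psi_rec k : Delta_Psi k.+1 =
  (p - p^-1) *: (Delta_x k * Delta_y 0%N - Delta_y 0%N * Delta_x k).
Proof.
rewrite cpp_comm (half_xy rel) // D_scale -scalerAl scalerA divff // scale1r addn0.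
rewrite D_mul D_cp [(cp _ ⊗ cp _) * _]cpp_central -mulrA cppM /Delta_Psi.
by congr (_ * cpp _ _); lia.
Qed.

Let two0 : 2%:R != 0 :> F := char0 1.

Lemma Delta_x_series N :
  fps_small N ((Delta_x : fps T) - tele_sum p (first_x : fps T)
    (fpsT (scaled p second_y)) (second_Psi : fps T) (second_x : fps T) N).
Proof. exact: (current_solution two0 p0 p1 tensor_system Delta_x0 Delta_x_rec). Qed.

Lemma Delta_y_series N :
  fps_small N ((Delta_y : fps (rev_alg T)) - tele_sum p (second_y : fps (rev_alg T))
    (fpsT (scaled p (first_x : nat -> rev_alg T))) (first_Psi : fps (rev_alg T))
    (first_y : fps (rev_alg T)) N).
Proof.
apply: (current_solution two0 p0 p1 tensor_system_rev).
  by rewrite Delta_y0; congr (_ + _); exact: tens_lrC.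
move=> k; rewrite -Delta_y_rec /total_h.
have -> : first_h + second_h = second_h + first_h by rewrite addrC.
by [].
Qed.

Lemma Delta_Psi_series N :
  fps_small N ((Delta_Psi : fps T) - \sum_(n < N) psi_term p
    (fpsT (scaled p second_y)) (second_Psi : fps T) (scaled p first_x) (first_Psi : fps T) n).
Proof.
apply: (psi_solution two0 p0 p1 tensor_system (w0 := first_y 0%N)
  _ _ _ _ _ Delta_x0 Delta_x_rec Delta_Psi0).
- move=> k; rewrite -!rmorphM -rmorphB (cur_xy rel) //; last by lia.
  by rewrite /= linearZ addn0.
- by move=> k; rewrite -!rmorphM (cur_Psi_x rel) //= linearZ /= rmorphM.
- move=> k; rewrite -!rmorphM (cur_x_Psi rel) //= linear_sum; apply: eq_bigr => i _.
  by rewrite linearZ /= rmorphM.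
- by move=> k; rewrite -!rmorphM (cur_hPsi rel).
- move=> u v uP vP.
  have [a ->] : exists a, u = tl a by case: uP => ->; eexists; reflexivity.
  have [b ->] : exists b, v = tr b by case: vP => [k [] ->]; eexists; reflexivity.
  exact: tens_lrC.
- by move=> k; rewrite Delta_Psi_rec Delta_y0.
Qed.

End Coproduct.

End TensorCurrents.

(** * Relations in the quotient algebra and transport of the comultiplication *)

Section FpsMap.
Variables (F : fieldType) (A B : algType F) (phi : {lrmorphism A -> B}).

Definition fps_map (f : fps A) : fps B := fun k => phi (f k).

Lemma fps_mapM f g : fps_map (f * g) = fps_map f * fps_map g.
Proof.
apply/funext => k; rewrite /fps_map !fpsM linear_sum; apply: eq_bigr => i _.
exact: rmorphM.
Qed.

Lemma fps_mapX f n : fps_map (f ^+ n) = fps_map f ^+ n.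
Proof.
elim: n => [|n IHn]; last by rewrite !exprS fps_mapM IHn.
by apply/funext => k; rewrite /fps_map !expr0 !fps1 rmorph_nat.
Qed.

Lemma fps_mapZ a f : fps_map (a *: f) = a *: fps_map f.
Proof. by apply/funext => k; rewrite /fps_map !fpsZ linearZ. Qed.

Lemma fps_map_exp f : fps_map (fps_exp f) = fps_exp (fps_map f).
Proof.
apply/funext => k; rewrite /fps_map /fps_exp linear_sum; apply: eq_bigr => r _.
by rewrite linearZ /= -[phi _]/(fps_map (f ^+ r) k) fps_mapX.
Qed.

Variables (q : F) (g : dgen -> A).

Lemma map_chalf_pow l : phi (chalf_pow g l) = chalf_pow (phi \o g) l.
Proof. by case: l => n /=; rewrite rmorphXn. Qed.

Lemma map_Psi_series k : phi (Psi_series q g k) = Psi_series q (phi \o g) k.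
Proof.
rewrite /Psi_series rmorphM; congr (_ * _).
rewrite -[LHS]/(fps_map (fps_exp _) k) fps_map_exp fps_mapZ; congr (fps_exp (_ *: _) k).
by apply/funext => -[|m] //; exact: rmorph0.
Qed.

Lemma map_Phi_series k : phi (Phi_series q g k) = Phi_series q (phi \o g) k.
Proof.
rewrite /Phi_series rmorphM; congr (_ * _).
rewrite -[LHS]/(fps_map (fps_exp _) k) fps_map_exp fps_mapZ; congr (fps_exp (_ *: _) k).
by apply/funext => -[|m] //; exact: rmorph0.
Qed.

Lemma map_psi_of m : phi (psi_of q g m) = psi_of q (phi \o g) m.
Proof. by case: m => k; rewrite /= ?map_Psi_series ?rmorph0. Qed.

Lemma map_phi_of m : phi (phi_of q g m) = phi_of q (phi \o g) m.
Proof. by rewrite /phi_of; case: (- m) => k; rewrite /= ?map_Phi_series ?rmorph0. Qed.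

(** The relations hold by construction between classes of words of the free algebra; to use them
    over the quotient they are lifted back. Surjectivity serves for centrality of [c^(1/2)], which
    quantifies over all elements. *)
Lemma drinfeld_rel_map u v : (forall b, exists a, phi a = b) ->
  drinfeld_rel q (phi \o g) u v ->
  exists u' v', [/\ drinfeld_rel q g u' v', phi u' = u & phi v' = v].
Proof.
move=> surj; case=> [||||b|m n|m|m|m|m n|m n|m n|m n|m n].
- by do 2 eexists; split; [exact: drel_KKi | rewrite rmorphM | rewrite rmorph1].
- by do 2 eexists; split; [exact: drel_KiK | rewrite rmorphM | rewrite rmorph1].
- by do 2 eexists; split; [exact: drel_cci | rewrite rmorphM | rewrite rmorph1].
- by do 2 eexists; split; [exact: drel_cic | rewrite rmorphM | rewrite rmorph1].
- by have [a <-] := surj b; do 2 eexists; split;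
    [exact: (drel_central _ _ a) | rewrite rmorphM | rewrite rmorphM].
- do 2 eexists; split; [exact: (drel_hh _ _ m n) | by rewrite rmorphB !rmorphM | ].
  by case: eqP => _; rewrite ?rmorph0 // linearZ rmorphB /= !map_chalf_pow.
- by do 2 eexists; split; [exact: (drel_Kh _ _ m) | rewrite rmorphM | rewrite rmorphM].
- by do 2 eexists; split; [exact: (drel_Kx _ _ m) | rewrite !rmorphM | rewrite linearZ].
- by do 2 eexists; split; [exact: (drel_Ky _ _ m) | rewrite !rmorphM | rewrite linearZ].
- do 2 eexists; split; [exact: (drel_hx _ _ m n) | by rewrite rmorphB !rmorphM | ].
  by rewrite linearZ /= rmorphM /= map_chalf_pow.
- do 2 eexists; split; [exact: (drel_hy _ _ m n) | by rewrite rmorphB !rmorphM | ].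
  by rewrite linearZ /= rmorphM /= rmorphXn.
- do 2 eexists; split; [exact: (drel_xx _ _ m n) | | ];
    by rewrite rmorphB /= linearZ /= !rmorphM.
- do 2 eexists; split; [exact: (drel_yy _ _ m n) | | ];
    by rewrite rmorphB /= linearZ /= !rmorphM.
- do 2 eexists; split; [exact: (drel_xy _ _ m n) | by rewrite rmorphB !rmorphM | ].
  by rewrite linearZ /= rmorphB !rmorphM /= !map_chalf_pow map_psi_of map_phi_of.
Qed.

End FpsMap.

Lemma Uhat_rel (F : fieldType) (q : F) (u v : Uhat q) :
  drinfeld_rel q (@dgen_cls F q) u v -> u = v.
Proof.
case/(drinfeld_rel_map (phi := @qcls F _ _ (@drinfeld_proper F q)) (g := fgen F (G := _))) => [b|].
  by exists (qrep b); exact: qrepK.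
by move=> u' [v' [r <- <-]]; exact: qcls_rel r.
Qed.

Section QvarFacts.
Variable R : realType.
Local Notation q := (qvar R).

Lemma Cq_char0 n : n.+1%:R != 0 :> Cq R.
Proof.
rewrite -(rmorph_nat (@tofrac {poly R[i]})) tofrac_eq0 -polyC_natr polyC_eq0.
by rewrite Num.Theory.pnatr_eq0.
Qed.

Lemma qvar_neq0 : q != 0.
Proof. by rewrite tofrac_eq0 polyX_eq0. Qed.

(** The values [c = 1] and [c = -1] give [q - q^-1 != 0] and [q + q^-1 != 0]. *)
Lemma qvar2_neq (c : R[i]) : q ^+ 2 - tofrac c%:P != 0.
Proof.
rewrite /qvar -rmorphXn -rmorphB tofrac_eq0; apply/negP => /eqP /(congr1 (fun r : {poly R[i]} => r`_2)).
by rewrite coefB coefXn coefC coef0 subr0 => /eqP; rewrite oner_eq0.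
Qed.

Lemma qvar_subV : q - q^-1 != 0.
Proof.
have := qvar2_neq 1; rewrite tofrac1; apply: contraNneq => e.
by rewrite -(mulr0 q) -e mulrBr mulfV ?qvar_neq0.
Qed.

Lemma qvar_addV : q + q^-1 != 0.
Proof.
have := qvar2_neq (-1); rewrite polyCN tofracN tofrac1 opprK; apply: contraNneq => e.
by rewrite -(mulr0 q) -e mulrDr mulfV ?qvar_neq0.
Qed.

End QvarFacts.

Section AlgebraMorphism.
Variables (F : fieldType) (A B : algType F) (f : A -> B).
Hypotheses (f_lin : linear f) (f_mon : monoid_morphism f).
(** [Delta] is given as a bare function and is a morphism by surjectivity of the isomorphism; this
    name carries the resulting structure. *)
Definition alg_morphism of linear f & monoid_morphism f : A -> B := f.
HB.instance Definition _ := GRing.isLinear.Build F A B _ (alg_morphism f_lin f_mon) f_lin.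
HB.instance Definition _ := GRing.isMonoidMorphism.Build A B (alg_morphism f_lin f_mon) f_mon.
End AlgebraMorphism.

Section Transport.
Variables (F : fieldType) (q : F) (A B : algType F) (g : dgen -> A) (e : cgen -> B).
Hypothesis rel : forall u v, drinfeld_rel q g u v -> u = v.
Hypothesis kik : forall i, e (CKi i) * e (CK i) = 1.
Local Notation T := (tensor A A).
Local Notation cp := (chalf_pow g).
Variables (DeltaC : {lrmorphism B -> tensor B B}) (iso : {lrmorphism B -> A}).
Variable Delta : A -> T.
Hypothesis iso_surj : forall u, exists v, iso v = u.
Hypothesis DeltaE : forall u, Delta (iso u) = tens_map iso iso (DeltaC u).
Hypothesis DeltaC_ep : forall i,
  DeltaC (e (CE true i)) = e (CE true i) ⊗ e (CK i) + 1 ⊗ e (CE true i).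
Hypothesis DeltaC_em : forall i,
  DeltaC (e (CE false i)) = e (CE false i) ⊗ 1 + e (CKi i) ⊗ e (CE false i).
Hypothesis DeltaC_k : forall i, DeltaC (e (CK i)) = e (CK i) ⊗ e (CK i).
Hypotheses (DeltaC_c : DeltaC (e Cc) = e Cc ⊗ e Cc)
  (DeltaC_ci : DeltaC (e Cci) = e Cci ⊗ e Cci).
Hypotheses (iso_c : iso (e Cc) = cp 1) (iso_ci : iso (e Cci) = cp (-1)).
Hypotheses (iso_k0 : iso (e (CK 0)) = cp 2 * g DKi) (iso_k1 : iso (e (CK 1)) = g DK).
Hypotheses (iso_ep1 : iso (e (CE true 1)) = g (Dx 0)) (iso_em1 : iso (e (CE false 1)) = g (Dy 0)).
Hypotheses (iso_ep0 : iso (e (CE true 0)) = g (Dy 1) * g DKi)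
  (iso_em0 : iso (e (CE false 0)) = g DK * g (Dx (-1))).

Lemma transport_linear : linear Delta.
Proof.
move=> k a b; have [u <-] := iso_surj a; have [v <-] := iso_surj b.
by rewrite -linearP !DeltaE !linearP.
Qed.

Lemma transport_monoid : monoid_morphism Delta.
Proof.
split=> [|a b]; first by rewrite -(rmorph1 iso) DeltaE !rmorph1.
have [u <-] := iso_surj a; have [v <-] := iso_surj b.
by rewrite -rmorphM !DeltaE !rmorphM.
Qed.

Let DM a b : Delta (a * b) = Delta a * Delta b. Proof. exact: transport_monoid.2. Qed.
Let D1 : Delta 1 = 1. Proof. exact: transport_monoid.1. Qed.

Let DeltaE1 u a b : DeltaC u = a ⊗ b -> Delta (iso u) = iso a ⊗ iso b.
Proof. by move=> uE; rewrite DeltaE uE tens_mapE. Qed.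

Let DeltaE2 u a b c d : DeltaC u = a ⊗ b + c ⊗ d ->
  Delta (iso u) = iso a ⊗ iso b + iso c ⊗ iso d.
Proof. by move=> uE; rewrite DeltaE uE linearD /= !tens_mapE. Qed.

Let KKi : g DK * g DKi = 1. Proof. by apply: rel; constructor. Qed.
Let KiK : g DKi * g DK = 1. Proof. by apply: rel; constructor. Qed.

Lemma transport_cp l : Delta (cp l) = cp l ⊗ cp l.
Proof.
have ec : Delta (g Dc) = g Dc ⊗ g Dc by have := DeltaE1 DeltaC_c; rewrite iso_c.
have eci : Delta (g Dci) = g Dci ⊗ g Dci by have := DeltaE1 DeltaC_ci; rewrite iso_ci.
have X a n : Delta a = a ⊗ a -> Delta (a ^+ n) = a ^+ n ⊗ a ^+ n.
  move=> ea; elim: n => [|n IHn]; first by rewrite D1.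
  by rewrite !exprS DM ea IHn tensM.
by case: l => n; apply: X.
Qed.

Let Delta_K : Delta (g DK) = g DK ⊗ g DK.
Proof. by have := DeltaE1 (DeltaC_k 1); rewrite iso_k1. Qed.

(** The comultiplication is prescribed on the [k_i] alone, so the value on [K^-1] comes from
    uniqueness of inverses. *)
Let Delta_Kinv : Delta (g DKi) = g DKi ⊗ g DKi.
Proof.
have KK : (g DK ⊗ g DK) * (g DKi ⊗ g DKi) = 1 :> T by rewrite tensM KKi.
by rewrite -[LHS]mulr1 -KK -Delta_K mulrA -DM KiK D1 mul1r.
Qed.

Let iso_kinv i b : iso (e (CK i)) * b = 1 -> iso (e (CKi i)) = b.
Proof. by move=> kb; rewrite -[LHS]mulr1 -kb mulrA -rmorphM kik rmorph1 mul1r. Qed.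

Variable s : bool.
Local Notation eps := (sgn_int s).
Local Notation x := (half_x g s).
Local Notation y := (half_y g s).
Local Notation K := (half_K g s).
Local Notation Kinv := (half_Kinv g s).

Lemma transport_K : Delta K = K ⊗ K.
Proof. by rewrite /half_K; case: s; [exact: Delta_K | exact: Delta_Kinv]. Qed.

Lemma transport_Kinv : Delta Kinv = Kinv ⊗ Kinv.
Proof. by rewrite /half_Kinv; case: s; [exact: Delta_Kinv | exact: Delta_K]. Qed.

Lemma transport_x : Delta (x 0%N) = x 0%N ⊗ K + cp (eps - 1) ⊗ x 0%N.
Proof.
rewrite /half_x /half_K; case: s.
  by have := DeltaE2 (DeltaC_ep 1); rewrite rmorph1 iso_ep1 iso_k1.
have ik : iso (e (CKi 0)) = cp (-2) * g DK.
  apply: iso_kinv; rewrite iso_k0 -mulrA [g DKi * (_ * _)]mulrA -(cp_central rel).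
  by rewrite -[cp (-2) * _ * _]mulrA KiK mulr1 -(cpD rel).
have xE : g (Dx (Negz 0)) = g DKi * (g DK * g (Dx (-1))) by rewrite mulrA KiK mul1r.
have := DeltaE2 (DeltaC_em 0); rewrite rmorph1 iso_em0 ik => em.
rewrite [in LHS]xE DM em Delta_Kinv mulrDr !tensM -xE mulr1.
by rewrite mulrA -(cp_central rel) -mulrA KiK mulr1.
Qed.

Lemma transport_y : Delta (y 0%N) = y 0%N ⊗ cp (eps + 1) + K ⊗ y 0%N.
Proof.
rewrite /half_y /half_K; case: s; last first.
  have ik : iso (e (CKi 1)) = g DKi by apply: iso_kinv; rewrite iso_k1.
  by have := DeltaE2 (DeltaC_em 1); rewrite rmorph1 iso_em1 ik.
have yE : g (Dy (Posz 1)) = (g (Dy 1) * g DKi) * g DK by rewrite -mulrA KiK mulr1.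
have := DeltaE2 (DeltaC_ep 0); rewrite rmorph1 iso_ep0 iso_k0 => ep.
rewrite [in LHS]yE DM ep Delta_K mulrDl !tensM -yE mul1r -mulrA KiK mulr1.
by [].
Qed.

End Transport.

Lemma Uq_kik (F : fieldType) (q : F) i : k_inv q i * k_gen q i = 1.
Proof.
have := qcls_rel (@chevalley_proper F q) (crel_kik q (fgen F (G := cgen)) i).
by rewrite rmorphM rmorph1.
Qed.

(** * The six identities *)

Section SeriesSums.
Variables (F : fieldType) (T : algType F).

Lemma has_sum_small (u : nat -> fps T) (f Z : fps T) :
  (forall N, fps_small N (f - (Z + \sum_(n < N) u n))) -> fps_has_sum u (f - Z).
Proof.
move=> fu k; exists k.+1 => M kM; have := fu M k kM.
by rewrite opprD addrA fpsD fpsN => /subr0_eq /esym.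
Qed.

Lemma fpsTE (f : fps T) : fpsT f = fpsT 1 * f.
Proof. by rewrite fpsT_mull mul1r. Qed.

Lemma fpsT1_comm (f : fps T) : GRing.comm f (fpsT 1).
Proof. by rewrite /GRing.comm fpsT_mull fpsT_mulr mul1r mulr1. Qed.

Lemma fpsTX (f : fps T) n : fpsT f ^+ n = fpsT 1 ^+ n * f ^+ n.
Proof. by rewrite fpsTE exprMn_comm //; apply/commr_sym/fpsT1_comm. Qed.

(** The [n] powers of the variable in [Y] and the outer one are handed over to the [n.+1] factors
    [X]: for negative modes the series in [x] starts in degree 1 and the series in [y] in degree
    0. *)
Lemma fpsT_balance (X Y P : fps T) n :
  fpsT (X ^+ n.+1 * fpsT Y ^+ n * P) = fpsT X ^+ n.+1 * Y ^+ n * P.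
Proof.
rewrite fpsTE (fpsTX X) (fpsTX Y) !mulrA; congr (_ * _ * _).
rewrite -mulrA (commrX n (fpsT1_comm (X ^+ n.+1))) mulrA -exprS.
by [].
Qed.

Lemma fpsT_exchange (X Y : fps T) n : X ^+ n * fpsT Y ^+ n = fpsT X ^+ n * Y ^+ n.
Proof. by rewrite (fpsTX X) (fpsTX Y) !mulrA (commrX n (fpsT1_comm (X ^+ n))). Qed.

Lemma fpsT_exchange_middle (X Y P S : fps T) n :
  P * X ^+ n * fpsT Y ^+ n * S = P * fpsT X ^+ n * Y ^+ n * S.
Proof. by rewrite -(mulrA P) fpsT_exchange mulrA. Qed.

Lemma fpsT_balance_rev (X Y P : fps T) n :
  fpsT (P * (fpsT Y ^+ n * X ^+ n.+1)) = P * (Y ^+ n * fpsT X ^+ n.+1).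
Proof.
rewrite -fpsT_mulr; congr (_ * _).
rewrite fpsTE (fpsTX X) (fpsTX Y) !mulrA -exprS.
by rewrite (commrX n.+1 (fpsT1_comm (Y ^+ n))).
Qed.

Lemma tele_sum_rev p (X Y P Z : fps T) N :
  tele_sum p (X : fps (rev_alg T)) Y P Z N =
  Z + \sum_(n < N) tele_coef p ^+ n *: (P * (Y ^+ n * X ^+ n.+1)) :> fps T.
Proof.
rewrite /tele_sum -fps_rev_sum; congr (_ + _); apply: eq_bigr => n _.
by rewrite !fps_revM !fps_revX.
Qed.

End SeriesSums.

Lemma scale_middle (F : fieldType) (W : algType F) (c r : F) (P X Y S : W) n :
  c *: (P * X * (r *: Y) ^+ n * S) = (c * r ^+ n) *: (P * X * (Y ^+ n * S)).
Proof. by rewrite exprZn -scalerAr -scalerAl scalerA -(mulrA (P * X)). Qed.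

Lemma scale_left (F : fieldType) (W : algType F) (c r : F) (P X Y S : W) n :
  c *: (P * (r *: X) ^+ n * Y * S) = (c * r ^+ n) *: (P * X ^+ n * (Y * S)).
Proof. by rewrite exprZn -scalerAr -!scalerAl scalerA -(mulrA (P * X ^+ n)). Qed.

Lemma psi_term_exchange (F : fieldType) (T : algType F) (p r : F) (X X' Y P S : fps T) n :
  fpsT X = r *: X' ->
  psi_term p (fpsT Y) S X P n =
  (tele_coef p ^+ n * ((1 - p ^- 2 ^+ n.+1) / (1 - p ^- 2)) * r ^+ n) *:
    (P * X' ^+ n * (Y ^+ n * S)).
Proof. by move=> XE; rewrite /psi_term fpsT_exchange_middle XE scale_left. Qed.

(** The geometric sum is [p^-n [n+1]], and [tele_coef p * p^2 = - (p - p^-1)^2 p] supplies the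
    compensating [p^n]. *)
Lemma psi_coef (F : fieldType) (p : F) n : p != 0 -> p - p^-1 != 0 ->
  tele_coef p ^+ n * ((1 - p ^- 2 ^+ n.+1) / (1 - p ^- 2)) * p ^+ 2 ^+ n =
  (-1) ^+ n * (p - p^-1) ^+ (2 * n) * qint p n.+1.
Proof.
move=> p0 p1.
have -> : tele_coef p ^+ n * ((1 - p ^- 2 ^+ n.+1) / (1 - p ^- 2)) * p ^+ 2 ^+ n =
    (tele_coef p * p ^+ 2) ^+ n * ((1 - p ^- 2 ^+ n.+1) / (1 - p ^- 2)).
  by rewrite (exprMn n (tele_coef p)) mulrAC.
have -> : tele_coef p * p ^+ 2 = -1 * (p - p^-1) ^+ 2 * p by rewrite /tele_coef; field.
rewrite (exprMn n (-1 * (p - p^-1) ^+ 2)) (exprMn n (-1)) -(exprM _ 2 n) -[LHS]mulrA; congr (_ * _).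
rewrite /qint -exprnN -exprnP -!exprVn -exprM mulnC exprM !(exprS _ n) exprMn.
have r0 : p ^+ n != 0 by rewrite expf_neq0.
have p21 := p2_neq1 p0 p1.
rewrite exprVn; move: (p ^+ n) r0 => r r0.
by field; rewrite ?p0 ?p21 ?r0.
Qed.

Lemma psi_coefV (F : fieldType) (p : F) n : p != 0 -> p - p^-1 != 0 ->
  tele_coef p^-1 ^+ n * ((1 - p^-1 ^- 2 ^+ n.+1) / (1 - p^-1 ^- 2)) * p ^- 2 ^+ n =
  (-1) ^+ n * (p - p^-1) ^+ (2 * n) * qint p n.+1.
Proof.
move=> p0 p1; have pV1 : p^-1 - p^-1^-1 != 0 by rewrite invrK -opprB oppr_eq0.
rewrite -(exprVn p 2) (psi_coef n (invr_neq0 p0) pV1).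
rewrite !exprM invrK -[p^-1 - p]opprB sqrrN; congr (_ * _).
rewrite /qint invrK -[p^-1 - p]opprB invrN mulrN -mulNr opprB.
by rewrite !exprz_inv opprK.
Qed.

Section FpsTens.
Variables (F : fieldType) (A B : algType F).

Lemma fps_tensE (f : fps A) (g : fps B) :
  f ⊠ g = fps_map (@tens_l F A B) f * fps_map (@tens_r F A B) g.
Proof. by apply/funext => n; rewrite fpsM; apply: eq_bigr => i _; rewrite [RHS]tens_lr. Qed.

Lemma fps_tens1l (g : fps B) : (1 : fps A) ⊠ g = fps_map (@tens_r F A B) g.
Proof.
rewrite fps_tensE -[RHS]mul1r; congr (_ * _).
by apply/funext => -[|k]; rewrite /fps_map !fps1 ?rmorph1 ?rmorph0.
Qed.

Lemma fps_tens1r (f : fps A) : f ⊠ (1 : fps B) = fps_map (@tens_l F A B) f.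
Proof.
rewrite fps_tensE -[RHS]mulr1; congr (_ * _).
by apply/funext => -[|k]; rewrite /fps_map !fps1 ?rmorph1 ?rmorph0.
Qed.

End FpsTens.

Section Identities.
Variables (F : fieldType) (q : F) (A : algType F) (g : dgen -> A).
Hypothesis rel : forall u v, drinfeld_rel q g u v -> u = v.
Hypotheses (q0 : q != 0) (q1 : q - q^-1 != 0) (q2 : q + q^-1 != 0).
Hypothesis char0 : forall n, n.+1%:R != 0 :> F.
Local Notation T := (tensor A A).
Local Notation cp := (chalf_pow g).
Variable D : {lrmorphism A -> T}.
Hypothesis D_cp : forall l, D (cp l) = cp l ⊗ cp l.
Hypothesis D_K : forall s, D (half_K g s) = half_K g s ⊗ half_K g s.
Hypothesis D_Kinv : forall s, D (half_Kinv g s) = half_Kinv g s ⊗ half_Kinv g s.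
Hypothesis D_x : forall s, D (half_x g s 0) =
  half_x g s 0 ⊗ half_K g s + cp (sgn_int s - 1) ⊗ half_x g s 0.
Hypothesis D_y : forall s, D (half_y g s 0) =
  half_y g s 0 ⊗ cp (sgn_int s + 1) + half_K g s ⊗ half_y g s 0.

Let atV (r : F) (l : int) (f : fps A) : fps A :=
  fun k => r ^- k *: (cp (- (l * k%:Z)) * f k).
Let atz (r : F) (l : int) (f : fps A) : fps A :=
  fun k => r ^+ k *: (cp (l * k%:Z) * f k).
Let X0p : fps A := fun k => g (Dx k%:Z).
Let Xm : fps A := fun k => if k == 0%N then 0 else g (Dx (- k%:Z)).
Let Yp : fps A := fun k => if k == 0%N then 0 else g (Dy k%:Z).
Let Y0m : fps A := fun k => g (Dy (- k%:Z)).
Let Ps : fps A := fun k => psi_of q g k%:Z.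
Let Ph : fps A := fun k => phi_of q g (- k%:Z).
Let el := fps_map (@tens_l F A A).
Let er := fps_map (@tens_r F A A).

Let pos_first_x : first_x g true = el (atV 1 2 X0p).
Proof.
apply/funext => k; congr tens_l; rewrite /atV /cur_x expr1n invr1 scale1r.
congr (cp _ * _); rewrite /sgn_int; lia.
Qed.

Let pos_first_xt : scaled q (first_x g true) = el (atV (q ^+ 2) 2 X0p).
Proof.
apply/funext => k; rewrite /scaled /el /fps_map /atV linearZ exprM; congr (_ *: tens_l _ (cp _ * _)).
rewrite /sgn_int; lia.
Qed.

Let pos_second_x : second_x g true = er (atV 1 4 X0p).
Proof.
apply/funext => k; congr tens_r; rewrite /atV /cur_x expr1n invr1 scale1r.
congr (cp _ * _); rewrite /sgn_int; lia.
Qed.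

Let pos_second_y : fpsT (second_y g true) = er (atV 1 2 Yp).
Proof.
apply/funext => -[|k]; rewrite /er /fps_map /atV expr1n invr1 scale1r; first by rewrite /= mulr0 rmorph0.
rewrite -[LHS]/(second_y g true k); congr tens_r; rewrite /cur_y; congr (cp _ * _); rewrite /sgn_int; lia.
Qed.

(** The mode [y_{k+1}] is scaled by [q^(-2k)] rather than [q^(-2(k+1))]; the resulting [q^2] turns
    [tele_coef q] into [- q (q - q^-1)^2]. *)
Let pos_second_yt : fpsT (scaled q (second_y g true)) = q ^+ 2 *: er (atV (q ^+ 2) 2 Yp).
Proof.
apply/funext => -[|k]; rewrite fpsZ /er /fps_map /atV; first by rewrite /= mulr0 scaler0 rmorph0 scaler0.
rewrite -[LHS]/(scaled q (second_y g true) k) /scaled linearZ scalerA.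
rewrite (exprS (q ^+ 2) k) invfM mulrA mulfV ?expf_neq0 // mul1r exprM.
congr (_ *: tens_r _ (cp _ * _)); rewrite /sgn_int; lia.
Qed.

Let pos_first_y : fpsT (first_y g true) = el Yp.
Proof.
apply/funext => -[|k]; rewrite /el /fps_map /=; first by rewrite rmorph0.
congr tens_l; rewrite /cur_y (_ : _ + 0 = 0) ?cp0 ?mul1r //; rewrite /sgn_int; lia.
Qed.

Let pos_first_Psi : first_Psi q g true = el (atV 1 1 Ps).
Proof.
apply/funext => k; congr tens_l; rewrite /atV /cur_Psi expr1n invr1 scale1r.
congr (cp _ * _); rewrite /sgn_int; lia.
Qed.

Let pos_second_Psi : second_Psi q g true = er (atV 1 3 Ps).
Proof.
apply/funext => k; congr tens_r; rewrite /atV /cur_Psi expr1n invr1 scale1r.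
congr (cp _ * _); rewrite /sgn_int; lia.
Qed.

Let neg_first_x : fpsT (first_x g false) = el (atz 1 2 Xm).
Proof.
apply/funext => -[|k]; rewrite /el /fps_map /atz expr1n scale1r; first by rewrite /= mulr0 rmorph0.
rewrite -[LHS]/(first_x g false k); congr tens_l; rewrite /cur_x; congr (cp _ * _); rewrite /sgn_int; lia.
Qed.

Let neg_first_xt : fpsT (scaled q^-1 (first_x g false)) = q ^- 2 *: el (atz (q ^+ 2) 2 Xm).
Proof.
apply/funext => -[|k]; rewrite fpsZ /el /fps_map /atz; first by rewrite /= mulr0 scaler0 rmorph0 scaler0.
rewrite -[LHS]/(scaled q^-1 (first_x g false) k) /scaled linearZ scalerA.
rewrite exprVn invrK (exprS (q ^+ 2) k) mulrA mulVf ?expf_neq0 // mul1r exprM.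
congr (_ *: tens_l _ (cp _ * _)); rewrite /sgn_int; lia.
Qed.

Let neg_second_x : fpsT (second_x g false) = er Xm.
Proof.
apply/funext => -[|k]; rewrite /er /fps_map /=; first by rewrite rmorph0.
congr tens_r; rewrite /cur_x (_ : _ + 0 = 0) ?cp0 ?mul1r //; rewrite /sgn_int; lia.
Qed.

Let neg_second_y : second_y g false = er (atz 1 2 Y0m).
Proof.
apply/funext => k; congr tens_r; rewrite /atz /cur_y expr1n scale1r.
congr (cp _ * _); rewrite /sgn_int; lia.
Qed.

Let neg_second_yt : scaled q^-1 (second_y g false) = er (atz (q ^+ 2) 2 Y0m).
Proof.
apply/funext => k; rewrite /scaled /er /fps_map /atz linearZ exprVn invrK exprM.
congr (_ *: tens_r _ (cp _ * _)); rewrite /sgn_int; lia.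
Qed.

Let neg_first_y : first_y g false = el (atz 1 4 Y0m).
Proof.
apply/funext => k; congr tens_l; rewrite /atz /cur_y expr1n scale1r.
congr (cp _ * _); rewrite /sgn_int; lia.
Qed.

Let PhE k : Ph k = half_Psi q g false k.
Proof. by rewrite /Ph /phi_of opprK. Qed.

Let neg_first_Psi : first_Psi q g false = el (atz 1 3 Ph).
Proof.
apply/funext => k; congr tens_l; rewrite /atz /cur_Psi expr1n scale1r PhE.
congr (cp _ * _); rewrite /sgn_int; lia.
Qed.

Let neg_second_Psi : second_Psi q g false = er (atz 1 1 Ph).
Proof.
apply/funext => k; congr tens_r; rewrite /atz /cur_Psi expr1n scale1r PhE.
congr (cp _ * _); rewrite /sgn_int; lia.
Qed.

Let FX s : fps T := first_x g s.
Let FP s : fps T := first_Psi q g s.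
Let SY s : fps T := second_y g s.
Let SP s : fps T := second_Psi q g s.
Let series_x s := @Delta_x_series F q A g rel q0 q1 q2 char0 s D D_cp (D_Kinv s) (D_x s) (D_y s).
Let series_y s := @Delta_y_series F q A g rel q0 q1 q2 char0 s D D_cp (D_Kinv s) (D_x s) (D_y s).
Let series_Psi s :=
  @Delta_Psi_series F q A g rel q0 q1 q2 char0 s D D_cp (D_K s) (D_Kinv s) (D_x s) (D_y s).

Lemma Delta_x_pos :
  exists2 S : fps T,
    fps_has_sum (fun n => (- q * (q - q^-1) ^+ 2) ^+ n *:
      (atV 1 2 X0p ^+ n.+1 ⊠ atV (q ^+ 2) 2 Yp ^+ n * atV 1 3 Ps)) S
  & (fun k : nat => D (g (Dx k%:Z)) * (cp (- (2 * k%:Z)) ⊗ cp (- (4 * k%:Z)))) =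
      1 ⊠ atV 1 4 X0p + S.
Proof.
pose L : fps T := fun k : nat => D (g (Dx k%:Z)) * (cp (- (2 * k%:Z)) ⊗ cp (- (4 * k%:Z))).
(* The sum is defined as what the identity requires; the content is that the partial sums converge
   to it. *)
exists (L - 1 ⊠ atV 1 4 X0p); last by rewrite addrC subrK.
have LE : L = Delta_x g true D.
  by apply/funext => k; congr (_ * (cp _ ⊗ cp _)); rewrite /sgn_int; lia.
apply: has_sum_small => N; rewrite LE fps_tens1l -/er -pos_second_x.
rewrite (eq_bigr (fun n : 'I_N => tele_coef q ^+ n *: (FX true ^+ n.+1 *
  fpsT (scaled q (SY true)) ^+ n * SP true))); first exact: (series_x true).
move=> n _; rewrite fps_tensE fps_mapX fps_mapM fps_mapX -/el -/er -pos_first_x -pos_second_Psi.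
rewrite /FX /SY /SP pos_second_yt exprZn -scalerAr -scalerAl scalerA -exprMn mulrA.
by congr (_ ^+ n *: _); rewrite /tele_coef; field.
Qed.

Lemma Delta_x_neg :
  exists2 S : fps T,
    fps_has_sum (fun n => (- q * (q - q^-1) ^+ 2) ^+ n *:
      (atz 1 2 Xm ^+ n.+1 ⊠ atz (q ^+ 2) 2 Y0m ^+ n * atz 1 1 Ph)) S
  & (fun k : nat => if k == 0%N then 0 else D (g (Dx (- k%:Z))) * (cp (2 * k%:Z) ⊗ 1)) =
      1 ⊠ Xm + S.
Proof.
pose L : fps T := fun k : nat => if k == 0%N then 0 else D (g (Dx (- k%:Z))) * (cp (2 * k%:Z) ⊗ 1).
exists (L - 1 ⊠ Xm); last by rewrite addrC subrK.
have LE : L = fpsT (Delta_x g false D).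
  apply/funext => -[|k] //; rewrite /L -[RHS]/(Delta_x g false D k) -[in LHS](cp0 g).
  by congr (_ * (cp _ ⊗ cp _)); rewrite /sgn_int; lia.
apply: has_sum_small => N; rewrite LE fps_tens1l -/er -neg_second_x.
rewrite (eq_bigr (fun n : 'I_N => fpsT (tele_coef q^-1 ^+ n *: (FX false ^+ n.+1 *
  fpsT (scaled q^-1 (SY false)) ^+ n * SP false)))).
  rewrite -linear_sum -linearD -linearB => k kN; apply: (smallT (N := N)); last exact: ltnW.
  exact: (series_x false).
move=> n _; rewrite linearZ /= fpsT_balance.
rewrite fps_tensE fps_mapX fps_mapM fps_mapX -/el -/er /FX /SY /SP.
rewrite neg_first_x -neg_second_Psi neg_second_yt mulrA.
by congr (_ ^+ n *: _); rewrite /tele_coef invrK -[q^-1 - q]opprB sqrrN.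
Qed.

Lemma Delta_y_pos :
  exists2 S : fps T,
    fps_has_sum (fun n => (- q^-1 * (q - q^-1) ^+ 2) ^+ n *:
      (atV 1 1 Ps * atV (q ^+ 2) 2 X0p ^+ n ⊠ atV 1 2 Yp ^+ n.+1)) S
  & (fun k : nat => if k == 0%N then 0 else D (g (Dy k%:Z)) * (1 ⊗ cp (- (2 * k%:Z)))) =
      Yp ⊠ 1 + S.
Proof.
pose L : fps T := fun k : nat => if k == 0%N then 0 else D (g (Dy k%:Z)) * (1 ⊗ cp (- (2 * k%:Z))).
exists (L - Yp ⊠ 1); last by rewrite addrC subrK.
have LE : L = fpsT (Delta_y g true D).
  apply/funext => -[|k] //; rewrite /L -[RHS]/(Delta_y g true D k) -[in LHS](cp0 g).
  by congr (_ * (cp _ ⊗ cp _)); rewrite /sgn_int; lia.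
apply: has_sum_small => N; rewrite LE fps_tens1r -/el -pos_first_y.
rewrite (eq_bigr (fun n : 'I_N => fpsT (tele_coef q ^+ n *: (FP true *
  (fpsT (scaled q (FX true)) ^+ n * SY true ^+ n.+1))))).
  rewrite -linear_sum -linearD -linearB => k kN; apply: (smallT (N := N)); last exact: ltnW.
  by have := @series_y true N; rewrite tele_sum_rev; apply.
move=> n _; rewrite linearZ /= fpsT_balance_rev.
rewrite fps_tensE fps_mapX fps_mapM fps_mapX -/el -/er /FX /SY /FP pos_first_xt pos_first_Psi pos_second_y.
by rewrite mulrA.
Qed.

Lemma Delta_y_neg :
  exists2 S : fps T,
    fps_has_sum (fun n => (- q^-1 * (q - q^-1) ^+ 2) ^+ n *:
      (atz 1 3 Ph * atz (q ^+ 2) 2 Xm ^+ n ⊠ atz 1 2 Y0m ^+ n.+1)) S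
  & (fun k : nat => D (g (Dy (- k%:Z))) * (cp (4 * k%:Z) ⊗ cp (2 * k%:Z))) =
      atz 1 4 Y0m ⊠ 1 + S.
Proof.
pose L : fps T := fun k : nat => D (g (Dy (- k%:Z))) * (cp (4 * k%:Z) ⊗ cp (2 * k%:Z)).
exists (L - atz 1 4 Y0m ⊠ 1); last by rewrite addrC subrK.
have LE : L = Delta_y g false D.
  by apply/funext => k; congr (_ * (cp _ ⊗ cp _)); rewrite /sgn_int; lia.
apply: has_sum_small => N; rewrite LE fps_tens1r -/el -neg_first_y.
rewrite (eq_bigr (fun n : 'I_N => tele_coef q^-1 ^+ n *: (FP false *
  (fpsT (scaled q^-1 (FX false)) ^+ n * SY false ^+ n.+1)))).
  by have := @series_y false N; rewrite tele_sum_rev; apply.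
move=> n _; rewrite fps_tensE fps_mapX fps_mapM fps_mapX -/el -/er -neg_first_Psi -neg_second_y.
rewrite /FX /SY /FP neg_first_xt exprZn -scalerAl -scalerAr scalerA -exprMn.
congr (_ ^+ n *: _); last by rewrite mulrA.
(* Together with the [q^-2] from [neg_first_xt], this gives the constant [- q^-1 (q - q^-1)^2]. *)
have -> : tele_coef q^-1 = - q * (q - q^-1) ^+ 2.
  by rewrite /tele_coef invrK -[q^-1 - q]opprB sqrrN.
by field; rewrite ?q0.
Qed.

Lemma Delta_Psi_pos :
  fps_has_sum (fun n => ((-1) ^+ n * (q - q^-1) ^+ (2 * n) * qint q n.+1) *:
      (atV 1 1 Ps * atV (q ^+ 2) 2 X0p ^+ n ⊠ atV (q ^+ 2) 2 Yp ^+ n * atV 1 3 Ps))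
    (fun k : nat => D (psi_of q g k%:Z) * (cp (- k%:Z) ⊗ cp (- (3 * k%:Z)))).
Proof.
set u := fun n : nat => _.
pose L : fps T := fun k : nat => D (psi_of q g k%:Z) * (cp (- k%:Z) ⊗ cp (- (3 * k%:Z))).
rewrite -/L; suff : fps_has_sum u (L - 0) by rewrite subr0.
have LE : L = Delta_Psi q g true D.
  by apply/funext => k; congr (_ * (cp _ ⊗ cp _)); rewrite /sgn_int; lia.
apply: has_sum_small => N; rewrite LE add0r.
rewrite (eq_bigr (fun n : 'I_N => psi_term q (fpsT (scaled q (SY true))) (SP true)
  (scaled q (FX true)) (FP true) n)); first exact: (series_Psi true).
move=> n _; rewrite /u /psi_term fps_tensE !fps_mapM !fps_mapX -/el -/er -pos_first_Psi -pos_second_Psi.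
rewrite /FX /SY /SP /FP pos_second_yt pos_first_xt scale_middle.
by congr (_ *: _); rewrite psi_coef.
Qed.

Lemma Delta_Psi_neg :
  fps_has_sum (fun n => ((-1) ^+ n * (q - q^-1) ^+ (2 * n) * qint q n.+1) *:
      (atz 1 3 Ph * atz (q ^+ 2) 2 Xm ^+ n ⊠ atz (q ^+ 2) 2 Y0m ^+ n * atz 1 1 Ph))
    (fun k : nat => D (phi_of q g (- k%:Z)) * (cp (3 * k%:Z) ⊗ cp k%:Z)).
Proof.
set u := fun n : nat => _.
pose L : fps T := fun k : nat => D (phi_of q g (- k%:Z)) * (cp (3 * k%:Z) ⊗ cp k%:Z).
rewrite -/L; suff : fps_has_sum u (L - 0) by rewrite subr0.
have LE : L = Delta_Psi q g false D.
  apply/funext => k; rewrite /L -/(Ph k) PhE.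
  by congr (_ * (cp _ ⊗ cp _)); rewrite /sgn_int; lia.
apply: has_sum_small => N; rewrite LE add0r.
rewrite (eq_bigr (fun n : 'I_N => psi_term q^-1 (fpsT (scaled q^-1 (SY false))) (SP false)
  (scaled q^-1 (FX false)) (FP false) n)); first exact: (series_Psi false).
move=> n _; rewrite /u (psi_term_exchange _ _ _ _ _ neg_first_xt) psi_coefV //; congr (_ *: _).
rewrite fps_tensE !fps_mapM !fps_mapX -/el -/er -neg_first_Psi -neg_second_Psi.
by rewrite /SY neg_second_yt.
Qed.

End Identities.

Theorem theorem2p1 (R : realType) :
  let q : Cq R := qvar R in
  let U := Uhat q in
  forall (DeltaC : {lrmorphism Uq_sl2hat q ->
                      tensor (Uq_sl2hat q) (Uq_sl2hat q)})
    (iso : {lrmorphism Uq_sl2hat q -> U})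
    (Delta : U -> tensor U U),
  chevalley_comul DeltaC ->
  drinfeld_iso iso ->
  (forall u, Delta (iso u) = tens_map iso iso (DeltaC u)) ->
  [/\ exists2 S : fps (tensor U U),
        fps_has_sum
          (fun n => (- q * (q - q^-1) ^+ 2) ^+ n *:
             (at_zV 1 2 (X0plus q) ^+ n.+1
              ⊠ at_zV (q ^+ 2) 2 (Yplus q) ^+ n * at_zV 1 3 (Psi q)))
          S
        & (fun k : nat => Delta (x_ q k%:Z)
             * (cpow q (- (2 * k%:Z)) ⊗ cpow q (- (4 * k%:Z))))
          = 1 ⊠ at_zV 1 4 (X0plus q) + S,
      exists2 S : fps (tensor U U),
        fps_has_sum
          (fun n => (- q * (q - q^-1) ^+ 2) ^+ n *:
             (at_z 1 2 (Xminus q) ^+ n.+1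
              ⊠ at_z (q ^+ 2) 2 (Y0minus q) ^+ n * at_z 1 1 (Phi q)))
          S
        & (fun k : nat => if k == 0%N then 0 else
             Delta (x_ q (- k%:Z)) * (cpow q (2 * k%:Z) ⊗ 1))
          = 1 ⊠ Xminus q + S,
      exists2 S : fps (tensor U U),
        fps_has_sum
          (fun n => (- q^-1 * (q - q^-1) ^+ 2) ^+ n *:
             (at_zV 1 1 (Psi q) * at_zV (q ^+ 2) 2 (X0plus q) ^+ n
              ⊠ at_zV 1 2 (Yplus q) ^+ n.+1))
          S
        & (fun k : nat => if k == 0%N then 0 else
             Delta (y_ q k%:Z) * (1 ⊗ cpow q (- (2 * k%:Z))))
          = Yplus q ⊠ 1 + S,
      exists2 S : fps (tensor U U),
        fps_has_sum
          (fun n => (- q^-1 * (q - q^-1) ^+ 2) ^+ n *: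
             (at_z 1 3 (Phi q) * at_z (q ^+ 2) 2 (Xminus q) ^+ n
              ⊠ at_z 1 2 (Y0minus q) ^+ n.+1))
          S
        & (fun k : nat => Delta (y_ q (- k%:Z))
             * (cpow q (4 * k%:Z) ⊗ cpow q (2 * k%:Z)))
          = at_z 1 4 (Y0minus q) ⊠ 1 + S
    & fps_has_sum
        (fun n => ((-1) ^+ n * (q - q^-1) ^+ (2 * n) * qint q n.+1) *:
           (at_zV 1 1 (Psi q) * at_zV (q ^+ 2) 2 (X0plus q) ^+ n
            ⊠ at_zV (q ^+ 2) 2 (Yplus q) ^+ n * at_zV 1 3 (Psi q)))
        (fun k : nat => Delta (psi_ q k%:Z)
           * (cpow q (- k%:Z) ⊗ cpow q (- (3 * k%:Z)))) /\
      fps_has_sum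
        (fun n => ((-1) ^+ n * (q - q^-1) ^+ (2 * n) * qint q n.+1) *:
           (at_z 1 3 (Phi q) * at_z (q ^+ 2) 2 (Xminus q) ^+ n
            ⊠ at_z (q ^+ 2) 2 (Y0minus q) ^+ n * at_z 1 1 (Phi q)))
        (fun k : nat => Delta (phi_ q (- k%:Z))
           * (cpow q (3 * k%:Z) ⊗ cpow q k%:Z))].
Proof.
move=> q U DeltaC iso Delta [Dep Dem Dk Dcc Dcci]
  [[j _ jK] [ic ici] [ik0 ik1] [iep1 iem1] [iep0 iem0]] DeltaE.
have surj u : exists v, iso v = u by exists (j u).
pose D : {lrmorphism U -> tensor U U} :=
  alg_morphism (transport_linear surj DeltaE) (transport_monoid surj DeltaE).
have rel := @Uhat_rel _ q.
have q0 := qvar_neq0 R; have q1 := qvar_subV R; have q2 := qvar_addV R.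
have char0 := @Cq_char0 R.
have kik := @Uq_kik _ q.
have D_cp := transport_cp surj DeltaE Dcc Dcci ic ici.
have D_K := transport_K rel surj DeltaE Dk ik1.
have D_Kinv := transport_Kinv rel surj DeltaE Dk ik1.
have D_x := transport_x rel kik surj DeltaE Dep Dem Dk ik0 ik1 iep1 iem0.
have D_y := transport_y rel kik surj DeltaE Dep Dem Dk ik0 ik1 iem1 iep0.
split.
- exact: (Delta_x_pos rel q0 q1 q2 char0 (D := D) D_cp D_Kinv D_x D_y).
- exact: (Delta_x_neg rel q0 q1 q2 char0 (D := D) D_cp D_Kinv D_x D_y).
- exact: (Delta_y_pos rel q0 q1 q2 char0 (D := D) D_cp D_Kinv D_x D_y).
- exact: (Delta_y_neg rel q0 q1 q2 char0 (D := D) D_cp D_Kinv D_x D_y).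
- split.
    exact: (Delta_Psi_pos rel q0 q1 q2 char0 (D := D) D_cp D_K D_Kinv D_x D_y).
  exact: (Delta_Psi_neg rel q0 q1 q2 char0 (D := D) D_cp D_K D_Kinv D_x D_y).
Qed.
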